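(* Let $b,r,f$ be fixed analytic data on $[0,1]$ and $\gamma>0$ a fixed constant as in the context, in particular with $r-\tfrac12 b'\ge\gamma$ on $[0,1]$, and let $\varepsilon_2=1$. There exist constants $c_0\in(0,1)$, $\kappa>0$, $\sigma>0$ and $C>0$, all independent of $\varepsilon_1$ and $p$, such that the following holds for all $p\in\mathbb{N}$, $p\ge1$, and all $0<\varepsilon_1\le c_0$ (that is, $\varepsilon_1\ll\varepsilon_2=1$). Let $\omega=\omega_{BL}(\kappa,p)$ be the Spectral Boundary Layer mesh described in the context, let $u$ be the solution of $$-\varepsilon_1u''(x)+b(x)u'(x)+r(x)u(x)=f(x),\quad x\in I=(0,1),\qquad u(0)=u(1)=0,$$ and let $u_p\in V^{\omega}_{p,0}$ be the weak Galerkin solution on the mesh $\omega$, i.e. $\mathcal{A}_p(u_p,v)=(f,v_0)_I$ for all $v=(v_0,v_b)\in V^{\omega}_{p,0}$. Then $$|||u-u_p|||_p\le C\,e^{-\sigma p}.$$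
   Context: Data. $I=(0,1)$, $0<\varepsilon_1\le1$ is a parameter and $\varepsilon_2=1$. The functions $b,r,f$ do not depend on $\varepsilon_1$ and are analytic on $[0,1]$: there are positive constants $C_0,\gamma_b,\gamma_r,\gamma_f$, independent of $\varepsilon_1$, with $\|b^{(n)}\|_{L^\infty(I)}\le C_0\,n!\,\gamma_b^n$, $\|r^{(n)}\|_{L^\infty(I)}\le C_0\,n!\,\gamma_r^n$, $\|f^{(n)}\|_{L^\infty(I)}\le C_0\,n!\,\gamma_f^n$ for all $n\in\mathbb{N}_0$. Moreover $b>0$ and $r\ge0$ on $[0,1]$, and $r-\tfrac12b'\ge\gamma>0$ on $[0,1]$. Mesh. The Spectral Boundary Layer mesh $\omega_{BL}(\kappa,p)$ has nodes $\{0,1\}$ if $\kappa p\varepsilon_1\ge 1/2$, and nodes $\{0,1-\kappa p\varepsilon_1,1\}$ if $\kappa p\varepsilon_1<1/2$. Spaces. For a mesh $\omega:0=x_0<x_1<\dots<x_N=1$ put $I_j=(x_{j-1},x_j)$, $h_j=x_j-x_{j-1}$. Let $\mathcal{M}^\omega$ be the set of pairs $v=(v_0,v_b)\in L^2(I)\times\mathbb{R}^{N+1}$ with $v_0|_{I_j}\in H^1(I_j)$ for all $j$ and $v_b=(v_{b,0},\dots,v_{b,N})$. A function $v\in H^1(I)$ is identified with the element $(v,(v(x_0),\dots,v(x_N)))$ of $\mathcal{M}^\omega$. With $\mathbb{P}_p$ the polynomials of degree at most $p$, let $V^\omega_p=\{v\in\mathcal{M}^\omega: v_0|_{I_j}\in\mathbb{P}_p\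 \forall j\}$, $V^\omega_{p,0}=\{v\in V^\omega_p: v_{b,0}=v_{b,N}=0\}$, and $W^\omega_p=\{w\in L^2(I): w|_{I_j}\in\mathbb{P}_p\ \forall j\}$. Weak derivatives. For $v\in\mathcal{M}^\omega$ and $p\in\mathbb{N}_0$, the weak derivative $D_pv\in W^\omega_p$ and weak convection derivative $D^c_pv\in W^\omega_p$ are the unique elements such that, for all $q\in\mathbb{P}_p$ and $j=1,\dots,N$, $$\int_{I_j}D_pv\,q=-\int_{I_j}v_0q'+v_{b,j}q(x_j)-v_{b,j-1}q(x_{j-1}),$$ $$\int_{I_j}D^c_pv\,q=-\int_{I_j}v_0(bq)'+v_{b,j}(bq)(x_j)-v_{b,j-1}(bq)(x_{j-1}).$$ Bilinear form (with $\varepsilon_2=1$). For $p\ge1$, with $(\cdot,\cdot)_I$ the $L^2(I)$ inner product, $$\mathcal{A}_p(w,v)=\varepsilon_1(D_{p-1}w,D_{p-1}v)_I+\varepsilon_2(D^c_pw,v_0)_I+(rw_0,v_0)_I+S(w,v)+S_c(w,v),$$ $$S(w,v)=\sum_{j=1}^N\sigma_j\Big[(w_0(x_j^-)-w_{b,j})(v_0(x_j^-)-v_{b,j})+(w_0(x_{j-1}^+)-w_{b,j-1})(v_0(x_{j-1}^+)-v_{b,j-1})\Big],$$ $$S_c(w,v)=\sum_{j=1}^N\varepsilon_2b(x_j)(w_0(x_j^-)-w_{b,j})(v_0(x_j^-)-v_{b,j}),$$ where the penalty parameters are $\sigma_j=\varepsilon_1p^2/h_j$ and $x_j^\mp$ denote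 one-sided limits from the left/right. Norm. For $v\in\mathcal{M}^\omega$, $$|||v|||_p^2=\varepsilon_1\|D_{p-1}v\|_{L^2(I)}^2+\|v_0\|_{L^2(I)}^2+S(v,v)+S_c(v,v)+|v|_J^2,\qquad |v|_J^2=\sum_{j=1}^Nw_j\,\varepsilon_2b(x_j)\,(v_0(x_j^-)-v_{b,j})^2,$$ with $w_j=1$ for $j=1,\dots,N-1$ and $w_N=1/2$. *)

(* Defs.v *)
From HB Require Import structures.
From mathcomp Require Import all_boot all_order all_algebra.
From mathcomp Require Import all_classical all_reals all_analysis.

Set Implicit Arguments.
Unset Strict Implicit.
Unset Printing Implicit Defensive.
Import Order.TTheory GRing.Theory Num.Theory.
Import numFieldNormedType.Exports.
Local Open Scope classical_set_scope.
Local Open Scope ring_scope.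

(* Weak Galerkin method for a singularly perturbed convection-diffusion-       *)
(* reaction problem on (0,1).  The convection parameter is fixed to 1 and does *)
(* not appear; [e1] is the diffusion parameter.  Nodes and cells are numbered  *)
(* from 0, so that cell [j : 'I_N] is the interval (x_j, x_(j+1)).             *)

(* [derive1n n b] is only meaningful inside (0,1), [b] being arbitrary outside *)
(* [0,1]; the L^oo(0,1)-bounds are pointwise because the derivatives are       *)
(* continuous.  Such a [b] is analytic up to the boundary.                     *)
Definition analytic01 (R : realType) (C g : R) (b : R -> R) : Prop :=
  {within `[0, 1], continuous b} /\
  forall (n : nat) (x : R), x \in `]0, 1[ ->
    derivable (derive1n n b) x 1 /\ `|derive1n n b x| <= C * n`!%:R * g ^+ n.

Definition bvp_solution (R : realType) (e1 : R) (b r f u : R -> R) : Prop :=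
  [/\ {within `[0, 1], continuous u},
      forall x : R, x \in `]0, 1[ ->
        [/\ derivable u x 1, derivable (derive1 u) x 1 &
            - e1 * derive1n 2 u x + b x * derive1 u x + r x * u x = f x],
      u 0 = 0 & u 1 = 0].

Definition L2 (R : realType) (D : set R) (v : R -> R) : Prop :=
  v \_ D \in Lfun (@lebesgue_measure R) 2%:E.

(* [v] is, on (x, y), the continuous representative of an element of H^1;      *)
(* [g] is its weak derivative.                                                 *)
Definition H1 (R : realType) (x y : R) (v : R -> R) : Prop :=
  L2 `]x, y[ v /\
  exists2 g : R -> R, L2 `]x, y[ g &
    forall s t : R, x < s -> s <= t -> t < y ->
      v t - v s = \int[lebesgue_measure]_(z in `[s, t]) g z.

Record mesh (R : realType) := Mesh {
  cells : nat;
  node : 'I_cells.+1 -> R }.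

Section MeshOf.
Context {R : realType} (om : mesh R).

Definition lidx (j : 'I_(cells om)) : 'I_(cells om).+1 :=
  widen_ord (leqnSn _) j.
Definition ridx (j : 'I_(cells om)) : 'I_(cells om).+1 := lift ord0 j.

Definition mesh_axiom : Prop :=
  [/\ node (ord0 : 'I_(cells om).+1) = 0,
      node (ord_max : 'I_(cells om).+1) = 1 &
      forall j, node (lidx j) < node (ridx j)].

Definition cell (j : 'I_(cells om)) : set R :=
  `]node (lidx j), node (ridx j)[.
Definition hcell (j : 'I_(cells om)) : R := node (ridx j) - node (lidx j).

(* Carrier of the space M^om of pairs (v_0, v_b). *)
Definition wpair : Type := ((R -> R) * ('I_(cells om).+1 -> R))%type.

Definition inM (v : wpair) : Prop :=
  L2 `]0, 1[ v.1 /\ forall j, H1 (node (lidx j)) (node (ridx j)) v.1.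

Definition embed (u : R -> R) : wpair := (u, fun i => u (node i)).

Definition subw (v w : wpair) : wpair :=
  (fun x => v.1 x - w.1 x, fun i => v.2 i - w.2 i).

Definition inV (p : nat) (v : wpair) : Prop :=
  inM v /\ forall j, exists2 q : {poly R}, (size q <= p.+1)%N &
    forall x, cell j x -> v.1 x = q.[x].

Definition inV0 (p : nat) (v : wpair) : Prop :=
  [/\ inV p v, v.2 ord0 = 0 & v.2 ord_max = 0].

(* An element of W_p is given by its polynomial on each cell; [pwfun] is the   *)
(* corresponding function (extended by 0 at the nodes).                        *)
Definition pwpoly : Type := {ffun 'I_(cells om) -> {poly R}}.

Definition inW (p : nat) (d : pwpoly) : Prop :=
  forall j, (size (d j) <= p.+1)%N.

Definition pwfun (d : pwpoly) (x : R) : R :=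
  \sum_(j < cells om) (d j).[x] * \1_(cell j) x.

Definition is_weakD (p : nat) (v : wpair) (d : pwpoly) : Prop :=
  inW p d /\
  forall j (q : {poly R}), (size q <= p.+1)%N ->
    \int[lebesgue_measure]_(x in cell j) (pwfun d x * q.[x]) =
    - (\int[lebesgue_measure]_(x in cell j) (v.1 x * q^`().[x]))
    + v.2 (ridx j) * q.[node (ridx j)] - v.2 (lidx j) * q.[node (lidx j)].

Definition is_weakDc (b : R -> R) (p : nat) (v : wpair) (d : pwpoly) : Prop :=
  inW p d /\
  forall j (q : {poly R}), (size q <= p.+1)%N ->
    let bq x := b x * q.[x] in
    \int[lebesgue_measure]_(x in cell j) (pwfun d x * q.[x]) =
    - (\int[lebesgue_measure]_(x in cell j) (v.1 x * derive1 bq x))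
    + v.2 (ridx j) * bq (node (ridx j)) - v.2 (lidx j) * bq (node (lidx j)).

Definition weakD (p : nat) (v : wpair) : R -> R :=
  pwfun (xget [ffun=> 0] [set d : {ffun 'I_(cells om) -> {poly R}} |
                           is_weakD p v d]).

Definition weakDc (b : R -> R) (p : nat) (v : wpair) : R -> R :=
  pwfun (xget [ffun=> 0] [set d : {ffun 'I_(cells om) -> {poly R}} |
                           is_weakDc b p v d]).

Definition ipI (v w : R -> R) : R :=
  \int[lebesgue_measure]_(x in `]0, 1[) (v x * w x).

(* Differences between one-sided limits of v_0 and v_b at the right and left   *)
(* endpoints of a cell.                                                        *)
Definition rjump (v : wpair) (j : 'I_(cells om)) : R :=
  lim (v.1 x @[x --> (node (ridx j))^'-]) - v.2 (ridx j).
Definition ljump (v : wpair) (j : 'I_(cells om)) : R :=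
  lim (v.1 x @[x --> (node (lidx j))^'+]) - v.2 (lidx j).

Definition penalty (e1 : R) (p : nat) (j : 'I_(cells om)) : R :=
  e1 * p%:R ^+ 2 / hcell j.

Definition stab (e1 : R) (p : nat) (w v : wpair) : R :=
  \sum_(j < cells om)
    penalty e1 p j * (rjump w j * rjump v j + ljump w j * ljump v j).

Definition stabc (b : R -> R) (w v : wpair) : R :=
  \sum_(j < cells om) b (node (ridx j)) * (rjump w j * rjump v j).

Definition bilin (e1 : R) (b r : R -> R) (p : nat) (w v : wpair) : R :=
  e1 * ipI (weakD p.-1 w) (weakD p.-1 v)
  + ipI (weakDc b p w) v.1
  + ipI (fun x => r x * w.1 x) v.1
  + stab e1 p w v + stabc b w v.

Definition jumpsq (b : R -> R) (v : wpair) : R :=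
  \sum_(j < cells om)
    (if j.+1 == cells om then 2^-1 else 1) * b (node (ridx j)) * rjump v j ^+ 2.

Definition wgnorm (e1 : R) (b : R -> R) (p : nat) (v : wpair) : R :=
  Num.sqrt (e1 * ipI (weakD p.-1 v) (weakD p.-1 v) + ipI v.1 v.1
            + stab e1 p v v + stabc b v v + jumpsq b v).

Definition wg_solution (e1 : R) (b r f : R -> R) (p : nat) (up : wpair) : Prop :=
  inV0 p up /\ forall v, inV0 p v -> bilin e1 b r p up v = ipI f v.1.

End MeshOf.

Definition SBLmesh (R : realType) (kappa : R) (p : nat) (e1 : R) : mesh R :=
  if kappa * p%:R * e1 < 2^-1
  then @Mesh R 2 (tnth [tuple 0; 1 - kappa * p%:R * e1; 1])
  else @Mesh R 1 (tnth [tuple 0; 1]).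

Lemma SBLmesh_axiom (R : realType) (kappa : R) (p : nat) (e1 : R) :
  0 < kappa -> (0 < p)%N -> 0 < e1 -> mesh_axiom (SBLmesh kappa p e1).
Proof.
move=> k0 p0 e0.
have h0 : 0 < kappa * p%:R * e1 by rewrite !mulr_gt0 ?ltr0n.
rewrite /SBLmesh; case: ifPn => hk; split => //=.
- case=> [[|[|//]] /= jlt]; rewrite !(tnth_nth 0) /=.
    by rewrite subr_gt0 (lt_trans hk)// invf_lt1 ?ltr1n.
  by rewrite ltrBlDr ltrDl.
- by case=> [[|//] /= jlt]; rewrite !(tnth_nth 0) /=.
Qed.

(* Main.v *)
Require Import Defs.
From HB Require Import structures.
From mathcomp Require Import all_boot all_order all_algebra.
From mathcomp Require Import all_classical all_reals all_analysis.
From mathcomp Require Import measurable_realfun ring lra zify.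
Set Implicit Arguments.
Unset Strict Implicit.
Unset Printing Implicit Defensive.
Import Order.TTheory GRing.Theory Num.Theory.
Import numFieldNormedType.Exports.
Local Open Scope classical_set_scope.
Local Open Scope ring_scope.

(* Write L for the differential operator, eta for a generic quantity C e^(-s p)  *)
(* and h for the width of the layer cell, which is at most 2 kappa p e.          *)
(* The error is measured against a continuous piecewise polynomial P.  In the    *)
(* layer cell u^(k) is bounded by A (K (1/e + m))^k for k up to m ~ p, so after  *)
(* rescaling u' is approximated by gluing Taylor polynomials with Bernstein      *)
(* weights, and P is a primitive; moreover f - L P is small up to the derivative *)
(* of a small polynomial S, because the exact flux e u' - b u is a primitive of  *)
(* smooth data.  In the coarse cell P approximates a partial sum of the          *)
(* expansion of u in powers of e, and the barrier exp(-b0 (1 - x) / e) shows     *)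
(* that the layer component is below eta there.                                  *)
(* Testing the discrete equation with E = u_p - P, the term                      *)
(* (S', E) = -(S, D E) + [S E_b] is absorbed by the diffusion, and the flux jump *)
(* of P at the transition point a is multiplied by E_b(a) = - int_a^1 D E, so    *)
(* that it costs at most eta^2 h / e <= 2 kappa p eta^2.  The polynomial factor  *)
(* p is absorbed by halving the exponential rate.                                *)

(** The stability of the method is uniform in [e]. Tested with the discrete error, the form yields
    the diffusion, the reaction r - b'/2 >= gam, the penalties and half of the upwind jumps. It
    therefore suffices to find a continuous piecewise polynomial P that is close to u and almost
    solves the equation, with error exp(-s p) uniformly in [e].

    Approximation. [approx01] turns a bound (Gam m)^m on an m-th derivative into a polynomial of
    degree O(m) with geometrically small error. In a cell of width h <= 4 m e, the bounds of
    [sol_deriv_bound], which grow like (1/e + m)^k, become bounds of this kind after rescaling.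
    There only u' is approximated, so e P'' has no bound of its own; [layer_flux] shows that the
    residual is nevertheless small up to S' with S a small polynomial ([layer_approx]). In the
    coarse cell the derivatives of u are not uniformly bounded, but those of the truncated expansion
    in powers of [e] are ([reduced_expansion], [smooth_coarse_approx]), and [barrier] compares u
    with the resulting polynomial. [approximant] glues both pieces.

    Discrete part. [cell_lower] combines stability and consistency on one cell, [discrete_error]
    sums over the cells, and [wg_error] adds u - P by the triangle inequality. A division by [e] is
    made only on a cell whose width is O(p e), so it costs a factor p ([wg_error_mesh1],
    [wg_error_mesh2]). On the coarse cell [energy_bound] gives the diffusion energy of u - P without
    such a division. [sqrt_rate] removes the factor p. *)

(** * Derivatives on open intervals *)

Section Calculus.
Context {R : realType}.
Implicit Types (f g : R -> R) (x y a c : R).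

Lemma dD f g x u v : is_derive x 1 f u -> is_derive x 1 g v ->
  is_derive x 1 (fun y => f y + g y) (u + v).
Proof. by move=> hf hg; have := is_deriveD hf hg. Qed.

Lemma dB f g x u v : is_derive x 1 f u -> is_derive x 1 g v ->
  is_derive x 1 (fun y => f y - g y) (u - v).
Proof. by move=> hf hg; have := is_deriveB hf hg. Qed.

Lemma dN f x u : is_derive x 1 f u -> is_derive x 1 (fun y => - f y) (- u).
Proof. by move=> hf; have := is_deriveN hf. Qed.

Lemma dM f g x u v : is_derive x 1 f u -> is_derive x 1 g v ->
  is_derive x 1 (fun y => f y * g y) (u * g x + f x * v).
Proof.
move=> hf hg; have := is_deriveM hf hg.
by rewrite /GRing.scale /= addrC [g x * u]mulrC.
Qed.

Lemma dZ k f x u : is_derive x 1 f u -> is_derive x 1 (fun y => k * f y) (k * u).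
Proof. by move=> hf; have := is_deriveZ k hf. Qed.

Lemma dC (k x : R) : is_derive x 1 (fun=> k) 0.
Proof. exact: is_derive_cst. Qed.

Lemma dI x : is_derive x 1 (fun y => y) 1.
Proof. exact: is_derive_id. Qed.

Lemma dV f x u : f x != 0 -> is_derive x 1 f u ->
  is_derive x 1 (fun y => (f y)^-1) (- u / f x ^+ 2).
Proof.
move=> fx0 hf; have := is_deriveV fx0 hf; rewrite /GRing.scale /= => h.
by apply: (is_derive_eq h); rewrite mulrC mulrN mulNr.
Qed.

Lemma d_compose f g x u v : is_derive x 1 f u -> is_derive (f x) 1 g v ->
  is_derive x 1 (fun y => g (f y)) (v * u).
Proof. by move=> hf hg; exact: (@is_derive1_comp _ g f x v u). Qed.

Lemma dX f x u n : is_derive x 1 f u ->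
  is_derive x 1 (fun y => f y ^+ n.+1) (n.+1%:R * f x ^+ n * u).
Proof.
move=> hf; elim: n => [|n IH].
  by apply: is_derive_eq; rewrite expr0 !mul1r.
rewrite (_ : (fun y => _) = fun y => f y * f y ^+ n.+1); last first.
  by apply/funext => y; rewrite exprS.
by apply: (is_derive_eq (dM hf IH)); rewrite -[in RHS]natr1 !exprS; ring.
Qed.

Lemma dexp x : is_derive x 1 (@expR R) (expR x).
Proof. exact: is_derive_expR. Qed.

Lemma dhorner (p : {poly R}) x : is_derive x 1 (horner p) (p^`()).[x].
Proof.
by rewrite derivE derive1E; apply: derivableP; exact: derivable_horner.
Qed.

Lemma d_cont f x u : is_derive x 1 f u -> {for x, continuous f}.
Proof.
by move=> hf; apply: differentiable_continuous; apply/derivable1_diffP; exact: ex_derive.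
Qed.

Lemma within_continuousB (A : set R) (f g : R -> R) : {within A, continuous f} -> {within A, continuous g} -> {within A, continuous (fun x => f x - g x)}.
Proof. by move=> cf cg x; apply: (@continuousB _ _ (subspace A) f g); [exact: cf| exact: cg]. Qed.

Lemma within_continuousM (A : set R) (f g : R -> R) : {within A, continuous f} -> {within A, continuous g} -> {within A, continuous (fun x => f x * g x)}.
Proof. by move=> cf cg x; apply: (@continuousM _ (subspace A) f g); [exact: cf| exact: cg]. Qed.

Lemma within_continuousC (A : set R) (k : R) : {within A, continuous (fun _ : R => k)}.
Proof. by move=> x; exact: cvg_cst. Qed.

Lemma d_derive1 f x u : is_derive x 1 f u -> derive1 f x = u.
Proof. by move=> hf; rewrite derive1E derive_val. Qed.

Lemma derive1_d f x : derivable f x 1 -> is_derive x 1 f (derive1 f x).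
Proof. by move=> h; rewrite derive1E; exact: derivableP. Qed.

Lemma near_oo a c x : a < x -> x < c -> \forall y \near x, a < y < c.
Proof.
move=> ax xc; have : x \in `]a, c[ by rewrite in_itv /= ax.
by move/near_in_itvoo; apply: filterS => y; rewrite in_itv.
Qed.

Lemma d_ext f g a c x u : a < x -> x < c ->
  (forall y, a < y -> y < c -> f y = g y) -> is_derive x 1 f u -> is_derive x 1 g u.
Proof.
move=> ax xc fg; apply: near_eq_is_derive.
by apply: filterS (near_oo ax xc) => y /andP[? ?]; exact: fg.
Qed.

(** The derivative is a second function, so that jets, primitives and polynomials are treated alike;
    nothing is asked at the endpoints. *)
Definition derOn a c f g := forall x, a < x -> x < c -> is_derive x 1 f (g x).

Lemma derOn_cont a c f g s t : derOn a c f g -> a < s -> t < c ->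
  {within `[s, t], continuous f}.
Proof.
move=> h als tc; apply: continuous_in_subspaceT => x.
rewrite inE /= in_itv /= => /andP[sx xt].
exact: (d_cont (h _ (lt_le_trans als sx) (le_lt_trans xt tc))).
Qed.

(** The jets are controlled only inside the interval, hence this version without endpoints; [lip_cc]
    is for functions continuous up to them. *)
Lemma lip_oo a c f g M : derOn a c f g ->
  (forall x, a < x -> x < c -> `|g x| <= M) ->
  forall x y, a < x -> x < c -> a < y -> y < c -> `|f x - f y| <= M * `|x - y|.
Proof.
move=> h gM.
have H x y : a < x -> x < y -> y < c -> `|f y - f x| <= M * `|y - x|.
  move=> ax xy yc.
  have [] := @MVT _ f g x y xy.
  - move=> z; rewrite in_itv /= => /andP[xz zy].
    exact: (h _ (lt_trans ax xz) (lt_trans zy yc)).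
  - exact: (derOn_cont h).
  - move=> z; rewrite in_itv /= => /andP[xz zy] ->.
    rewrite normrM ler_wpM2r //; apply: gM; [exact: (lt_trans ax)|exact: (lt_trans zy)].
move=> x y ax xc ay yc; case: (ltgtP x y) => [xy|yx|->].
- by rewrite distrC [`|x - y|]distrC H.
- exact: H.
- by rewrite !subrr normr0 mulr0.
Qed.

Lemma lip_cc a c f g M : {within `[a, c], continuous f} -> derOn a c f g ->
  (forall x, a < x -> x < c -> `|g x| <= M) ->
  forall x y, a <= x -> x <= c -> a <= y -> y <= c -> `|f x - f y| <= M * `|x - y|.
Proof.
move=> cf h gM.
have H x y : a <= x -> x < y -> y <= c -> `|f y - f x| <= M * `|y - x|.
  move=> ax xy yc.
  have [] := @MVT _ f g x y xy.
  - move=> z; rewrite in_itv /= => /andP[xz zy].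
    exact: (h _ (le_lt_trans ax xz) (lt_le_trans zy yc)).
  - by apply: continuous_subspaceW cf => z /=; rewrite !in_itv /= => /andP[xz zy];
    rewrite (le_trans ax xz) (le_trans zy yc).
  - move=> z; rewrite in_itv /= => /andP[xz zy] ->.
    rewrite normrM ler_wpM2r //; apply: gM; [exact: (le_lt_trans ax)|exact: (lt_le_trans zy)].
move=> x y ax xc ay yc; case: (ltgtP x y) => [xy|yx|->].
- by rewrite distrC [`|x - y|]distrC H.
- exact: H.
- by rewrite !subrr normr0 mulr0.
Qed.

(* The Leibniz sum, so that [leib X Y n] is the n-th derivative of [X 0 * Y 0]. *)
Definition leib (X Y : nat -> R -> R) n x : R :=
  \sum_(j < n.+1) 'C(n, j)%:R * (X (n - j)%N x * Y j x).

Lemma leib0 X Y x : leib X Y 0 x = X 0 x * Y 0 x.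
Proof. by rewrite /leib big_ord_recl big_ord0 /= bin0 mul1r addr0 subn0. Qed.

Lemma d_sum n (F : 'I_n -> R -> R) (G : 'I_n -> R) x :
  (forall i, is_derive x 1 (F i) (G i)) ->
  is_derive x 1 (fun y => \sum_(i < n) F i y) (\sum_(i < n) G i).
Proof.
elim: n F G => [|n IH] F G h.
  rewrite big_ord0; apply: (is_derive_eq _ erefl).
  by rewrite (_ : (fun y => _) = fun=> 0); [exact: dC|apply/funext => y; rewrite big_ord0].
rewrite big_ord_recr (_ : (fun y => _) = fun y => \sum_(i < n) F (widen_ord (leqnSn n) i) y + F ord_max y).
  by apply: dD => //; exact: (IH (fun i => F (widen_ord (leqnSn n) i)) (fun i => G (widen_ord (leqnSn n) i))).
by apply/funext => y; rewrite big_ord_recr.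
Qed.

(** Pascal's rule. Derivatives are required only up to the order that occurs and only at x, so that
    regularity can be proved by induction on the order. *)
Lemma leib_d X Y n x :
  (forall k, (k <= n)%N -> is_derive x 1 (X k) (X k.+1 x)) ->
  (forall k, (k <= n)%N -> is_derive x 1 (Y k) (Y k.+1 x)) ->
  is_derive x 1 (leib X Y n) (leib X Y n.+1 x).
Proof.
move=> hX hY.
have := @d_sum n.+1 (fun j y => 'C(n, j)%:R * (X (n - j)%N y * Y j y))
  (fun j => 'C(n, j)%:R * (X (n - j).+1 x * Y j x + X (n - j)%N x * Y j.+1 x)) x.
move=> /(_ _)/is_derive_eq; apply.
  by move=> j; apply: dZ; apply: dM; [apply: hX; exact: leq_subr|apply: hY; rewrite -ltnS].
under eq_bigr do rewrite mulrDr.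
rewrite big_split /= [RHS]big_ord_recl /= bin0 subn0.
under [in RHS]eq_bigr => i _ do rewrite /bump /= add1n binS natrD mulrDl subSS.
rewrite big_split /= addrA; congr (_ + _).
rewrite [in RHS]big_ord_recr /= bin_small // mul0r addr0.
rewrite big_ord_recl /= bin0 subn0; congr (_ + _).
by apply: eq_bigr => i _; rewrite /bump /= add1n subnSK.
Qed.

End Calculus.

(** * Polynomial approximation of functions with geometric derivative bounds *)

Section Approximation.
Context {R : realType}.
Implicit Types (G : nat -> R -> R) (x y l : R).

Lemma poly_antideriv (p : {poly R}) (x0 y0 : R) :
  exists P : {poly R}, [/\ P^`() = p, (size P <= (size p).+1)%N & P.[x0] = y0].
Proof.
pose P0 : {poly R} := \poly_(i < (size p).+1) (p`_i.-1 / i%:R).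
have dP0 : P0^`() = p.
  apply/polyP => i; rewrite coef_deriv coef_poly ltnS /=.
  case: ltnP => [ip|pi].
    by rewrite -[LHS]mulr_natr divfK // pnatr_eq0.
  by rewrite mul0rn nth_default.
exists (P0 + (y0 - P0.[x0])%:P); split.
- by rewrite derivD derivC addr0.
- apply: leq_trans (size_polyD _ _) _; rewrite geq_max size_poly /=.
  exact: leq_trans (size_polyC_leq1 _) _.
- by rewrite hornerD hornerC addrC subrK.
Qed.

(** Differentiating in the base point y telescopes the sum; only the top order survives. *)
Lemma taylor_sum_d G m (a c x y : R) : (forall k, (k <= m)%N -> derOn a c (G k) (G k.+1)) ->
  a < y -> y < c ->
  is_derive y 1 (fun y => \sum_(j < m.+1) G j y * (x - y) ^+ j / j`!%:R)
    (G m.+1 y * (x - y) ^+ m / m`!%:R).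
Proof.
move=> + ay yc; elim: m => [|m IH] h.
  apply: (is_derive_eq (f' := G 1%N y)); last by rewrite expr0 fact0 divr1 mulr1.
  rewrite (_ : (fun y => _) = G 0%N); first exact: h.
  by apply/funext => z; rewrite big_ord_recl big_ord0 expr0 fact0 divr1 mulr1 addr0.
rewrite (_ : (fun y => _) = fun y => \sum_(j < m.+1) G j y * (x - y) ^+ j / j`!%:R
   + (m.+1`!%:R)^-1 * (G m.+1 y * (x - y) ^+ m.+1)); last first.
  by apply/funext => z; rewrite big_ord_recr /= [X in _ + X = _]mulrC.
have hp : is_derive y 1 (fun y => (x - y) ^+ m.+1) (- (m.+1%:R * (x - y) ^+ m)).
  apply: (is_derive_eq (dX m (dB (dC x y) (dI y)))); ring.
have := dD (IH (fun k km => h k (leqW km))) (dZ (m.+1`!%:R)^-1 (dM (h m.+1 (leqnn _) y ay yc) hp)).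
move/is_derive_eq; apply.
have f0 : m`!%:R != 0 :> R by rewrite pnatr_eq0 -lt0n fact_gt0.
have m0 : m.+1%:R != 0 :> R by rewrite pnatr_eq0.
by rewrite factS natrM; field; rewrite f0 /= nat1r.
Qed.

(** Mean value theorem for the Taylor sum as a function of its base point. Compared with the
    Lagrange remainder this loses a factor m + 1, which is harmless here. *)
Lemma taylor_oo G m (a c M x y : R) :
  (forall k, (k <= m)%N -> derOn a c (G k) (G k.+1)) ->
  (forall z, a < z -> z < c -> `|G m.+1 z| <= M) ->
  a < x -> x < c -> a < y -> y < c ->
  `|G 0%N x - \sum_(j < m.+1) G j y * (x - y) ^+ j / j`!%:R| <=
    M * `|x - y| ^+ m.+1 / m`!%:R.
Proof.
move=> h hM ax xc ay yc.
pose phi z := \sum_(j < m.+1) G j z * (x - z) ^+ j / j`!%:R.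
pose dphi z := G m.+1 z * (x - z) ^+ m / m`!%:R.
have dp z : a < z -> z < c -> is_derive z 1 phi (dphi z) by move=> az zc; exact: (@taylor_sum_d G m a c x z h az zc).
have phix : phi x = G 0%N x.
  rewrite /phi big_ord_recl /= expr0 fact0 divr1 mulr1 big1 ?addr0 // => i _.
  by rewrite subrr expr0n /= mulr0 mul0r.
have M0 : 0 <= M by apply: le_trans (hM x ax xc).
rewrite -phix exprSr.
have B z : a < z -> z < c -> `|x - z| <= `|x - y| -> `|dphi z| <= M * `|x - y| ^+ m / m`!%:R.
  move=> az zc zy; rewrite /dphi !normrM normrX normfV [`|m`!%:R|]ger0_norm //.
  rewrite ler_wpM2r ?invr_ge0 // ler_pM ?exprn_ge0 //; first exact: hM.
  by rewrite lerXn2r ?nnegrE.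
have -> : M * (`|x - y| ^+ m * `|x - y|) / m`!%:R = M * `|x - y| ^+ m / m`!%:R * `|x - y|.
  by rewrite !mulrA [RHS]mulrAC.
have cont s t : a < s -> t < c -> {within `[s, t], continuous phi}.
  exact: (@derOn_cont _ a c phi dphi).
rewrite -/(phi y); case: (ltgtP x y) => [xy|yx|->].
- apply: (@lip_cc _ x y phi dphi); rewrite ?lexx ?(ltW xy) //.
  + exact: cont.
  + by move=> z xz zy; apply: dp; [exact: lt_trans xz|exact: lt_trans yc].
  + move=> z xz zy; apply: B; [exact: lt_trans xz|exact: lt_trans yc|].
    by rewrite !ltr0_norm; lra.
- apply: (@lip_cc _ y x phi dphi); rewrite ?lexx ?(ltW yx) //.
  + exact: cont.
  + by move=> z xz zy; apply: dp; [exact: lt_trans xz|exact: lt_trans xc].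
  + move=> z xz zy; apply: B; [exact: lt_trans xz|exact: lt_trans xc|].
    by rewrite !gtr0_norm; lra.
- by rewrite !(subrr, normr0, mulr0).
Qed.

Lemma expr_le_fact_exp m x : 0 <= x -> x ^+ m <= m`!%:R * expR x.
Proof.
move=> x0; case: m => [|m].
  by rewrite expr0 fact0 mul1r; have := expR_ge1Dx x; lra.
have f0 : 0 < m.+1`!%:R :> R by rewrite ltr0n fact_gt0.
rewrite mulrC -ler_pdivrMr //; have := @expR_ge1Dxn R x m x0; lra.
Qed.

Lemma expR_le_quad l : `|l| <= 2^-1 -> expR l <= 1 + l + 2 * l ^+ 2.
Proof.
rewrite ler_norml => /andP[l1 l2].
have h := expR_ge1Dx (- l); have p : 0 < 1 - l by lra.
have : expR l <= (1 - l)^-1 by rewrite -[l in leLHS]opprK expRN lef_pV2 ?posrE ?expR_gt0.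
move/le_trans; apply; rewrite -[leLHS]mul1r ler_pdivrMr //.
by rewrite expr2; nra.
Qed.

(** The binomial probability of k successes in n trials with success probability x. *)
Definition bern n k x : R := 'C(n, k)%:R * (x ^+ k * (1 - x) ^+ (n - k)).

Lemma bern_ge0 n k x : 0 <= x -> x <= 1 -> 0 <= bern n k x.
Proof. by move=> x0 x1; rewrite /bern !mulr_ge0 ?exprn_ge0 ?subr_ge0. Qed.

Lemma bern_mgf n x s : \sum_(k < n.+1) bern n k x * s ^+ k = (1 - x + x * s) ^+ n.
Proof.
rewrite exprDn; apply: eq_bigr => k _; rewrite /bern exprMn.
by rewrite -[RHS]mulr_natl; ring.
Qed.

Lemma bern_sum1 n x : \sum_(k < n.+1) bern n k x = 1.
Proof.
by have := bern_mgf n x 1; rewrite mulr1 subrK expr1n => <-; apply: eq_bigr => k _; rewrite expr1n mulr1.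
Qed.

(** The centred exponential moment is the n-th power of that of one trial, (1 - x + x e^l) e^(-l x),
    and this is at most exp(2 l^2) by [expR_le_quad]. *)
Lemma bern_exp n x l : 0 <= x -> x <= 1 -> `|l| <= 2^-1 ->
  \sum_(k < n.+1) bern n k x * expR (l * (k%:R - n%:R * x)) <= expR (n%:R * (2 * l ^+ 2)).
Proof.
move=> x0 x1 hl.
have -> : \sum_(k < n.+1) bern n k x * expR (l * (k%:R - n%:R * x)) =
   ((1 - x + x * expR l) * expR (- (l * x))) ^+ n.
  rewrite exprMn -bern_mgf mulr_suml; apply: eq_bigr => k _.
  rewrite -[RHS]mulrA; congr (_ * _); rewrite -(expRM_natl k l) -(expRM_natl n) -expRD; congr expR; ring.
rewrite expRM_natl; apply: lerXn2r; rewrite ?nnegrE ?expR_ge0 //.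
  apply: mulr_ge0 (expR_ge0 _); rewrite addr_ge0 ?subr_ge0 //.
  by rewrite mulr_ge0 ?expR_ge0.
have -> : 2 * l ^+ 2 = 2 * l ^+ 2 + l * x + - (l * x) by ring.
rewrite expRD ler_wpM2r ?expR_ge0 //.
have h : 1 - x + x * expR l <= 1 + (2 * l ^+ 2 + l * x).
  have h1 : x * expR l <= x * (1 + l + 2 * l ^+ 2) by rewrite ler_wpM2l // expR_le_quad.
  have := sqr_ge0 l; nra.
exact: le_trans h (expR_ge1Dx _).
Qed.

Lemma bern_exp_abs n x l : 0 <= x -> x <= 1 -> `|l| <= 2^-1 ->
  \sum_(k < n.+1) bern n k x * expR (`|l| * `|k%:R - n%:R * x|) <=
  2 * expR (n%:R * (2 * l ^+ 2)).
Proof.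
move=> x0 x1 hl.
have h1 := @bern_exp n x l x0 x1 hl.
have h2 := @bern_exp n x (- l) x0 x1; rewrite normrN sqrrN in h2.
have h3 := lerD h1 (h2 hl); rewrite -big_split /= in h3.
rewrite mulr2n mulrDl mul1r; apply: le_trans h3.
apply: ler_sum => k _; rewrite -mulrDr ler_wpM2l ?bern_ge0 //.
rewrite -normrM mulNr; set t := l * _.
have := expR_ge0 t; have := expR_ge0 (- t).
by case: (lerP 0 t) => ht; [rewrite (ger0_norm ht)|rewrite (ltr0_norm ht)]; lra.
Qed.

(* The approximant glues the Taylor polynomials at the points (k+1)/(n+2) with
   the Bernstein weights of degree n = nu^2 m; the exponential moments of the
   binomial distribution bound the weighted Taylor remainders. *)
Lemma approx01 G m nu (M0 Gam : R) : (0 < m)%N -> (1 < nu)%N ->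
  0 <= M0 -> 0 <= Gam ->
  (forall k, (k < m)%N -> derOn 0 1 (G k) (G k.+1)) ->
  (forall x, 0 < x -> x < 1 -> `|G m x| <= M0 * (Gam * m%:R) ^+ m) ->
  exists2 q : {poly R}, (size q <= nu ^ 2 * m + m)%N &
    forall x, 0 < x -> x < 1 ->
      `|G 0%N x - q.[x]| <= 2 * expR 1 * M0 * (2 * expR 2 * Gam / nu%:R) ^+ m.
Proof.
case: m => // m _ nu1 hM0 hGam hG hGm.
have [n En] : exists n, n = (nu ^ 2 * m.+1)%N by eexists.
rewrite -En.
(* These nodes, unlike k/n, stay strictly inside (0,1), where the bounds on G hold. *)
pose cc (k : nat) : R := k.+1%:R / n.+2%:R.
have n20 : 0 < n.+2%:R :> R by rewrite ltr0n.
have nn2 : n%:R <= n.+2%:R :> R by rewrite ler_nat !leqW.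
have cc0 k : 0 < cc k by rewrite divr_gt0.
have cc1 (k : 'I_n.+1) : cc k < 1.
  by rewrite ltr_pdivrMr // mul1r ltr_nat; have := ltn_ord k; lia.
pose T k : {poly R} := \sum_(j < m.+1) (G j (cc k) / j`!%:R) *: ('X - (cc k)%:P) ^+ j.
pose q : {poly R} := \sum_(k < n.+1) ('C(n, k)%:R *: ('X ^+ k * (1 - 'X) ^+ (n - k))) * T k.
have sX (e : nat) (p : {poly R}) : (size p <= 2)%N -> (size (p ^+ e) <= e.+1)%N.
  move=> p2; apply: leq_trans (size_poly_exp_leq _ _) _; rewrite ltnS.
  by apply: leq_trans (_ : 1 * e <= _)%N; [rewrite leq_mul2r; apply/orP; right; lia|rewrite mul1n].
have s1X : (size ((1 - 'X)%R : {poly R}) <= 2)%N.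
  by rewrite -opprB size_polyN size_XsubC.
exists q.
  apply: leq_trans (size_sum _ _ _) _; apply/bigmax_leqP => k _.
  apply: leq_trans (size_polyMleq _ _) _.
  have h1 : (size (('C(n, k)%:R *: ('X ^+ k * (1 - 'X) ^+ (n - k)))%R : {poly R}) <= n.+1)%N.
    apply: leq_trans (size_scale_leq _ _) _; apply: leq_trans (size_polyMleq _ _) _.
    rewrite size_polyXn; move: (sX (n - k)%N _ s1X) (ltn_ord k).
    move: (nat_of_ord k) (size _) => i z; clear; lia.
  have h2 : (size (T k) <= m.+1)%N.
    apply: leq_trans (size_sum _ _ _) _; apply/bigmax_leqP => j _.
    apply: leq_trans (size_scale_leq _ _) _; apply: leq_trans (sX j _ _) _.
      by rewrite size_XsubC.
    exact: ltn_ord.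
  lia.
move=> x x0 x1.
have Tx k : (T k).[x] = \sum_(j < m.+1) G j (cc k) * (x - cc k) ^+ j / j`!%:R.
  rewrite /T horner_sum; apply: eq_bigr => j _.
  by rewrite !hornerE; ring.
have qx : q.[x] = \sum_(k < n.+1) bern n k x * (T k).[x].
  rewrite /q horner_sum; apply: eq_bigr => k _.
  by rewrite /bern !hornerE.
have -> : G 0%N x = \sum_(k < n.+1) bern n k x * G 0%N x.
  by rewrite -mulr_suml bern_sum1 mul1r.
rewrite qx -sumrB.
apply: le_trans (ler_norm_sum _ _ _) _.
(* With n = nu^2 m and l = 1/nu, the exponential moment is only exp(2 m), while powers of n l = nu m
   appear in the denominator: this produces the ratio Gam / nu. *)
set l : R := nu%:R^-1.
have nu0 : 0 < nu%:R :> R by rewrite ltr0n; lia.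
have l0 : 0 < l by rewrite invr_gt0.
have l12 : `|l| <= 2^-1 by rewrite gtr0_norm // lef_pV2 ?posrE // ler_nat.
have nl : n%:R * l = nu%:R * m.+1%:R.
  by rewrite En /l natrM natrX; field; rewrite gt_eqF.
have nl2 : n%:R * (2 * l ^+ 2) = 2 * m.+1%:R.
  by rewrite En /l natrM natrX; field; rewrite gt_eqF.
set K := M0 * (Gam * m.+1%:R) ^+ m.+1.
have K0 : 0 <= K by rewrite mulr_ge0 ?exprn_ge0 ?mulr_ge0.
have f0 : 0 < m`!%:R :> R by rewrite ltr0n fact_gt0.
have m10 : 0 < m.+1%:R :> R by [].
have nl0 : 0 < n%:R * l by rewrite nl mulr_gt0.
set Z := K * m.+1%:R / (n%:R * l) ^+ m.+1 * expR 1.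
have Z0 : 0 <= Z.
  by rewrite /Z; apply: mulr_ge0 (expR_ge0 _); apply: divr_ge0; [exact: mulr_ge0|rewrite exprn_ge0 ?ltW].
have step (k : 'I_n.+1) : `|bern n k x * G 0%N x - bern n k x * (T k).[x]| <=
   Z * (bern n k x * expR (`|l| * `|k%:R - n%:R * x|)).
  rewrite -mulrBr normrM (ger0_norm (bern_ge0 _ _ (ltW x0) (ltW x1))) mulrCA.
  rewrite ler_wpM2l ?(bern_ge0 _ _ (ltW x0) (ltW x1)) // Tx.
  apply: le_trans (taylor_oo (M := K) (a := 0) (c := 1) _ _ x0 x1 (cc0 k) (cc1 k)) _.
  - by move=> i im; exact: hG.
  - by move=> z z0 z1; exact: hGm.
  have -> : Z * expR (`|l| * `|k%:R - n%:R * x|) = K * (m.+1%:R / (n%:R * l) ^+ m.+1 *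
      (expR 1 * expR (`|l| * `|k%:R - n%:R * x|))) by rewrite /Z; ring.
  rewrite -[leLHS]mulrA ler_wpM2l // ler_pdivrMr //.
  have e0 : 0 < (n%:R * l) ^+ m.+1 by rewrite exprn_gt0.
  (* The power of |x - c_k| is traded for a factorial times exp t, and t differs from l |k - n x| by
     at most 1, so the exponential moment applies. *)
  set t := l * `|n.+2%:R * (x - cc k)|.
  have t0 : 0 <= t by rewrite mulr_ge0 // ltW.
  have tle : t <= 1 + `|l| * `|k%:R - n%:R * x|.
    rewrite /t (gtr0_norm l0).
    have -> : n.+2%:R * (x - cc k) = - (k%:R - n%:R * x) + (2 * x - 1).
      rewrite /cc.
      have e2 : n.+2%:R = n%:R + 2 :> R by rewrite -addn2 natrD.
      have e1 : (nat_of_ord k).+1%:R = k%:R + 1 :> R by rewrite -addn1 natrD.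
      have e3 : n%:R + 2 != 0 :> R by rewrite -e2 gt_eqF.
      rewrite e2 e1.
      move: (n%:R) (k%:R) e3 => N K1 e3.
      by field.
    have h1 := ler_normD (- (k%:R - n%:R * x)) (2 * x - 1); rewrite normrN in h1.
    have h2 : `|2 * x - 1| <= 1 by rewrite ler_norml; lra.
    have h3 : l <= 1 by move: l12; rewrite gtr0_norm //; lra.
    nra.
  have h1 := expr_le_fact_exp m.+1 t0.
  have h2 : expR t <= expR 1 * expR (`|l| * `|k%:R - n%:R * x|) by rewrite -expRD ler_expR.
  have h3 : `|x - cc k| ^+ m.+1 * (n%:R * l) ^+ m.+1 <= t ^+ m.+1.
    rewrite -exprMn lerXn2r ?nnegrE ?mulr_ge0 ?(ltW l0) //.
    rewrite /t normrM [`|n.+2%:R|]gtr0_norm // mulrC [n%:R * l]mulrC -mulrA.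
    by apply: ler_wpM2l (ltW l0) _ _ _; apply: ler_wpM2r nn2; exact: normr_ge0.
  rewrite -(ler_pM2r e0).
  apply: le_trans h3 _; apply: le_trans h1 _; rewrite factS natrM.
  have -> : m.+1%:R / (n%:R * l) ^+ m.+1 * (expR 1 * expR (`|l| * `|k%:R - n%:R * x|)) * m`!%:R *
     (n%:R * l) ^+ m.+1 = m.+1%:R * m`!%:R * (expR 1 * expR (`|l| * `|k%:R - n%:R * x|)).
    by field; rewrite gt_eqF.
  by rewrite ler_wpM2l // mulr_ge0 // ltW.
apply: le_trans (ler_sum _ (fun k _ => step k)) _.
rewrite -mulr_sumr.
apply: le_trans (ler_wpM2l Z0 (bern_exp_abs n (ltW x0) (ltW x1) l12)) _.
rewrite nl2 mulrC [2 * m.+1%:R]mulrC expRM_natl /Z nl /K.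
(* The remaining factor m is absorbed by the 2 inside the final power. *)
have m2 : m.+1%:R <= 2 ^+ m.+1 :> R by rewrite -natrX ler_nat ltnW // ltn_expl.
have -> : 2 * expR 2 ^+ m.+1 * (M0 * (Gam * m.+1%:R) ^+ m.+1 * m.+1%:R /
    (nu%:R * m.+1%:R) ^+ m.+1 * expR 1) =
  2 * expR 1 * M0 * (m.+1%:R * (expR 2 * Gam / nu%:R) ^+ m.+1).
  rewrite !exprMn !exprVn; field.
  by rewrite !expf_neq0 ?gt_eqF.
rewrite ler_wpM2l ?mulr_ge0 ?expR_ge0 //.
rewrite -[2 * expR 2 * Gam / nu%:R]mulrA -[2 * expR 2 * _]mulrA [leRHS]exprMn.
rewrite [expR 2 * (_ / _)]mulrA ler_wpM2r // exprn_ge0 //.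
by rewrite divr_ge0 ?mulr_ge0 ?expR_ge0 // ltW.
Qed.

End Approximation.

(** * Derivative bounds for the solution *)

Section Regularity.
Context {R : realType}.
Implicit Types (X Y : nat -> R -> R) (x y s : R).

Definition jet01 (X : nat -> R -> R) := forall n, derOn 0 1 (X n) (X n.+1).

Definition jetof (f : R -> R) (n : nat) : R -> R := derive1n n f.

Definition geom_bound (C g : R) X := forall n x, 0 < x -> x < 1 ->
  `|X n x| <= C * n`!%:R * g ^+ n.

Lemma analytic01_jet (C g : R) (b : R -> R) : analytic01 C g b -> jet01 (jetof b).
Proof.
move=> [_ h] n x x0 x1; have [] := h n x; first by rewrite in_itv /= x0.
by move=> /derive1_d.
Qed.

Lemma analytic01_bound (C g g' : R) (b : R -> R) : 0 <= C -> 0 <= g -> g <= g' ->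
  analytic01 C g b -> geom_bound C g' (jetof b).
Proof.
move=> C_ge0 g0 gg' [_ h] n x x0 x1; have [] := h n x; first by rewrite in_itv /= x0.
move=> _ /le_trans; apply; apply: ler_wpM2l; first by rewrite mulr_ge0.
by apply: lerXn2r; rewrite ?nnegrE // (le_trans g0).
Qed.

(** A geometric sum of ratio a/s <= 1/2. Every term has at least one factor a, which the second
    estimate keeps. *)
Lemma geo_sum_le (a s : R) n : 0 <= a -> 2 * a <= s ->
  (\sum_(j < n) a ^+ (n - j) * s ^+ j <= s ^+ n) /\
  s * (\sum_(j < n) a ^+ (n - j) * s ^+ j) <= 2 * a * s ^+ n.
Proof.
move=> a0 as2; have s0 : 0 <= s by lra.
elim: n => [|n [IH _]].
  by rewrite big_ord0 !expr0; split; lra.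
have E : \sum_(j < n.+1) a ^+ (n.+1 - j) * s ^+ j =
    a * (\sum_(j < n) a ^+ (n - j) * s ^+ j + s ^+ n).
  rewrite big_ord_recr /= subSnn expr1 mulrDr; congr (_ + _).
  rewrite mulr_sumr; apply: eq_bigr => j _.
  by rewrite mulrA -exprS subSn // ltnW.
have sn : 0 <= s ^+ n by rewrite exprn_ge0.
rewrite E; set S := \sum_(j < n) _ in IH *.
have h : a * (S + s ^+ n) <= 2 * a * s ^+ n by nra.
split; last by rewrite exprS; nra.
by apply: le_trans h _; rewrite exprS ler_wpM2r.
Qed.

Lemma bin_fact_le n j (t : R) : (j <= n)%N -> n%:R <= t ->
  'C(n, j)%:R * (n - j)`!%:R <= t ^+ (n - j).
Proof.
move=> jn nt; rewrite -natrM -bin_sub // bin_ffact.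
have h m : (n ^_ m <= n ^ m)%N.
  elim: m => // m IH; rewrite ffactnSr expnSr; apply: leq_mul => //; exact: leq_subr.
apply: le_trans (_ : (n ^ (n - j))%:R <= _); first by rewrite ler_nat.
by rewrite natrX lerXn2r ?nnegrE // (le_trans _ nt).
Qed.

Lemma leib_term X Y n j x (C g A s t : R) : (j <= n)%N -> n%:R <= t -> 0 <= C -> 0 <= g -> 0 <= A ->
  `|X (n - j)%N x| <= C * (n - j)`!%:R * g ^+ (n - j) -> `|Y j x| <= A * s ^+ j ->
  `|'C(n, j)%:R * (X (n - j)%N x * Y j x)| <= C * A * ((g * t) ^+ (n - j) * s ^+ j).
Proof.
move=> jn nt C_ge0 g0 A0 hX hY.
rewrite normrM (ger0_norm (ler0n _ _)) normrM.
have h1 := bin_fact_le jn nt; have h2 := ler_pM (normr_ge0 _) (normr_ge0 _) hX hY.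
have h3 : 0 <= g ^+ (n - j) by rewrite exprn_ge0.
have h4 : 0 <= A * s ^+ j := le_trans (normr_ge0 _) hY.
apply: le_trans (ler_wpM2l (ler0n _ _) h2) _.
have -> : 'C(n, j)%:R * (C * (n - j)`!%:R * g ^+ (n - j) * (A * s ^+ j)) =
   ('C(n, j)%:R * (n - j)`!%:R) * (C * g ^+ (n - j) * (A * s ^+ j)) by ring.
have -> : C * A * ((g * t) ^+ (n - j) * s ^+ j) = t ^+ (n - j) * (C * g ^+ (n - j) * (A * s ^+ j)).
  by rewrite exprMn; ring.
by rewrite ler_wpM2r // mulr_ge0 // mulr_ge0.
Qed.

(** The Leibniz sum without its top term: each remaining term carries a factor g t, to be gained
    against s. [transport_bound] needs this when it solves for the highest derivative. *)
Lemma leib_tail_bound X Y n x (C g A s t : R) :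
  n%:R <= t -> 0 <= C -> 0 <= g -> 0 <= A -> 2 * (g * t) <= s ->
  (forall i, `|X i x| <= C * i`!%:R * g ^+ i) ->
  (forall j, (j < n)%N -> `|Y j x| <= A * s ^+ j) ->
  s * `|\sum_(j < n) 'C(n, j)%:R * (X (n - j)%N x * Y j x)| <= 2 * C * A * (g * t) * s ^+ n.
Proof.
move=> nt C_ge0 g0 A0 gs hX hY.
have t0 : 0 <= t by apply: le_trans nt.
have gt0 : 0 <= g * t by rewrite mulr_ge0.
have s0 : 0 <= s by lra.
have h : `|\sum_(j < n) 'C(n, j)%:R * (X (n - j)%N x * Y j x)| <=
   C * A * \sum_(j < n) ((g * t) ^+ (n - j) * s ^+ j).
  apply: le_trans (ler_norm_sum _ _ _) _; rewrite mulr_sumr; apply: ler_sum => j _.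
  by apply: leib_term => //; [exact: ltnW|exact: hY].
have [_ h2] := geo_sum_le n gt0 gs.
apply: le_trans (ler_wpM2l s0 h) _.
have -> : 2 * C * A * (g * t) * s ^+ n = C * A * (2 * (g * t) * s ^+ n) by ring.
by rewrite mulrCA ler_wpM2l // mulr_ge0.
Qed.

Lemma leib_bound X Y n x (C g A s t : R) :
  n%:R <= t -> 0 <= C -> 0 <= g -> 0 <= A -> 2 * (g * t) <= s ->
  (forall i, `|X i x| <= C * i`!%:R * g ^+ i) ->
  (forall j, (j <= n)%N -> `|Y j x| <= A * s ^+ j) ->
  `|leib X Y n x| <= 2 * C * A * s ^+ n.
Proof.
move=> nt C_ge0 g0 A0 gs hX hY.
have t0 : 0 <= t by apply: le_trans nt.
have gt0 : 0 <= g * t by rewrite mulr_ge0.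
have [h1 _] := geo_sum_le n gt0 gs.
apply: le_trans (ler_norm_sum _ _ _) _.
apply: le_trans (_ : \sum_(j < n.+1) C * A * ((g * t) ^+ (n - j) * s ^+ j) <= _).
  apply: ler_sum => j _; have jn : (j <= n)%N by rewrite -ltnS.
  by apply: leib_term => //; exact: hY.
rewrite -mulr_sumr big_ord_recr /= subnn expr0 mul1r.
have : C * A * (\sum_(i < n) (g * t) ^+ (n - i) * s ^+ i + s ^+ n) <= C * A * (s ^+ n + s ^+ n).
  by rewrite ler_wpM2l ?mulr_ge0 // lerD2r.
by move/le_trans; apply; rewrite -mulr2n mulrnAr -[leLHS]mulr_natl !mulrA.
Qed.

Lemma fact_geo_le n (t g : R) : n%:R <= t -> 0 <= g -> n`!%:R * g ^+ n <= (g * t) ^+ n.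
Proof.
move=> nt g0; rewrite exprMn mulrC ler_wpM2l ?exprn_ge0 //.
by have := bin_fact_le (leq0n n) nt; rewrite bin0 mul1r subn0.
Qed.

Variables (b r f : R -> R) (C0 g : R).
Hypotheses (C0_ge0 : 0 <= C0) (g_ge0 : 0 <= g).
Let B := jetof b.
Let Q := jetof r.
Let F := jetof f.
Hypotheses (jB : jet01 B) (jQ : jet01 Q) (jF : jet01 F).
Hypotheses (gB : geom_bound C0 g B) (gQ : geom_bound C0 g Q) (gF : geom_bound C0 g F).

(** Bootstrap: the n times differentiated equation expresses the derivative of order n + 2 by lower
    ones, and the right-hand side is differentiable once more. *)
Lemma sol_jet (e : R) (u : R -> R) : 0 < e -> bvp_solution e b r f u ->
  let U := jetof u in
  jet01 U /\ (forall n x, 0 < x -> x < 1 ->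
    e * U n.+2 x = leib B (fun k => U k.+1) n x + leib Q U n x - F n x).
Proof.
move=> e0 [_ h _ _] U.
have en0 : e != 0 by rewrite gt_eqF.
suff H n : (forall k, (k <= n.+1)%N -> derOn 0 1 (U k) (U k.+1)) /\
   (forall x, 0 < x -> x < 1 -> e * U n.+2 x = leib B (fun k => U k.+1) n x + leib Q U n x - F n x).
  by split=> [n|n]; [have [h1 _] := H n; exact: h1 (leqnSn n)|case: (H n)].
elim: n => [|n [IH1 IH2]].
  split=> [k k1 x x0 x1|x x0 x1].
    have [|h1 h2 _] := h x; first by rewrite in_itv /= x0.
    case: k k1 => [|[|//]] _; [exact: (derive1_d h1)|exact: (derive1_d h2)].
  have [|_ _ h3] := h x; first by rewrite in_itv /= x0.
  by rewrite !leib0 /U /B /Q /F /= -h3 /=; ring.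
have D x : 0 < x -> x < 1 -> is_derive x 1 (U n.+2)
   (e^-1 * (leib B (fun k => U k.+1) n.+1 x + leib Q U n.+1 x - F n.+1 x)).
  move=> x0 x1.
  apply: (@d_ext _ (fun y => e^-1 * (leib B (fun k => U k.+1) n y + leib Q U n y - F n y)) _ 0 1) => //.
    by move=> y y0 y1; rewrite -IH2 // mulKf.
  apply: dZ; apply: dB; last exact: jF.
  apply: dD; apply: leib_d => k kn; try exact: jB; try exact: jQ.
    exact: IH1.
  by apply: IH1 => //; exact: leqW.
split=> [k|x x0 x1]; last first.
  by rewrite [U n.+3 x](d_derive1 (D x x0 x1)) mulVKf.
rewrite leq_eqVlt => /orP[/eqP ->|]; last by rewrite ltnS => kn; exact: IH1.
by move=> x x0 x1; apply: (is_derive_eq (D x x0 x1)); rewrite [RHS](d_derive1 (D x x0 x1)).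
Qed.

(** Induction two orders at a time through the differentiated equation. The terms b u', r u and f
    contribute 2 C0, 2 C0 and C0, hence the 5 C0 in the growth constant; 2 g is for the Leibniz
    sums, and the division by [e] is paid by 1/e <= t. *)
Lemma sol_deriv_bound (e A t : R) (u : R -> R) n : 0 < e -> bvp_solution e b r f u ->
  1 <= A -> (forall x, 0 < x -> x < 1 -> `|u x| <= A /\ e * `|derive1 u x| <= A) ->
  1 <= e * t -> 1 <= t -> n%:R <= t ->
  forall k x, (k <= n.+2)%N -> 0 < x -> x < 1 ->
    `|jetof u k x| <= A * ((2 * g + 5 * C0 + 1) * t) ^+ k.
Proof.
move=> e0 hu A1 hA et t1 nt; set s := _ * t.
have [jU eU] := sol_jet e0 hu.
set U := jetof u in jU eU *.
have t0 : 0 <= t by lra.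
have gt0 : 0 <= g * t by rewrite mulr_ge0.
have ct0 : 0 <= C0 * t by rewrite mulr_ge0.
have sE : s = 2 * (g * t) + 5 * (C0 * t) + t by rewrite /s; ring.
have s1 : 1 <= s by lra.
have gs : 2 * (g * t) <= s by lra.
have A0 : 0 <= A by lra.
have te : e^-1 <= t by rewrite -[e^-1]mul1r ler_pdivrMr // mulrC.
elim/ltn_ind => -[|[|k]] IH x kn x0 x1.
- by rewrite expr0 mulr1; case: (hA x x0 x1).
- have [_ h] := hA x x0 x1; rewrite expr1.
  rewrite mulrC -ler_pdivlMr // in h; apply: le_trans h _.
  by rewrite ler_wpM2l // (le_trans te) //; lra.
- have kn' : k%:R <= t by apply: le_trans nt; rewrite ler_nat.
  have h1 : `|leib B (fun k => U k.+1) k x| <= 2 * C0 * (A * s) * s ^+ k.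
    apply: (leib_bound (t := t) (g := g)) => //.
    - by rewrite mulr_ge0 //; lra.
    - by move=> i; exact: gB.
    - move=> j jk; have jk' : (j.+1 < k.+2)%N by rewrite !ltnS.
      rewrite -[A * s * _]mulrA -exprS.
      exact: (IH j.+1 jk' x (leq_trans (ltnW jk') kn) x0 x1).
  have h2 : `|leib Q U k x| <= 2 * C0 * A * s ^+ k.
    apply: (leib_bound (t := t) (g := g)) => //.
    - by move=> i; exact: gQ.
    - move=> j jk; have jk' : (j < k.+2)%N by rewrite ltnS leqW.
      exact: (IH j jk' x (leq_trans (ltnW jk') kn) x0 x1).
  have h3 : `|F k x| <= C0 * s ^+ k.
    apply: le_trans (gF k x0 x1) _; rewrite -mulrA ler_wpM2l //.
    apply: le_trans (fact_geo_le kn' g_ge0) _.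
    by rewrite lerXn2r ?nnegrE //; lra.
  have h4 : e * `|U k.+2 x| <= 2 * C0 * (A * s) * s ^+ k + 2 * C0 * A * s ^+ k + C0 * s ^+ k.
    rewrite -[e in leLHS](gtr0_norm e0) -normrM eU //.
    apply: le_trans (ler_normB _ _) _; apply: lerD h3.
    by apply: le_trans (ler_normD _ _) _; exact: lerD.
  rewrite mulrC -ler_pdivlMr // in h4; apply: le_trans h4 _.
  have sk : 0 <= s ^+ k by rewrite exprn_ge0 //; lra.
  have h5 : 2 * C0 * (A * s) * s ^+ k + 2 * C0 * A * s ^+ k + C0 * s ^+ k <= 5 * C0 * A * (s * s ^+ k).
    have -> : 2 * C0 * (A * s) * s ^+ k + 2 * C0 * A * s ^+ k + C0 * s ^+ k =
       C0 * s ^+ k * (2 * (A * s) + 2 * A + 1) by ring.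
    have -> : 5 * C0 * A * (s * s ^+ k) = C0 * s ^+ k * (5 * (A * s)) by ring.
    rewrite ler_wpM2l ?mulr_ge0 //; nra.
  have ei : 0 <= e^-1 by rewrite invr_ge0 ltW.
  apply: le_trans (ler_wpM2r ei h5) _.
  have sk1 : 0 <= s * s ^+ k by rewrite mulr_ge0 //; lra.
  rewrite 2!exprS.
  have -> : A * (s * (s * s ^+ k)) = (A * (s * s ^+ k)) * s by ring.
  have -> : 5 * C0 * A * (s * s ^+ k) / e = (A * (s * s ^+ k)) * (5 * C0 / e) by ring.
  apply: (ler_wpM2l (mulr_ge0 A0 sk1)).
  apply: le_trans (ler_wpM2l (mulr_ge0 (ler0n R 5) C0_ge0) te) _.
  by rewrite sE; lra.
Qed.

End Regularity.

(** * Maximum principle and flux bounds *)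

Section MaximumPrinciple.
Context {R : realType}.
Implicit Types (v b r : R -> R) (e x : R).

Lemma neg_derive_right (v1 : R -> R) (c s : R) : is_derive c 1 v1 s -> v1 c = 0 -> s < 0 ->
  exists2 d, 0 < d & forall x, c < x -> x < c + d -> v1 x < 0.
Proof.
move=> /is_derive1_caratheodory [g [hg cg gc]] v1c s0.
have : \forall x \near c, g x < 0 by apply: cvgr_lt cg _ _; rewrite gc.
move=> /nbhs_ballP[d d0 hd]; exists d => // x cx xd.
have := hg x; rewrite v1c subr0 => ->.
have gx : g x < 0 by apply: hd; rewrite /ball /= distrC ger0_norm; lra.
by rewrite nmulr_rlt0 // subr_gt0.
Qed.

(** At a negative interior minimum v' = 0 and r v <= 0, so the strict inequality forces v'' < 0;
    then v decreases to the right of the minimum, a contradiction. *)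
Lemma maximum_principle e b r v (v1 v2 : R -> R) : 0 < e ->
  (forall x, 0 < x -> x < 1 -> 0 <= r x) ->
  {within `[0, 1], continuous v} -> derOn 0 1 v v1 -> derOn 0 1 v1 v2 ->
  (forall x, 0 < x -> x < 1 -> 0 < - e * v2 x + b x * v1 x + r x * v x) ->
  0 <= v 0 -> 0 <= v 1 -> forall x, 0 <= x -> x <= 1 -> 0 <= v x.
Proof.
move=> e0 r0 cv d1 d2 L va vb x x0 x1.
have [c] := @EVT_min R v 0 1 ler01 cv.
rewrite in_itv /= => /andP[c0 c1] hmin.
apply: (@le_trans _ _ (v c)); last by apply: hmin; rewrite in_itv /= x0.
rewrite leNgt; apply/negP => vc.
have {}c0 : 0 < c.
  by rewrite lt_neqAle c0 andbT; apply/eqP => E; move: vc; rewrite -E; lra.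
have {}c1 : c < 1.
  by rewrite lt_neqAle c1 andbT; apply/eqP => E; move: vc; rewrite E; lra.
have v1c : v1 c = 0.
  have dv : forall t : R, t \in `]0, 1[ -> derivable v t 1.
    by move=> t; rewrite in_itv /= => /andP[t0 t1]; have h := d1 _ t0 t1; exact: (@ex_derive _ _ _ _ _ _ _ h).
  have cin : c \in `]0, 1[ by rewrite in_itv /= c0.
  have := @derive1_at_min R v 0 1 c ler01 dv cin.
  have h : forall t, t \in `]0, 1[ -> v c <= v t.
    by move=> t; rewrite in_itv /= => /andP[t0 t1]; apply: hmin; rewrite in_itv /= !ltW.
  by move=> /(_ h) /d_derive1; rewrite (d_derive1 (d1 _ c0 c1)).
have Lc := L _ c0 c1; rewrite v1c mulr0 addr0 in Lc.
have v2c : v2 c < 0 by have := r0 _ c0 c1; nra.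
have [d d0 hd] := neg_derive_right (d2 _ c0 c1) v1c v2c.
pose y := c + Num.min d (1 - c) / 2.
have m0 : 0 < Num.min d (1 - c) by rewrite lt_min d0 subr_gt0.
have m1 : Num.min d (1 - c) <= d by rewrite ge_min lexx.
have m2 : Num.min d (1 - c) <= 1 - c by rewrite ge_min lexx orbT.
have cy : c < y by rewrite /y; lra.
have y1 : y < 1 by rewrite /y; lra.
have yd : y < c + d by rewrite /y; lra.
have [] := @MVT R v v1 c y cy.
- move=> z; rewrite in_itv /= => /andP[cz zy]; apply: d1; lra.
- exact: (derOn_cont d1).
- move=> z; rewrite in_itv /= => /andP[cz zy] E.
  have z1 : v1 z < 0 by apply: hd => //; lra.
  have : v y - v c < 0 by rewrite E nmulr_rlt0 // subr_gt0.
  have : v c <= v y by apply: hmin; rewrite in_itv /=; lra.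
  lra.
Qed.

Lemma d_layer (e b0 x : R) :
  is_derive x 1 (fun x => expR (- (b0 / e) * (1 - x))) (b0 / e * expR (- (b0 / e) * (1 - x))).
Proof.
have h := dZ (- (b0 / e)) (dB (dC 1 x) (dI x)).
have h2 := d_compose h (dexp _). by apply: (is_derive_eq h2); ring.
Qed.

(** Comparison with k (1 + x) + c exp(-b0 (1 - x) / e). The exponential is a supersolution since b
    >= b0, and the slope k = 2 eta / b0 makes the inequality strict. *)
Lemma barrier e b r v (v1 v2 : R -> R) (b0 eta c : R) : 0 < e -> 0 < b0 -> 0 < eta -> 0 <= c ->
  (forall x, 0 < x -> x < 1 -> 0 <= r x) -> (forall x, 0 < x -> x < 1 -> b0 <= b x) ->
  {within `[0, 1], continuous v} -> derOn 0 1 v v1 -> derOn 0 1 v1 v2 ->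
  (forall x, 0 < x -> x < 1 -> `|- e * v2 x + b x * v1 x + r x * v x| <= eta) ->
  v 0 = 0 -> `|v 1| <= c ->
  forall x, 0 <= x -> x <= 1 -> `|v x| <= 4 * eta / b0 + c * expR (- (b0 / e) * (1 - x)).
Proof.
move=> e0 b00 eta0 c_ge0 r0 bb cv d1 d2 L va vb.
pose k := 2 * eta / b0.
have k0 : 0 < k by rewrite divr_gt0 ?mulr_gt0.
pose E x : R := expR (- (b0 / e) * (1 - x)).
pose Psi x : R := k * (1 + x) + c * E x.
pose Psi1 x : R := k + c * (b0 / e * E x).
pose Psi2 x : R := c * (b0 / e * (b0 / e * E x)).
have dP x : is_derive x 1 Psi (Psi1 x).
  apply: (is_derive_eq (dD (dZ k (dD (dC 1 x) (dI x))) (dZ c (d_layer e b0 x)))).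
  by rewrite /Psi1 /E; ring.
have dP1 x : is_derive x 1 Psi1 (Psi2 x).
  apply: (is_derive_eq (dD (dC k x) (dZ c (dZ (b0 / e) (d_layer e b0 x))))).
  by rewrite /Psi2 /E; ring.
have LP x : 0 < x -> x < 1 -> eta < - e * Psi2 x + b x * Psi1 x + r x * Psi x.
  move=> x0 x1; have E0 : 0 < E x := expR_gt0 _.
  have rx := r0 _ x0 x1; have bx := bb _ x0 x1.
  have kb : k * b0 = 2 * eta by rewrite /k divfK // gt_eqF.
  have cE : 0 <= c * E x by rewrite mulr_ge0 // ltW.
  have kx : 0 <= k * (1 + x) by apply: mulr_ge0; lra.
  have P0 : 0 <= Psi x by rewrite /Psi; lra.
  have -> : - e * Psi2 x + b x * Psi1 x + r x * Psi x =
     k * b x + c * E x * (b0 / e) * (b x - b0) + r x * Psi x.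
    by rewrite /Psi1 /Psi2; field; rewrite gt_eqF.
  have h1 : k * b0 <= k * b x by rewrite ler_wpM2l // ltW.
  have h2 : 0 <= c * E x * (b0 / e) * (b x - b0).
    by apply: mulr_ge0; rewrite ?subr_ge0 //; apply: mulr_ge0 => //; rewrite divr_ge0 ?ltW.
  have h3 : 0 <= r x * Psi x by rewrite mulr_ge0.
  lra.
have E1 : E 1 = 1 by rewrite /E subrr mulr0 expR0.
have PE : forall x, x <= 1 -> Psi x <= 4 * eta / b0 + c * expR (- (b0 / e) * (1 - x)).
  move=> x x1; rewrite /Psi lerD2r.
  have -> : 4 * eta / b0 = k * 2 by rewrite /k; ring.
  by apply: ler_wpM2l (ltW k0) _ _ _; lra.
have E00 : 0 <= E 0 := expR_ge0 _.
have cP : {within `[0, 1], continuous Psi}.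
  by apply: continuous_subspaceT => x; exact: (d_cont (dP x)).
have vb' := vb; rewrite ler_norml in vb'; case/andP: vb' => vb1 vb2.
have H (s : R) : (s = 1) \/ (s = -1) -> forall x, 0 <= x -> x <= 1 -> 0 <= Psi x - s * v x.
  move=> hs; apply: (@maximum_principle e b r (fun x => Psi x - s * v x) (fun x => Psi1 x - s * v1 x) (fun x => Psi2 x - s * v2 x) e0 r0).
  - by apply: within_continuousB cP _; apply: within_continuousM cv; exact: within_continuousC.
  - by move=> x x0 x1; exact: (dB (dP x) (dZ s (d1 _ x0 x1))).
  - by move=> x x0 x1; exact: (dB (dP1 x) (dZ s (d2 _ x0 x1))).
  - move=> x x0 x1.
    have -> : - e * (Psi2 x - s * v2 x) + b x * (Psi1 x - s * v1 x) + r x * (Psi x - s * v x) =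
      (- e * Psi2 x + b x * Psi1 x + r x * Psi x) - s * (- e * v2 x + b x * v1 x + r x * v x) by ring.
    have := LP _ x0 x1; have := L _ x0 x1; rewrite ler_norml => /andP[].
    set X := - e * v2 x + _ + _; by case: hs => ->; lra.
  - rewrite va mulr0 subr0 /Psi; have := mulr_ge0 c_ge0 E00; lra.
  - by rewrite /Psi E1; case: hs => ->; lra.
move=> x x0 x1; apply: le_trans (PE x x1).
have h1 := H 1 (or_introl erefl) x x0 x1; have h2 := H (-1) (or_intror erefl) x x0 x1.
rewrite ler_norml; lra.
Qed.

(* The flux [e v' - b v] has the bounded derivative [(r - b') v - L v]. *)
Lemma flux_bound e b (b1 : R -> R) r v (v1 v2 : R -> R) (a Cb de eta : R) : 0 < e -> e <= 1 -> 2^-1 <= a -> a <= 1 ->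
  derOn 0 a b b1 ->
  (forall x, 0 < x -> x < a -> [/\ `|b x| <= Cb, `|b1 x| <= Cb & `|r x| <= Cb]) ->
  {within `[0, a], continuous v} -> derOn 0 a v v1 -> derOn 0 a v1 v2 ->
  (forall x, 0 < x -> x < a -> `|v x| <= de) ->
  (forall x, 0 < x -> x < a -> `|- e * v2 x + b x * v1 x + r x * v x| <= eta) ->
  `|v 0| <= de -> `|v a| <= de ->
  forall x, 0 < x -> x < a -> e * `|v1 x| <= (4 + 4 * Cb) * de + eta.
Proof.
move=> e0 e1 a12 a1 db hC cv d1 d2 hv hL v0 va x x0 xa.
have a0 : 0 < a by lra.
pose Ph x := e * v1 x - b x * v x.
pose Ph1 x := (r x - b1 x) * v x - (- e * v2 x + b x * v1 x + r x * v x).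
have dPh : derOn 0 a Ph Ph1.
  move=> y y0 ya; apply: (is_derive_eq (dB (dZ e (d2 y y0 ya)) (dM (db y y0 ya) (d1 y y0 ya)))).
  by rewrite /Ph1; ring.
have de0 : 0 <= de by apply: le_trans v0.
have dv y : y \in `]0, a[ -> is_derive y 1 v (v1 y).
  by rewrite in_itv /= => /andP[y0 ya]; exact: d1.
(* At a mean value point |v'| <= 2 de / a <= 4 de; from there the flux is transported to x. *)
have [xi] := @MVT R v v1 0 a a0 dv cv.
rewrite in_itv /= subr0 => /andP[xi0 xia] E.
have hxi : e * `|v1 xi| <= 4 * de.
  have h : `|v1 xi| * a <= 2 * de.
    rewrite -[a in leLHS](gtr0_norm a0) -normrM -E.
    by apply: le_trans (ler_normB _ _) _; lra.
  have := normr_ge0 (v1 xi); nra.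
have [c1 c2 c3] := hC _ x0 xa.
have Cb0 : 0 <= Cb by apply: le_trans c1.
have B1 y : 0 < y -> y < a -> `|Ph1 y| <= 2 * Cb * de + eta.
  move=> y0 ya; have [h1 h2 h3] := hC _ y0 ya.
  apply: le_trans (ler_normB _ _) _; apply: lerD (hL _ y0 ya).
  rewrite normrM ler_pM //; last exact: hv.
  by apply: le_trans (ler_normB _ _) _; lra.
have h := lip_oo dPh B1 x0 xa xi0 xia.
have h2 : `|x - xi| <= 1 by rewrite ler_norml; lra.
have K0 : 0 <= 2 * Cb * de + eta by apply: le_trans (B1 _ x0 xa).
have h3 : `|Ph x - Ph xi| <= 2 * Cb * de + eta.
  by apply: le_trans h _; rewrite -[leRHS]mulr1 ler_wpM2l.
have bv y : 0 < y -> y < a -> `|b y * v y| <= Cb * de.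
  by move=> y0 ya; have [? ? ?] := hC _ y0 ya; rewrite normrM ler_pM // hv.
rewrite -[e in leLHS](gtr0_norm e0) -normrM.
have -> : e * v1 x = (Ph x - Ph xi) + e * v1 xi - b xi * v xi + b x * v x by rewrite /Ph; ring.
have t1 := bv _ x0 xa; have t2 := bv _ xi0 xia.
have t3 : `|e * v1 xi| <= 4 * de by rewrite normrM (gtr0_norm e0).
apply: le_trans (ler_normD _ _) _; apply: le_trans (lerD (ler_normB _ _) (lexx _)) _.
apply: le_trans (lerD (lerD (ler_normD _ _) (lexx _)) (lexx _)) _.
lra.
Qed.

End MaximumPrinciple.

(** * Integrals of bounded continuous functions *)

Section Integrals.
Context {R : realType}.
Notation mu := (@lebesgue_measure R).
Implicit Types (f g k : R -> R) (a c x s t : R).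

(** Used to reach an endpoint when an estimate is available only at distance d from it. *)
Lemma le_limit (Z Y C D : R) : 0 < D -> (forall d, 0 < d -> d < D -> Z <= Y + C * d) -> Z <= Y.
Proof.
move=> D0 h; rewrite leNgt; apply/negP => YZ.
have K0 : 0 < `|C| + 1 by rewrite ltr_wpDl.
pose d := Num.min (D / 2) ((Z - Y) / 2 / (`|C| + 1)).
have d0 : 0 < d by rewrite lt_min !divr_gt0 // subr_gt0.
have dD : d < D by apply: le_lt_trans (_ : D / 2 < D); [rewrite ge_min lexx|lra].
have dZ : d * (`|C| + 1) <= (Z - Y) / 2 by rewrite -ler_pdivlMr // ge_min lexx orbT.
have := h d d0 dD; have : C * d <= `|C| * d by rewrite ler_wpM2r ?ler_norm // ltW.
lra.
Qed.

(** Continuous and bounded on the open interval: enough for integrability, stable under sums and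
    products, and silent about the endpoints, where the values of jets mean nothing. *)
Definition nice a c k := (forall x, a < x -> x < c -> {for x, continuous k}) /\
  exists M, forall x, a < x -> x < c -> `|k x| <= M.

Definition Itg a c k : R := \int[mu]_(x in `]a, c[) k x.

Lemma nice_measurable a c k : nice a c k -> measurable_fun (`]a, c[ : set R) k.
Proof.
move=> [h _]; apply: subspace_continuous_measurable_fun; first exact: measurable_itv.
apply: continuous_in_subspaceT => x.
by rewrite inE /= in_itv /= => /andP[ax xc]; exact: h.
Qed.

Lemma itv_fin (i : interval R) : (exists M, forall x, x \in i -> `|x| <= M) -> (mu [set` i] < +oo)%E.
Proof.
move=> [M hM]; have h : (mu (`[(- M)%R, M] : set R) < +oo)%E.
  by rewrite lebesgue_measure_itv /=; case: ifP => _; rewrite ?ltry // -EFinB ltry.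
apply: le_lt_trans h; apply: le_measure; rewrite ?inE /=.
- exact: measurable_itv.
- exact: measurable_itv.
- by move=> x /= /hM; rewrite in_itv /= ler_norml.
Qed.

Lemma bounded_int (A : set R) k M : measurable A -> (mu A < +oo)%E -> measurable_fun A k ->
  (forall x, A x -> `|k x| <= M) -> mu.-integrable A (EFin \o k).
Proof.
move=> mA fA mk hM; apply: measurable_bounded_integrable => //.
exists M; split; first exact: num_real.
by move=> y My x Ax; apply: le_trans (hM x Ax) (ltW My).
Qed.

Lemma oo_fin a c : (mu `]a, c[ < +oo)%E.
Proof.
apply: itv_fin; exists (`|a| + `|c|) => x; rewrite in_itv /= => /andP[ax xc].
rewrite ler_norml; have := ler_norm a; have := ler_norm c.
have := ler_norm (- a); have := ler_norm (- c); rewrite !normrN.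
have := normr_ge0 a; have := normr_ge0 c; lra.
Qed.

Lemma nice_int a c k : nice a c k -> mu.-integrable `]a, c[ (EFin \o k).
Proof.
move=> nk; have [_ [M hM]] := nk; apply: (@bounded_int _ _ M) => //.
- exact: oo_fin.
- exact: nice_measurable.
- by move=> x /=; rewrite in_itv /= => /andP[ax xc]; exact: hM.
Qed.

Lemma Itg_ext a c f g : (forall x, a < x -> x < c -> f x = g x) -> Itg a c f = Itg a c g.
Proof.
by move=> h; apply: eq_Rintegral => x; rewrite inE /= in_itv /= => /andP[ax xc]; exact: h.
Qed.

Lemma niceD a c f g : nice a c f -> nice a c g -> nice a c (fun x => f x + g x).
Proof.
move=> [f1 [M1 f2]] [g1 [M2 g2]]; split.
  by move=> x ax xc; apply: (@continuousD _ _ _ f g); [exact: f1|exact: g1].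
exists (M1 + M2) => x ax xc; apply: le_trans (ler_normD _ _) _.
by apply: lerD; [exact: f2|exact: g2].
Qed.

Lemma niceM a c f g : nice a c f -> nice a c g -> nice a c (fun x => f x * g x).
Proof.
move=> [f1 [M1 f2]] [g1 [M2 g2]]; split.
  by move=> x ax xc; apply: (@continuousM _ _ f g); [exact: f1|exact: g1].
exists (M1 * M2) => x ax xc; rewrite normrM ler_pM //; [exact: f2|exact: g2].
Qed.

Lemma niceC a c (r : R) : nice a c (fun=> r).
Proof. by split=> [x _ _|]; [exact: cvg_cst|exists `|r|]. Qed.

Lemma niceB a c f g : nice a c f -> nice a c g -> nice a c (fun x => f x - g x).
Proof.
move=> [f1 [M1 f2]] [g1 [M2 g2]]; split.
  by move=> x ax xc; apply: (@continuousB _ _ _ f g); [exact: f1|exact: g1].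
exists (M1 + M2) => x ax xc; apply: le_trans (ler_normB _ _) _.
by apply: lerD; [exact: f2|exact: g2].
Qed.

Lemma nice_sub a c a' c' k : a <= a' -> c' <= c -> nice a c k -> nice a' c' k.
Proof.
move=> aa cc [h [M hM]]; split=> [x ax xc|].
  by apply: h; [exact: le_lt_trans ax|exact: lt_le_trans cc].
by exists M => x ax xc; apply: hM; [exact: le_lt_trans ax|exact: lt_le_trans cc].
Qed.

Lemma nice_ext a c f g : (forall x, a < x -> x < c -> f x = g x) -> nice a c f -> nice a c g.
Proof.
move=> h [f1 [M f2]]; split=> [x ax xc|]; last by exists M => x ax xc; rewrite -h //; exact: f2.
suff : g y @[y --> x] --> g x by [].
rewrite -(h x ax xc); apply: cvg_trans (f1 x ax xc).
apply: near_eq_cvg; apply: filterS (near_oo ax xc) => y /andP[? ?].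
by rewrite h.
Qed.

Lemma ItgD a c f g : nice a c f -> nice a c g ->
  Itg a c (fun x => f x + g x) = Itg a c f + Itg a c g.
Proof. by move=> nf ng; apply: RintegralD; [exact: measurable_itv|exact: nice_int|exact: nice_int]. Qed.

Lemma ItgB a c f g : nice a c f -> nice a c g ->
  Itg a c (fun x => f x - g x) = Itg a c f - Itg a c g.
Proof. by move=> nf ng; apply: RintegralB; [exact: measurable_itv|exact: nice_int|exact: nice_int]. Qed.

Lemma ItgZ a c f (r : R) : nice a c f -> Itg a c (fun x => r * f x) = r * Itg a c f.
Proof. by move=> nf; apply: RintegralZl; [exact: measurable_itv|exact: nice_int]. Qed.

Lemma Itg_le a c f g : nice a c f -> nice a c g -> (forall x, a < x -> x < c -> f x <= g x) ->
  Itg a c f <= Itg a c g.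
Proof.
move=> nf ng h; apply: le_Rintegral; [exact: measurable_itv|exact: nice_int|exact: nice_int|].
by move=> x /=; rewrite in_itv /= => /andP[ax xc]; exact: h.
Qed.

Lemma Itg_ge0 a c f : (forall x, a < x -> x < c -> 0 <= f x) -> 0 <= Itg a c f.
Proof.
move=> h; apply: Rintegral_ge0 => x /=; rewrite in_itv /= => /andP[ax xc]; exact: h.
Qed.

Lemma Itg_cst a c (r : R) : a <= c -> Itg a c (fun=> r) = r * (c - a).
Proof.
move=> ac; rewrite /Itg Rintegral_cst; last exact: measurable_itv.
congr (_ * _).
have := lebesgue_measure_itv `]a, c[ => /= ->; rewrite lte_fin.
by case: ltgtP ac => //= ->; rewrite subrr.
Qed.

Lemma Itg_norm_le a c f M : a <= c -> nice a c f -> (forall x, a < x -> x < c -> `|f x| <= M) ->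
  `|Itg a c f| <= M * (c - a).
Proof.
move=> ac nf h; rewrite ler_norml -mulNr -!Itg_cst //.
by apply/andP; split; apply: Itg_le => //; try exact: niceC;
  move=> x ax xc; have := h x ax xc; rewrite ler_norml => /andP[].
Qed.

Lemma Itg_split a s c k : a < s -> s < c -> nice a s k -> nice s c k ->
  Itg a c k = Itg a s k + Itg s c k.
Proof.
move=> as_ sc n1 n2; have [_ [M1 h1]] := n1; have [_ [M2 h2]] := n2.
have E : (`]a, c[ = (`]a, s[ `|` [set s]) `|` `]s, c[ :> set R)%classic.
  apply/seteqP; split => x /=; rewrite !in_itv /=.
    by move=> /andP[ax xc]; case: (ltgtP x s) => h; [left; left; rewrite ax|right; rewrite xc|left; right].
  move=> [[/andP[ax xs]|->]|/andP[sx xc]]; first by rewrite ax (lt_trans xs).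
    by rewrite as_.
  by rewrite xc (lt_trans as_).
have m1 : measurable (`]a, s[ : set R) by exact: measurable_itv.
have m2 : measurable (`]s, c[ : set R) by exact: measurable_itv.
have m3 : measurable ([set s] : set R) by exact: measurable_set1.
have mf : measurable_fun (`]a, c[ : set R) k.
  rewrite E; apply/measurable_funU => //; first exact: measurableU.
  split; last exact: nice_measurable.
  apply/measurable_funU => //; split; first exact: nice_measurable.
  exact: measurable_fun_set1.
have ik : mu.-integrable `]a, c[ (EFin \o k).
  apply: (@bounded_int _ _ (`|M1| + `|M2| + `|k s|)) => //; first exact: oo_fin.
  rewrite E => x /=; rewrite !in_itv /=.
  have := ler_norm M1; have := ler_norm M2; have := normr_ge0 M1; have := normr_ge0 M2.
  have := normr_ge0 (k s).
  move=> ? ? ? ? ? [[/andP[ax xs]|->]|/andP[sx xc]]; last 1 first.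
  - by have := h2 x sx xc; lra.
  - by have := h1 x ax xs; lra.
  - lra.
rewrite /Itg E Rintegral_setU //; last 3 first.
- exact: measurableU.
- by rewrite -E.
- apply/disj_setPS => x /=; rewrite !in_itv /= => -[[/andP[_ xs]|->] /andP[sx _]]; last by rewrite ltxx in sx.
  by have := lt_trans xs sx; rewrite ltxx.
congr (_ + _); rewrite Rintegral_setU ?Rintegral_set1 ?addr0 //.
- apply: integrableS ik => //; first exact: measurableU.
  by rewrite E => x; left.
- apply/disj_setPS => x /=; rewrite !in_itv /= => -[/andP[_ xs] xe].
  by rewrite xe ltxx in xs.
Qed.

Lemma Itg_deriv a c k : nice a c k -> derOn a c (fun x => Itg a x k) k.
Proof.
move=> nk x ax xc.
pose u := (x + c) / 2.
have xu : x < u by rewrite /u; lra.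
have uc : u < c by rewrite /u; lra.
have ik : mu.-integrable [set` Interval (BRight a) (BRight u)] (EFin \o k).
  apply: (integrableS _ _ _ (nice_int nk)); try exact: measurable_itv.
  by move=> y /=; rewrite !in_itv /= => /andP[ay yu]; rewrite ay (le_lt_trans yu).
have [] := @continuous_FTC1 R k (BRight a) x u xu ik.
- exact: ax.
- by have [h _] := nk; exact: h.
move=> D E; have H := derive1_d D; rewrite E in H.
apply: (d_ext (a := a) (c := c) (f := fun x => \int[mu]_(t in [set` Interval (BRight a) (BRight x)]) k t)) => //.
move=> y ay yc; rewrite /Itg Rintegral_itv_bndo_bndc //.
by apply: nice_int; apply: nice_sub nk => //; exact: ltW.
Qed.

(** The difference between F and the integral of k is constant inside; the two margins of width d
    contribute O(d). *)
Lemma Itg_FTC a c (F k : R -> R) : a < c -> {within `[a, c], continuous F} -> derOn a c F k ->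
  nice a c k -> Itg a c k = F c - F a.
Proof.
move=> ac cF dF nk; have [_ [M hM]] := nk.
have dG := Itg_deriv nk.
have lF := lip_cc cF dF hM.
suff H d : 0 < d -> d < (c - a) / 2 -> `|Itg a c k - (F c - F a)| <= 0 + (4 * M) * d.
  by apply/eqP; rewrite -subr_eq0 -normr_le0; apply: (le_limit (D := (c - a) / 2)) H; lra.
move=> d0 dc.
pose s := a + d; pose t := c - d.
have as_ : a < s by rewrite /s; lra.
have st : s < t by rewrite /s /t; lra.
have tc : t < c by rewrite /t; lra.
have M0 : 0 <= M by apply: le_trans (hM s as_ (lt_trans st tc)).
pose H x := F x - Itg a x k.
have dH : derOn a c H (fun=> 0).
  by move=> y ay yc; apply: (is_derive_eq (dB (dF y ay yc) (dG y ay yc))); rewrite subrr.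
have : `|H t - H s| <= 0 * `|t - s|.
  apply: (lip_oo dH) => //; [by move=> *; rewrite normr0|exact: lt_trans st|exact: lt_trans tc].
rewrite mul0r normr_le0 subr_eq0 => /eqP Hst.
have h1 : `|F c - F t| <= M * d.
  by apply: le_trans (lF _ _ _ _ _ _) _; rewrite ?lexx ?(ltW ac) ?(ltW tc) ?(ltW (lt_trans as_ st)) // /t opprB addrC subrK gtr0_norm.
have h2 : `|F s - F a| <= M * d.
  by apply: le_trans (lF _ _ _ _ _ _) _; rewrite ?lexx ?(ltW ac) ?(ltW as_) ?(ltW (lt_trans st tc)) // /s addrC addKr gtr0_norm.
have h3 : `|Itg a s k| <= M * d.
  have -> : d = s - a by rewrite /s addrC addKr.
  apply: Itg_norm_le; [exact: ltW|by apply: nice_sub nk => //; lra|].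
  by move=> x ax xs; apply: hM => //; lra.
have h4 : `|Itg t c k| <= M * d.
  have -> : d = c - t by rewrite /t opprB addrC subrK.
  apply: Itg_norm_le; [exact: ltW|by apply: nice_sub nk => //; lra|].
  by move=> x ax xs; apply: hM => //; lra.
have E : Itg a c k = Itg a t k + Itg t c k.
  by apply: Itg_split; [exact: lt_trans st|exact: tc|apply: nice_sub nk; lra|apply: nice_sub nk; lra].
rewrite /H in Hst; rewrite E; move: h1 h2 h3 h4; rewrite !ler_norml.
move=> /andP[? ?] /andP[? ?] /andP[? ?] /andP[? ?]; lra.
Qed.

End Integrals.

(** * The reduced problem *)

Section Transport.
Context {R : realType}.
Implicit Types (b r w : R -> R) (x y s : R).

Lemma nice_inv a c (b0 : R) b : 0 < b0 -> (forall x, a < x -> x < c -> b0 <= b x) ->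
  nice a c b -> nice a c (fun x => (b x)^-1).
Proof.
move=> b00 hb [cb _]; split.
  move=> x ax xc; have h : b x != 0 by rewrite gt_eqF // (lt_le_trans b00) // hb.
  exact: (cvgV h (cb x ax xc)).
exists b0^-1 => x ax xc; have := hb x ax xc => h.
have bx : 0 < b x by apply: lt_le_trans h.
by rewrite gtr0_norm ?invr_gt0 // lef_pV2.
Qed.

(* [e^A] with [A = int r/b] is the integrating factor of [b w' + r w = phi]. *)
Lemma integrating_factor b r (b0 C0 : R) : 0 < b0 -> nice 0 1 b -> nice 0 1 r ->
  (forall x, 0 < x -> x < 1 -> b0 <= b x) -> (forall x, 0 < x -> x < 1 -> `|r x| <= C0) ->
  exists2 A : R -> R, derOn 0 1 A (fun x => r x / b x) &
    forall x, 0 < x -> x < 1 -> `|A x| <= C0 / b0.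
Proof.
move=> b00 nb nr hb hr.
have nq : nice 0 1 (fun x => r x / b x) by apply: niceM => //; exact: (nice_inv b00 hb nb).
exists (fun x => Itg 0 x (fun x => r x / b x)); first exact: Itg_deriv.
have bd x : 0 < x -> x < 1 -> `|r x / b x| <= C0 / b0.
  move=> x0 x1; have bx := hb x x0 x1; have bp : 0 < b x by apply: lt_le_trans bx.
  rewrite normrM normfV (gtr0_norm bp) ler_pM ?invr_ge0 ?(ltW bp) //; first exact: hr.
  by rewrite lef_pV2.
move=> x x0 x1.
apply: le_trans (@Itg_norm_le _ 0 x _ (C0 / b0) _ _ _) _; first exact: ltW.
- by apply: nice_sub nq => //; exact: ltW.
- by move=> y y0 yx; apply: bd => //; exact: lt_trans x1.
- rewrite subr0 -[leRHS]mulr1 ler_wpM2l ?(ltW x1) //.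
  by apply: le_trans (bd x x0 x1).
Qed.

Lemma expR_bound (a M : R) : `|a| <= M -> expR a <= expR M /\ expR (- a) <= expR M.
Proof. by rewrite ler_norml !ler_expR => /andP[? ?]; split; lra. Qed.

(** Variation of constants. The bound C x encodes the initial condition w(0) = 0 without a value at
    the endpoint. *)
Lemma transport_exists b r (phi : R -> R) (b0 C0 : R) : 0 < b0 -> nice 0 1 b -> nice 0 1 r -> nice 0 1 phi ->
  (forall x, 0 < x -> x < 1 -> b0 <= b x) -> (forall x, 0 < x -> x < 1 -> `|r x| <= C0) ->
  exists2 w, derOn 0 1 w (fun x => (phi x - r x * w x) / b x) &
    exists C, forall x, 0 < x -> x < 1 -> `|w x| <= C * x.
Proof.
move=> b00 nb nr np hb hr.
have [A dA hA] := integrating_factor b00 nb nr hb hr.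
have nE : nice 0 1 (fun x => expR (A x)).
  split; last first.
    exists (expR (C0 / b0)) => x x0 x1; rewrite gtr0_norm ?expR_gt0 //.
    by have [] := expR_bound (hA x x0 x1).
  by move=> x x0 x1; exact: (d_cont (d_compose (dA x x0 x1) (dexp _))).
have ng : nice 0 1 (fun x => expR (A x) * (phi x / b x)).
  by apply: niceM nE _; apply: niceM np _; exact: (nice_inv b00 hb nb).
have dG := Itg_deriv ng; set G := (fun x => Itg 0 x _) in dG.
exists (fun x => expR (- A x) * G x).
  move=> x x0 x1.
  have h := dM (d_compose (dN (dA x x0 x1)) (dexp _)) (dG x x0 x1).
  apply: (is_derive_eq h); rewrite expRN.
  have bx : b x != 0 by rewrite gt_eqF // (lt_le_trans b00) // hb.
  by field; rewrite bx expR_eq0.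
have [_ [M hM]] := ng.
exists (expR (C0 / b0) * M) => x x0 x1; rewrite normrM -mulrA ler_pM //.
  by rewrite gtr0_norm ?expR_gt0 //; have [] := expR_bound (hA x x0 x1).
have : `|Itg 0 x (fun x => expR (A x) * (phi x / b x))| <= M * (x - 0).
  apply: Itg_norm_le; [exact: ltW|by apply: nice_sub ng => //; exact: ltW|].
  by move=> y y0 yx; apply: hM => //; exact: lt_trans x1.
by rewrite subr0.
Qed.

(** Multiplied by the integrating factor, y has derivative e^A psi / b. The estimate starts from a
    point s near 0 and lets s tend to 0, where only m remains. *)
Lemma transport_stable b r (psi y : R -> R) (b0 C0 m Mp C : R) : 0 < b0 -> nice 0 1 b -> nice 0 1 r ->
  (forall x, 0 < x -> x < 1 -> b0 <= b x) -> (forall x, 0 < x -> x < 1 -> `|r x| <= C0) ->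
  derOn 0 1 y (fun x => (psi x - r x * y x) / b x) ->
  (forall x, 0 < x -> x < 1 -> `|psi x| <= Mp) ->
  (forall x, 0 < x -> x < 1 -> `|y x| <= m + C * x) ->
  forall x, 0 < x -> x < 1 -> `|y x| <= expR (C0 / b0) ^+ 2 * (m + Mp / b0).
Proof.
move=> b00 nb nr hb hr dy hp hy x x0 x1.
have [A dA hA] := integrating_factor b00 nb nr hb hr.
set E := expR (C0 / b0); have E0 : 0 < E := expR_gt0 _.
pose H x := expR (A x) * y x.
have dH : derOn 0 1 H (fun x => expR (A x) * (psi x / b x)).
  move=> z z0 z1.
  apply: (is_derive_eq (dM (d_compose (dA z z0 z1) (dexp _)) (dy z z0 z1))); ring.
have eA z : 0 < z -> z < 1 -> `|expR (A z)| <= E.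
  by move=> z0 z1; rewrite gtr0_norm ?expR_gt0 //; have [] := expR_bound (hA z z0 z1).
have Mp0 : 0 <= Mp by apply: le_trans (hp x x0 x1).
have bH z : 0 < z -> z < 1 -> `|expR (A z) * (psi z / b z)| <= E * (Mp / b0).
  move=> z0 z1; have bz := hb z z0 z1; have bp : 0 < b z by apply: lt_le_trans bz.
  rewrite normrM ler_pM //; first exact: eA.
  rewrite normrM normfV (gtr0_norm bp) ler_pM ?invr_ge0 ?(ltW bp) //; first exact: hp.
  by rewrite lef_pV2.
apply: (le_limit (D := x) (C := E ^+ 2 * C)) => // s s0 sx.
have s1 : s < 1 by apply: lt_trans x1.
have h1 := lip_oo dH bH x0 x1 s0 s1.
have h2 : `|H s| <= E * (m + C * s).
  by rewrite /H normrM ler_pM //; [exact: eA|exact: hy].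
have h3 : `|H x| <= E * (m + C * s) + E * (Mp / b0).
  have -> : H x = H s + (H x - H s) by ring.
  apply: le_trans (ler_normD _ _) _; apply: lerD h2 _; apply: le_trans h1 _.
  have h : `|x - s| <= 1 by rewrite ler_norml; lra.
  by rewrite -[leRHS]mulr1 ler_wpM2l // !mulr_ge0 ?invr_ge0 ?(ltW b00) ?(ltW E0).
have -> : y x = expR (- A x) * H x by rewrite /H mulrA -expRD addNr expR0 mul1r.
have h4 : `|expR (- A x)| <= E.
  by rewrite gtr0_norm ?expR_gt0 //; have [] := expR_bound (hA x x0 x1).
rewrite normrM; apply: le_trans (ler_pM _ _ h4 h3) _ => //.
by rewrite le_eqVlt; apply/orP; left; apply/eqP; ring.
Qed.

Variables (b r : R -> R) (C0 g b0 : R).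
Hypotheses (C0_ge0 : 0 <= C0) (g_ge0 : 0 <= g) (b0_gt0 : 0 < b0).
Let B := jetof b.
Let Q := jetof r.
Hypotheses (jB : jet01 B) (jQ : jet01 Q).
Hypotheses (gB : geom_bound C0 g B) (gQ : geom_bound C0 g Q).
Hypothesis hb : forall x, 0 < x -> x < 1 -> b0 <= b x.

Lemma jet_nice (X : nat -> R -> R) n (M : R) : jet01 X -> (forall x, 0 < x -> x < 1 -> `|X n x| <= M) ->
  nice 0 1 (X n).
Proof.
move=> jX hX; split; last by exists M.
by move=> x x0 x1; exact: (d_cont (jX n x x0 x1)).
Qed.

Lemma geom_nice (C g' : R) (X : nat -> R -> R) n : jet01 X -> geom_bound C g' X -> nice 0 1 (X n).
Proof. by move=> jX gX; apply: (jet_nice jX) => x x0 x1; exact: gX. Qed.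

Lemma geom_bound0 (C g' : R) (X : nat -> R -> R) x : geom_bound C g' X -> 0 < x -> x < 1 -> `|X 0%N x| <= C.
Proof. by move=> gX x0 x1; have := gX 0%N x x0 x1; rewrite fact0 expr0 !mulr1. Qed.

(** As for [sol_jet], but the equation is of first order: the top derivative is isolated by dividing
    by b, and [tail] collects the lower ones. *)
Lemma transport_jet (w : R -> R) (Phi : nat -> R -> R) : jet01 Phi ->
  derOn 0 1 w (fun x => (Phi 0%N x - r x * w x) / b x) ->
  let W := jetof w in
  jet01 W /\ (forall n x, 0 < x -> x < 1 ->
    leib B (fun k => W k.+1) n x + leib Q W n x = Phi n x).
Proof.
move=> jP dw W.
have bx x : 0 < x -> x < 1 -> b x != 0.
  by move=> x0 x1; rewrite gt_eqF // (lt_le_trans b0_gt0) // hb.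
suff H n : (forall k, (k <= n)%N -> derOn 0 1 (W k) (W k.+1)) /\
   (forall x, 0 < x -> x < 1 -> leib B (fun k => W k.+1) n x + leib Q W n x = Phi n x).
  by split=> [n|n]; [have [h1 _] := H n; exact: h1 (leqnn n)|case: (H n)].
elim: n => [|n [IH1 IH2]].
  have d0 : derOn 0 1 (W 0%N) (W 1%N).
    move=> x x0 x1; apply: (is_derive_eq (dw x x0 x1)).
    by rewrite -(d_derive1 (dw x x0 x1)).
  split=> [k|x x0 x1]; first by rewrite leqn0 => /eqP ->.
  rewrite !leib0 /B /Q /W /jetof /= (d_derive1 (dw x x0 x1)).
  by field; exact: bx.
pose tail x := \sum_(j < n) 'C(n, j)%:R * (B (n - j)%N x * W j.+1 x).
have tailE x : leib B (fun k => W k.+1) n x = tail x + b x * W n.+1 x.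
  by rewrite /leib big_ord_recr /= binn subnn mul1r.
have D x : 0 < x -> x < 1 -> exists d, is_derive x 1 (W n.+1) d.
  move=> x0 x1; eexists.
  apply: (@d_ext _ (fun y => (Phi n y - leib Q W n y - tail y) * (b y)^-1) _ 0 1) => //.
    move=> y y0 y1; rewrite -IH2 // tailE; field; exact: bx.
  apply: dM; last by apply: dV; [exact: bx|exact: (jB 0%N x0 x1)].
  apply: dB; first apply: dB; first exact: jP.
    by apply: leib_d => k kn; [exact: jQ|exact: IH1].
  apply: (@d_sum _ n (fun j y => 'C(n, j)%:R * (B (n - j)%N y * W j.+1 y))
     (fun j => 'C(n, j)%:R * (B (n - j).+1 x * W j.+1 x + B (n - j)%N x * W j.+2 x))).
  by move=> j; apply: dZ; apply: dM; [exact: jB|apply: IH1 => //; exact: ltn_ord].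
have J : forall k, (k <= n.+1)%N -> derOn 0 1 (W k) (W k.+1).
  move=> k; rewrite leq_eqVlt => /orP[/eqP ->|]; last by rewrite ltnS => kn; exact: IH1.
  move=> x x0 x1; have [d hd] := D x x0 x1.
  by apply: (is_derive_eq hd); rewrite [RHS](d_derive1 hd).
split=> // x x0 x1.
have h1 : is_derive x 1 (fun y => leib B (fun k => W k.+1) n y + leib Q W n y)
   (leib B (fun k => W k.+1) n.+1 x + leib Q W n.+1 x).
  apply: dD; apply: leib_d => k kn; try exact: jB; try exact: jQ; apply: J => //.
  exact: leqW.
have h2 := d_ext (g := Phi n) x0 x1 IH2 h1.
by rewrite -(d_derive1 h2) (d_derive1 (jP n x x0 x1)).
Qed.

(** The differentiated equation is solved for b w^(n+1). The right-hand side, the reaction term and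
    the Leibniz tail each take one third of b0 A s^(n+1); the hypotheses on s say precisely this. *)
Lemma transport_bound (W Phi : nat -> R -> R) N (A s t : R) :
  (forall n x, 0 < x -> x < 1 -> leib B (fun k => W k.+1) n x + leib Q W n x = Phi n x) ->
  N%:R <= t -> 0 <= A -> 0 < s -> 2 * (g * t) <= s -> 6 * C0 * (g * t) <= b0 * s -> 6 * C0 <= b0 * s ->
  (forall n x, (n < N)%N -> 0 < x -> x < 1 -> `|Phi n x| <= b0 / 3 * (A * s ^+ n.+1)) ->
  (forall x, 0 < x -> x < 1 -> `|W 0%N x| <= A) ->
  forall n x, (n <= N)%N -> 0 < x -> x < 1 -> `|W n x| <= A * s ^+ n.
Proof.
move=> eW Nt A0 s0 gs h6 h6' hP hW0.
elim/ltn_ind => -[|n] IH x nN x0 x1; first by rewrite expr0 mulr1; exact: hW0.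
have nt : n%:R <= t by apply: le_trans Nt; rewrite ler_nat ltnW.
have sn : 0 <= s ^+ n by rewrite exprn_ge0 // ltW.
have tailE : leib B (fun k => W k.+1) n x =
    \sum_(j < n) 'C(n, j)%:R * (B (n - j)%N x * W j.+1 x) + b x * W n.+1 x.
  by rewrite /leib big_ord_recr /= binn subnn mul1r.
set tail := \sum_(j < n) _ in tailE.
have h1 : s * `|tail| <= 2 * C0 * (A * s) * (g * t) * s ^+ n.
  apply: (@leib_tail_bound _ B (fun k => W k.+1)) => //.
  - by rewrite mulr_ge0 // ltW.
  - by move=> i; exact: gB.
  - move=> j jn; rewrite -[A * s * _]mulrA -exprS.
    by apply: IH => //; exact: leq_trans jn (ltnW nN).
have h2 : `|leib Q W n x| <= 2 * C0 * A * s ^+ n.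
  apply: (leib_bound (t := t) (g := g)) => //.
  - by move=> i; exact: gQ.
  - by move=> j jn; apply: IH => //; exact: leq_trans jn (ltnW nN).
have h1' : `|tail| <= 2 * C0 * A * (g * t) * s ^+ n.
  rewrite -(ler_pM2l s0); apply: le_trans h1 _.
  by rewrite le_eqVlt; apply/orP; left; apply/eqP; ring.
have h3 := hP n x nN x0 x1.
have h4 : b x * W n.+1 x = Phi n x - leib Q W n x - tail by rewrite -eW // tailE; ring.
have bx := hb x0 x1; have bp : 0 < b x by apply: lt_le_trans bx.
have h5 : b0 * `|W n.+1 x| <= b0 / 3 * (A * s ^+ n.+1) + 2 * C0 * A * s ^+ n + 2 * C0 * A * (g * t) * s ^+ n.
  apply: le_trans (_ : `|b x * W n.+1 x| <= _).
    by rewrite normrM (gtr0_norm bp) ler_wpM2r.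
  rewrite h4; apply: le_trans (ler_normB _ _) _; apply: lerD h1'.
  by apply: le_trans (ler_normB _ _) _; exact: lerD.
rewrite -(ler_pM2l b0_gt0); apply: le_trans h5 _; rewrite exprS.
have As : 0 <= A * s ^+ n by rewrite mulr_ge0.
have e1 : 2 * C0 * A * s ^+ n = (2 * C0) * (A * s ^+ n) by ring.
have e2 : 2 * C0 * A * (g * t) * s ^+ n = (2 * C0 * (g * t)) * (A * s ^+ n) by ring.
have e3 : A * (s * s ^+ n) = s * (A * s ^+ n) by ring.
rewrite e1 e2 e3.
have k1 : 2 * C0 * (A * s ^+ n) <= b0 * s / 3 * (A * s ^+ n) by rewrite ler_wpM2r //; lra.
have k2 : 2 * C0 * (g * t) * (A * s ^+ n) <= b0 * s / 3 * (A * s ^+ n) by rewrite ler_wpM2r //; lra.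
lra.
Qed.

End Transport.

(** * Expansion in powers of the diffusion parameter and the coarse-cell polynomial *)

Section Expansion.
Context {R : realType}.
Variables (b r f : R -> R) (C0 g b0 : R).
Hypotheses (C0_ge0 : 0 <= C0) (g_ge0 : 0 <= g) (b0_gt0 : 0 < b0).
Let B := jetof b.
Let Q := jetof r.
Let F := jetof f.
Hypotheses (jB : jet01 B) (jQ : jet01 Q) (jF : jet01 F).
Hypotheses (gB : geom_bound C0 g B) (gQ : geom_bound C0 g Q) (gF : geom_bound C0 g F).
Hypothesis hb : forall x, 0 < x -> x < 1 -> b0 <= b x.

(** [E] comes from the integrating factor, [Cw] is the loss in [transport_gain], [A] bounds the
    reduced solution and [K] its derivative growth. [C2] is such that e s C2 <= 1/2 makes both e s
    Cw and 3 e s / b0 at most 1/2. *)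
Let E := expR (C0 / b0) ^+ 2.
Let Cw := E * (b0^-1 + (C0 * g + C0) / b0 / b0) + b0^-1.
Let A := 3 * C0 / b0 + E * (C0 / b0).
Let K := 2 * g + 6 * C0 * g / b0 + 6 * C0 / b0 + 1.
Let C2 := 3 / b0 + Cw.

Let nb : nice 0 1 b. Proof. exact: (geom_nice 0 jB gB). Qed.
Let nr : nice 0 1 r. Proof. exact: (geom_nice 0 jQ gQ). Qed.
Let hr x : 0 < x -> x < 1 -> `|r x| <= C0. Proof. exact: (geom_bound0 gQ). Qed.
Let E0 : 0 < E. Proof. by rewrite exprn_gt0 ?expR_gt0. Qed.

(** A corrector w solves b w' + r w = e v''. Subtracting e v'/b removes v'' from the equation, so w
    is bounded through v' alone: one derivative is lost and not two. *)
Lemma transport_gain (v w : nat -> R -> R) (e Mv Cs : R) : 0 < e -> jet01 v ->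
  derOn 0 1 (w 0%N) (fun x => (e * v 2%N x - r x * w 0%N x) / b x) ->
  (forall x, 0 < x -> x < 1 -> `|w 0%N x| <= Cs * x) ->
  (forall x, 0 < x -> x < 1 -> `|v 1%N x| <= Mv) ->
  forall x, 0 < x -> x < 1 -> `|w 0%N x| <= e * Mv * Cw.
Proof.
move=> e0 jv dw hw hv x x0 x1.
pose y x := w 0%N x - e * (v 1%N x / b x).
have bp z : 0 < z -> z < 1 -> 0 < b z by move=> z0 z1; apply: lt_le_trans (hb z0 z1).
pose psi x := e * v 1%N x * (B 1%N x - r x) / b x.
have dy : derOn 0 1 y (fun x => (psi x - r x * y x) / b x).
  move=> z z0 z1; have bz : b z != 0 by rewrite gt_eqF // bp.
  have db : is_derive z 1 b (B 1%N z) := jB 0%N z0 z1.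
  have h := dB (dw z z0 z1) (dZ e (dM (jv 1%N z z0 z1) (dV bz db))).
  by apply: (is_derive_eq h); rewrite /psi /y; field.
have Mv0 : 0 <= Mv by apply: le_trans (hv x x0 x1).
have ib z : 0 < z -> z < 1 -> `|(b z)^-1| <= b0^-1.
  by move=> z0 z1; rewrite gtr0_norm ?invr_gt0 ?lef_pV2 ?posrE ?bp // hb.
have vb z : 0 < z -> z < 1 -> `|e * (v 1%N z / b z)| <= e * Mv / b0.
  move=> z0 z1; rewrite normrM (gtr0_norm e0) -mulrA ler_wpM2l ?(ltW e0) //.
  by rewrite normrM ler_pM //; [exact: hv|exact: ib].
have hp z : 0 < z -> z < 1 -> `|psi z| <= e * Mv * (C0 * g + C0) / b0.
  move=> z0 z1; rewrite /psi normrM ler_pM //; last exact: ib.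
  rewrite normrM ler_pM //; first by rewrite normrM (gtr0_norm e0) ler_wpM2l ?(ltW e0) // hv.
  apply: le_trans (ler_normB _ _) _; apply: lerD (hr z0 z1).
  by have := gB 1%N z0 z1; rewrite expr1 mulr1.
have hy z : 0 < z -> z < 1 -> `|y z| <= e * Mv / b0 + Cs * z.
  move=> z0 z1; apply: le_trans (ler_normB _ _) _; rewrite addrC.
  by apply: lerD; [exact: vb|exact: hw].
have h := transport_stable b0_gt0 nb nr hb hr dy hp hy x0 x1.
have -> : w 0%N x = y x + e * (v 1%N x / b x) by rewrite /y subrK.
apply: le_trans (ler_normD _ _) _.
have -> : e * Mv * Cw = E * (e * Mv / b0 + e * Mv * (C0 * g + C0) / b0 / b0) + e * Mv / b0.
  by rewrite /Cw; ring.
by apply: lerD (vb x x0 x1).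
Qed.

(* Partial sums W of the expansion in powers of [e] of the reduced solution,
   with last term V: every step loses one derivative and gains a factor 1/2. *)
Lemma reduced_expansion (e : R) (T M : nat) : 0 < e -> (1 <= T)%N ->
  let s := K * T%:R in e * (s * C2) <= 2^-1 -> (M < T)%N ->
  exists W V : nat -> R -> R, [/\ jet01 W /\ jet01 V,
    exists C, forall x, 0 < x -> x < 1 -> `|W 0%N x| <= C * x,
    exists C, forall x, 0 < x -> x < 1 -> `|V 0%N x| <= C * x,
    forall x, 0 < x -> x < 1 ->
      - e * W 2%N x + b x * W 1%N x + r x * W 0%N x = f x - e * V 2%N x &
    forall n x, (n + M <= T)%N -> 0 < x -> x < 1 ->
      `|W n x| <= A * (2 - (2^-1) ^+ M) * s ^+ n /\ `|V n x| <= A * (2^-1) ^+ M * s ^+ n].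
Proof.
move=> e0 T1 s es; have b0p := b0_gt0; have C0p := C0_ge0.
have ib0 : 0 < b0^-1 by rewrite invr_gt0.
have t1 : 1 <= T%:R :> R by rewrite ler1n.
have t0 : 0 <= T%:R :> R by lra.
have gt0 : 0 <= g * T%:R by rewrite mulr_ge0.
have Cgb : 0 <= C0 * (g * T%:R) / b0 by rewrite divr_ge0 ?mulr_ge0 // ltW.
have Cb : 0 <= C0 * T%:R / b0 by rewrite divr_ge0 ?mulr_ge0 // ltW.
have sE : s = 2 * (g * T%:R) + 6 * (C0 * (g * T%:R) / b0) + 6 * (C0 * T%:R / b0) + T%:R.
  by rewrite /s /K; ring.
have s1 : 1 <= s by lra.
have s0 : 0 < s by lra.
have gs : 2 * (g * T%:R) <= s by lra.
have b0s : b0 * s = 2 * b0 * (g * T%:R) + 6 * C0 * (g * T%:R) + 6 * C0 * T%:R + b0 * T%:R.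
  by rewrite sE; field; rewrite gt_eqF.
have q1 : 0 <= b0 * (g * T%:R) by rewrite mulr_ge0 // ltW.
have q2 : 0 <= C0 * (g * T%:R) by rewrite mulr_ge0.
have q3 : C0 <= C0 * T%:R by rewrite ler_peMr.
have q4 : 0 <= b0 * T%:R by rewrite mulr_ge0 // ltW.
have q5 : 0 <= C0 * T%:R by rewrite mulr_ge0.
have h6 : 6 * C0 * (g * T%:R) <= b0 * s.
  rewrite b0s -!mulrA; move: (b0 * (g * T%:R)) (C0 * (g * T%:R)) (C0 * T%:R) (b0 * T%:R) q1 q2 q3 q4 q5.
  by move=> *; lra.
have h6' : 6 * C0 <= b0 * s.
  rewrite b0s -!mulrA; move: (b0 * (g * T%:R)) (C0 * (g * T%:R)) (C0 * T%:R) (b0 * T%:R) q1 q2 q3 q4 q5.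
  by move=> *; lra.
have Cb0 : 0 <= C0 / b0 by rewrite divr_ge0 // ltW.
have A30 : 0 <= 3 * C0 / b0 by rewrite -mulrA mulr_ge0.
have AE0 : 0 <= E * (C0 / b0) by rewrite mulr_ge0 // ltW.
have A0 : 0 <= A by rewrite /A addr_ge0.
have Cw0 : 0 <= Cw.
  rewrite /Cw addr_ge0 ?(ltW ib0) // mulr_ge0 ?(ltW E0) // addr_ge0 ?(ltW ib0) //.
  by rewrite !divr_ge0 ?(ltW b0_gt0) // addr_ge0 // mulr_ge0.
have es0 : 0 <= e * s by rewrite mulr_ge0 ?ltW.
have k1 : e * s * (3 / b0) <= 2^-1.
  have -> : e * s * (3 / b0) = e * (s * C2) - e * s * Cw by rewrite /C2; ring.
  by have := mulr_ge0 es0 Cw0; lra.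
have k2 : e * s * Cw <= 2^-1.
  have -> : e * s * Cw = e * (s * C2) - e * s * (3 / b0) by rewrite /C2; ring.
  have h : 0 <= 3 / b0 by rewrite mulr_ge0 // ltW.
  by have := mulr_ge0 es0 h; lra.
elim: M => [_|M IH MT].
  have [w dw [Cs hw]] := transport_exists b0_gt0 nb nr (geom_nice 0 jF gF) hb hr.
  have [jW eW] := transport_jet b0_gt0 jB jQ hb jF dw.
  set W := jetof w in jW eW.
  have hy z : 0 < z -> z < 1 -> `|w z| <= 0 + Cs * z by rewrite add0r; exact: hw.
  have st := transport_stable b0_gt0 nb nr hb hr dw (fun x => @geom_bound0 _ C0 g _ x gF) hy.
  have hW0 x : 0 < x -> x < 1 -> `|W 0%N x| <= A.
    by move=> x0 x1; apply: le_trans (st x x0 x1) _; rewrite add0r /A lerDr.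
  have bd : forall n x, (n <= T)%N -> 0 < x -> x < 1 -> `|W n x| <= A * s ^+ n.
    apply: (@transport_bound _ b r C0 g b0 _ _ _ _ _ _ W F T A s T%:R) => //.
    move=> n x nT x0 x1; apply: le_trans (gF n x0 x1) _.
    have nT' : n%:R <= T%:R :> R by rewrite ler_nat ltnW.
    have sn : 0 <= s ^+ n by rewrite exprn_ge0 // ltW.
    rewrite -mulrA; apply: le_trans (ler_wpM2l C0_ge0 (fact_geo_le nT' g_ge0)) _.
    apply: le_trans (_ : C0 * s ^+ n <= _).
      by rewrite ler_wpM2l // lerXn2r ?nnegrE ?(ltW s0) //; lra.
    have -> : b0 / 3 * (A * s ^+ n.+1) = (b0 / 3 * A * s) * s ^+ n by rewrite exprS; ring.
    rewrite ler_wpM2r //.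
    have h : C0 <= b0 / 3 * A.
      have -> : b0 / 3 * A = C0 + b0 / 3 * (E * (C0 / b0)) by rewrite /A; field; rewrite gt_eqF.
      have h : 0 <= b0 / 3 by lra.
      by have := mulr_ge0 h AE0; lra.
    have h1 := le_trans C0_ge0 h; apply: le_trans h _; by rewrite ler_peMr.
  exists W, W; split => //.
  - by exists Cs.
  - by exists Cs.
  - move=> x x0 x1; have := eW 0%N x x0 x1; rewrite !leib0 /B /Q /F /jetof /= => <-.
    by rewrite -addrA addrC mulNr.
  - by move=> n x; rewrite addn0 expr0 mulr1 => nT x0 x1; split;
      [apply: le_trans (bd n x nT x0 x1) _; rewrite ler_wpM2r ?exprn_ge0 ?(ltW s0) //; lra|exact: bd].
have [W [V [[jW jV] [CW hW] [CV hV] eWV bd]]] := IH (ltnW MT).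
set h := (2^-1) ^+ M in bd.
have h0 : 0 <= h by rewrite exprn_ge0.
(* The residual of W is e V''; it becomes the source of the next corrector. *)
pose Phi n x := e * V n.+2 x.
have jP : jet01 Phi by move=> n x x0 x1; apply: dZ; exact: jV.
have nP : nice 0 1 (Phi 0%N).
  apply: niceM; first exact: niceC.
  split=> [x x0 x1|]; first exact: (d_cont (jV 2%N x x0 x1)).
  by exists (A * h * s ^+ 2) => x x0 x1; have [] := bd 2%N x MT x0 x1.
have [v dv [Cs hv]] := transport_exists b0_gt0 nb nr nP hb hr.
have [jV' eV'] := transport_jet b0_gt0 jB jQ hb jP dv.
set V' := jetof v in jV' eV'.
have V1 x : 0 < x -> x < 1 -> `|V 1%N x| <= A * h * s.
  move=> x0 x1; have [_] := bd 1%N x (ltnW MT) x0 x1; by rewrite expr1.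
have V'0 x : 0 < x -> x < 1 -> `|V' 0%N x| <= A * (h / 2).
  move=> x0 x1; apply: le_trans (transport_gain e0 jV dv hv V1 x0 x1) _.
  have -> : e * (A * h * s) * Cw = A * h * (e * s * Cw) by ring.
  by rewrite [leRHS]mulrA ler_wpM2l // mulr_ge0.
have V'n : forall n x, (n <= T - M.+1)%N -> 0 < x -> x < 1 -> `|V' n x| <= A * (h / 2) * s ^+ n.
  apply: (@transport_bound _ b r C0 g b0 _ _ _ _ _ _ V' Phi _ _ s T%:R) => //.
  - by rewrite ler_nat leq_subr.
  - by rewrite !mulr_ge0.
  - move=> n x nT x0 x1; have nT2 : (n.+2 + M <= T)%N by clear -nT; lia.
    have [_ hn] := bd n.+2 x nT2 x0 x1.
    rewrite /Phi normrM (gtr0_norm e0).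
    apply: le_trans (ler_wpM2l (ltW e0) hn) _.
    have -> : e * (A * h * s ^+ n.+2) = (b0 / 3) * (A * h * s ^+ n.+1) * (e * s * (3 / b0)).
      by rewrite !exprS; field; rewrite gt_eqF.
    have -> : b0 / 3 * (A * (h / 2) * s ^+ n.+1) = (b0 / 3) * (A * h * s ^+ n.+1) * 2^-1 by ring.
    rewrite ler_wpM2l //; apply: mulr_ge0; first by lra.
    by rewrite !mulr_ge0 ?exprn_ge0 ?(ltW s0).
exists (fun n x => W n x + V' n x), V'; split.
- by split=> // n x x0 x1; apply: dD; [exact: jW|exact: jV'].
- exists (CW + Cs) => x x0 x1; apply: le_trans (ler_normD _ _) _; rewrite mulrDl.
  by apply: lerD; [exact: hW|exact: hv].
- by exists Cs.
- move=> x x0 x1; have h1 := eWV x x0 x1; have h2 := eV' 0%N x x0 x1.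
  rewrite !leib0 /B /Q /Phi /jetof /= in h2.
  have -> : - e * (W 2%N x + V' 2%N x) + b x * (W 1%N x + V' 1%N x) + r x * (W 0%N x + V' 0%N x) =
    (- e * W 2%N x + b x * W 1%N x + r x * W 0%N x) - e * V' 2%N x + (b x * V' 1%N x + r x * V' 0%N x) by ring.
  by rewrite h1 /V' /jetof /= h2; ring.
- move=> n x nM x0 x1; rewrite exprSr -/h.
  have nM1 : (n + M <= T)%N by clear -nM; lia.
  have nM2 : (n <= T - M.+1)%N by clear -nM; lia.
  have [h1 _] := bd n x nM1 x0 x1; have h2 := V'n n x nM2 x0 x1.
  split=> //; apply: le_trans (ler_normD _ _) _; apply: le_trans (lerD h1 h2) _.
  by rewrite -mulrDl le_eqVlt; apply/orP; left; apply/eqP; field.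
Qed.

Lemma closed_le (a c M : R) (h : R -> R) x : a < c -> {for x, continuous h} ->
  (forall y, a < y -> y < c -> h y <= M) -> a <= x -> x <= c -> h x <= M.
Proof.
move=> ac ch hM ax xc; rewrite leNgt; apply/negP => Mh.
have : \forall y \near x, M < h y by apply: cvgr_gt ch _ _.
move=> /nbhs_ballP[d /= d0 hd].
pose k := Num.min (d / 2) ((c - a) / 2).
have k0 : 0 < k by rewrite lt_min !divr_gt0 // subr_gt0.
have k1 : k <= d / 2 by rewrite ge_min lexx.
have k2 : k <= (c - a) / 2 by rewrite ge_min lexx orbT.
have [xm|xm] := lerP x ((a + c) / 2).
  have : M < h (x + k / 2) by apply: hd; rewrite /ball /= opprD addrA subrr sub0r normrN gtr0_norm; lra.
  by rewrite ltNge hM //; lra.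
have : M < h (x - k / 2) by apply: hd; rewrite /ball /= opprB addrCA subrr addr0 gtr0_norm; lra.
by rewrite ltNge hM //; lra.
Qed.

Lemma closed_norm_le (a c M : R) (h : R -> R) x : a < c -> {for x, continuous h} ->
  (forall y, a < y -> y < c -> `|h y| <= M) -> a <= x -> x <= c -> `|h x| <= M.
Proof.
move=> ac ch hM; apply: (closed_le (h := fun x => `|h x|)) => //.
exact: (cvg_norm ch).
Qed.

Lemma horner_cont (P : {poly R}) x : {for x, continuous (horner P)}.
Proof. exact: (d_cont (dhorner P x)). Qed.

Lemma exists_natr_ge (x : R) : exists n : nat, (1 < n)%N /\ x <= n%:R.
Proof.
have [n hn] : exists n : nat, x <= n%:R.
  by exists (Num.bound `|x|); apply: ltW (le_lt_trans (ler_norm x) (archi_boundP (normr_ge0 x))).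
by exists n.+2; split=> //; apply: le_trans hn _; rewrite ler_nat !leqW.
Qed.

Lemma natr_le_exp2 m : m%:R <= 2 ^+ m :> R.
Proof. by rewrite -natrX ler_nat ltnW // ltn_expl. Qed.

(** The second derivative of the partial sum W is approximated, and P is its double primitive, so
    that P, P' and P'' are accurate at once. The residual then consists of these errors and of the
    remainder e V''. *)
Lemma smooth_coarse_approx : exists (C K2 : R) (J : nat), [/\ 0 < C, 0 < K2, (0 < J)%N &
  forall (m : nat) (e : R), (0 < m)%N -> 0 < e -> e <= 1 -> e * (K2 * m%:R) <= 1 ->
  exists P : {poly R}, [/\ (size P <= J * m)%N, P.[0] = 0,
    forall x, 0 <= x -> x <= 1 -> `|P.[x]| <= C &
    forall x, 0 < x -> x < 1 ->
     `|f x - (- e * (P^`()^`()).[x] + b x * (P^`()).[x] + r x * P.[x])| <= C * 2^-1 ^+ m]].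
Proof.
have b0p := b0_gt0; have C0p := C0_ge0; have gp := g_ge0.
have ib0 : 0 < b0^-1 by rewrite invr_gt0.
have K1 : 1 <= K.
  have h1 : 0 <= 6 * C0 * g / b0 by rewrite divr_ge0 ?(ltW b0p) // !mulr_ge0.
  have h2 : 0 <= 6 * C0 / b0 by rewrite divr_ge0 ?(ltW b0p) // !mulr_ge0.
  rewrite /K; lra.
have A0 : 0 <= A.
  by rewrite /A addr_ge0 // ?mulr_ge0 ?invr_ge0 ?(ltW b0p) ?(ltW E0) ?divr_ge0 ?(ltW b0p).
have Cw0 : 0 <= Cw.
  rewrite /Cw addr_ge0 ?(ltW ib0) // mulr_ge0 ?(ltW E0) // addr_ge0 ?(ltW ib0) //.
  by rewrite !divr_ge0 ?(ltW b0_gt0) // addr_ge0 // mulr_ge0.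
have [nu [nu1 hnu]] := exists_natr_ge (80 * expR 2 * K).
have nu0 : 0 < nu%:R :> R by rewrite ltr0n; clear -nu1; lia.
pose Ce := 100 * expR 1 * A * K ^+ 2.
have Ce0 : 0 <= Ce by rewrite /Ce !mulr_ge0 ?expR_ge0 ?exprn_ge0 //; lra.
have C20 : 0 <= C2 by rewrite /C2 addr_ge0 // mulr_ge0 // ltW.
exists (1 + 2 * A + (1 + 2 * C0) * Ce + A * (5 * K) * b0), (10 * K * (C2 + 1)), (nu ^ 2 + 3)%N.
have AKb : 0 <= A * (5 * K) * b0 by rewrite !mulr_ge0 ?(ltW b0p) //; lra.
have CCe : 0 <= C0 * Ce by rewrite mulr_ge0.
split.
- lra.
- by rewrite !mulr_gt0 //; lra.
- by rewrite addnS.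
move=> m e m0 e0 e1 em.
have m1 : 1 <= m%:R :> R by rewrite ler1n.
pose T := (3 * m + 2)%N.
have T5 : T%:R <= 5 * m%:R :> R by rewrite -natrM ler_nat /T; clear -m0; lia.
have T1 : (1 <= T)%N by rewrite /T addn2.
have MT : (2 * m < T)%N by rewrite /T; clear; lia.
set s := K * T%:R.
have s5 : s <= 5 * K * m%:R.
  rewrite /s (_ : 5 * K * m%:R = K * (5 * m%:R)); last by ring.
  by rewrite ler_wpM2l //; lra.
have s0 : 0 <= s by rewrite /s mulr_ge0 //; lra.
have es : e * (s * C2) <= 2^-1.
  have h : e * (s * C2) <= e * (5 * K * m%:R * C2) by rewrite ler_wpM2l ?(ltW e0) // ler_wpM2r.
  have h2 : 0 <= e * (K * m%:R) by rewrite mulr_ge0 ?(ltW e0) // mulr_ge0 //; lra.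
  have h3 : e * (10 * K * (C2 + 1) * m%:R) = 2 * (e * (5 * K * m%:R * C2)) + 10 * (e * (K * m%:R)) by ring.
  by rewrite h3 in em; lra.
have [W [V [[jW jV] [CW hW] _ eWV bd]]] := reduced_expansion e0 T1 es MT.
rewrite -/s in bd.
have h2m : (2^-1 : R) ^+ (2 * m) = 4^-1 ^+ m by rewrite exprM expr2 -invfM -natrM.
have p2 : 0 < (2^-1 : R) ^+ m by rewrite exprn_gt0.
pose M0 := 2 * A * (5 * K * m%:R) ^+ 2.
have M00 : 0 <= M0 by rewrite /M0 mulr_ge0 ?exprn_ge0 ?mulr_ge0 //; lra.
have hA2 n : A * (2 - (2^-1) ^+ (2 * m)) * s ^+ n <= 2 * A * s ^+ n.
  rewrite ler_wpM2r ?exprn_ge0 // mulrC ler_wpM2r //.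
  by rewrite gerBl exprn_ge0.
have hGm x : 0 < x -> x < 1 -> `|W m.+2 x| <= M0 * (5 * K * m%:R) ^+ m.
  move=> x0 x1; have nT : (m.+2 + 2 * m <= T)%N by rewrite /T; clear; lia.
  have [h _] := bd m.+2 x nT x0 x1; apply: le_trans h _; apply: le_trans (hA2 _) _.
  rewrite /M0 -[leRHS]mulrA -exprD add2n ler_wpM2l ?mulr_ge0 //.
  by rewrite lerXn2r ?nnegrE //; lra.
have K50 : 0 <= 5 * K by lra.
have [q sq hq] := @approx01 R (fun k => W k.+2) m nu M0 (5 * K) m0 nu1 M00 K50 (fun k _ => jW k.+2) hGm.
pose eta := Ce * 2^-1 ^+ m.
have eta0 : 0 <= eta by rewrite mulr_ge0 // ltW.
have {}hq x : 0 < x -> x < 1 -> `|W 2%N x - q.[x]| <= eta.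
  move=> x0 x1; apply: le_trans (hq x x0 x1) _.
  have h1 : 2 * expR 2 * (5 * K) / nu%:R <= 8^-1.
    rewrite ler_pdivrMr //; have := hnu; lra.
  have h10 : 0 <= 2 * expR 2 * (5 * K) / nu%:R.
    by rewrite divr_ge0 ?(ltW nu0) // mulr_ge0 // mulr_ge0 // expR_ge0.
  have h2 : (2 * expR 2 * (5 * K) / nu%:R) ^+ m <= 8^-1 ^+ m by rewrite lerXn2r ?nnegrE.
  have h3 : 0 <= 2 * expR 1 * M0 by apply: mulr_ge0 M00; rewrite mulr_ge0 ?expR_ge0.
  apply: le_trans (ler_wpM2l h3 h2) _.
  have h4 : m%:R ^+ 2 * 8^-1 ^+ m <= 2^-1 ^+ m :> R.
    have -> : 2^-1 ^+ m = (2 ^+ m) ^+ 2 * 8^-1 ^+ m :> R.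
      by rewrite -exprM mulnC exprM -exprMn; congr (_ ^+ _); field.
    by rewrite ler_wpM2r ?exprn_ge0 // lerXn2r ?nnegrE ?exprn_ge0 // natr_le_exp2.
  have -> : 2 * expR 1 * M0 * 8^-1 ^+ m = Ce * (m%:R ^+ 2 * 8^-1 ^+ m).
    by rewrite /M0 /Ce; ring.
  by rewrite ler_wpM2l.
(* P1 is anchored at 1/2, inside the interval, and P at 0, where W tends to 0 because |W x| <= CW
   x. *)
have [P1 [dP1 sP1 vP1]] := poly_antideriv q 2^-1 (W 1%N 2^-1).
have [P [dP sP vP]] := poly_antideriv P1 0 0.
have hP1 x : 0 < x -> x < 1 -> `|W 1%N x - P1.[x]| <= eta.
  move=> x0 x1.
  have d1 : derOn 0 1 (fun x => W 1%N x - P1.[x]) (fun x => W 2%N x - q.[x]).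
    by move=> y y0 y1; apply: dB; [exact: jW|rewrite -dP1; exact: dhorner].
  have i0 : 0 < 2^-1 :> R by lra.
  have i1 : 2^-1 < 1 :> R by lra.
  have := lip_oo d1 hq x0 x1 i0 i1; rewrite vP1 subrr subr0 => /le_trans; apply.
  have h : `|x - 2^-1| <= 1 by rewrite ler_norml; lra.
  by rewrite -[leRHS]mulr1 ler_wpM2l.
have bP1 x : 0 < x -> x < 1 -> `|P1.[x]| <= 2 * A * s + eta.
  move=> x0 x1; have -> : P1.[x] = W 1%N x - (W 1%N x - P1.[x]) by ring.
  apply: le_trans (ler_normB _ _) _; apply: lerD (hP1 x x0 x1).
  have nT : (1 + 2 * m <= T)%N by rewrite /T; clear; lia.
  by have [h _] := bd 1%N x nT x0 x1; apply: le_trans h _; have := hA2 1%N; rewrite expr1.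
have hP x : 0 < x -> x < 1 -> `|W 0%N x - P.[x]| <= eta.
  move=> x0 x1.
  have d1 : derOn 0 1 (fun x => W 0%N x - P.[x]) (fun x => W 1%N x - P1.[x]).
    by move=> y y0 y1; apply: dB; [exact: jW|rewrite -dP; exact: dhorner].
  have cP : {within `[0, 1], continuous (horner P)}.
    by apply: continuous_subspaceT => y; exact: horner_cont.
  have dPP : derOn 0 1 (horner P) (horner P1) by move=> y _ _; rewrite -dP; exact: dhorner.
  apply: (le_limit (D := x) (C := CW + (2 * A * s + eta))) => // y y0 yx.
  have y1 : y < 1 by apply: lt_trans x1.
  have h1 := lip_oo d1 hP1 x0 x1 y0 y1.
  have h2 := lip_cc cP dPP bP1 (ltW y0) (ltW y1) (lexx 0) ler01.
  rewrite vP !subr0 (gtr0_norm y0) in h2.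
  have h3 := hW y y0 y1.
  have h : `|x - y| <= 1 by rewrite ler_norml; lra.
  have h4 : eta * `|x - y| <= eta by rewrite -[leRHS]mulr1 ler_wpM2l.
  have -> : W 0%N x - P.[x] = (W 0%N x - P.[x] - (W 0%N y - P.[y])) + W 0%N y - P.[y] by ring.
  apply: le_trans (ler_normB _ _) _; apply: le_trans (lerD (ler_normD _ _) (lexx _)) _.
  by rewrite mulrDl; lra.
have pm : 2^-1 ^+ m <= 1 :> R by rewrite exprn_ile1 //; lra.
have eta1 : eta <= Ce by rewrite /eta -[leRHS]mulr1 ler_wpM2l.
exists P; split=> //.
- move: sP sP1 sq; move: (size P) (size P1) (size q) (nu ^ 2)%N => z z1 z2 n2.
  clear -m0; nia.
- move=> x x0 x1; apply: (closed_norm_le (a := 0) (c := 1)) => //; first exact: horner_cont.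
  move=> y y0 y1; have -> : P.[y] = W 0%N y - (W 0%N y - P.[y]) by ring.
  apply: le_trans (ler_normB _ _) _; apply: le_trans (lerD (lexx _) (hP y y0 y1)) _.
  have nT : (0 + 2 * m <= T)%N by rewrite /T; clear; lia.
  have [h _] := bd 0%N y nT y0 y1; have := hA2 0%N; rewrite expr0 !mulr1 in h * => h'.
  by lra.
- move=> x x0 x1; rewrite dP dP1.
  have -> : f x - (- e * q.[x] + b x * P1.[x] + r x * P.[x]) =
     e * V 2%N x + (- e * (W 2%N x - q.[x]) + b x * (W 1%N x - P1.[x]) + r x * (W 0%N x - P.[x])).
    by have := eWV x x0 x1; lra.
  have nT : (2 + 2 * m <= T)%N by rewrite /T; clear -m0; lia.
  have [_ hV] := bd 2%N x nT x0 x1.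
  have bx : `|b x| <= C0 by exact: (geom_bound0 gB).
  have rx : `|r x| <= C0 by exact: (geom_bound0 gQ).
  have k1 : `|e * V 2%N x| <= A * (5 * K) * b0 * 2^-1 ^+ m.
    rewrite normrM (gtr0_norm e0); apply: le_trans (ler_wpM2l (ltW e0) hV) _.
    rewrite h2m; have -> : e * (A * 4^-1 ^+ m * s ^+ 2) = A * (e * s) * (s * 4^-1 ^+ m) by ring.
    have e3 : e * s <= b0.
      have h3 : e * s * (3 / b0) <= 1.
        have -> : e * s * (3 / b0) = e * (s * C2) - e * s * Cw by rewrite /C2; ring.
        by have := mulr_ge0 (mulr_ge0 (ltW e0) s0) Cw0; lra.
      by rewrite mulrA ler_pdivrMr // in h3; have := mulr_ge0 (ltW e0) s0; lra.
    have e4 : s * 4^-1 ^+ m <= 5 * K * 2^-1 ^+ m.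
      have -> : 4^-1 ^+ m = 2^-1 ^+ m * 2^-1 ^+ m :> R by rewrite -exprMn; congr (_ ^+ _); field.
      rewrite mulrA ler_wpM2r ?(ltW p2) //; apply: le_trans (ler_wpM2r (ltW p2) s5) _.
      rewrite -[leRHS]mulr1 -!mulrA ler_wpM2l // ler_wpM2l ?(le_trans ler01) //.
      by rewrite exprVn ler_pdivrMr ?exprn_gt0 // mul1r natr_le_exp2.
    have -> : A * (5 * K) * b0 * 2^-1 ^+ m = A * b0 * (5 * K * 2^-1 ^+ m) by ring.
    apply: ler_pM e4.
    - exact: mulr_ge0 A0 (mulr_ge0 (ltW e0) s0).
    - by apply: mulr_ge0 s0 _; exact: exprn_ge0.
    - exact: ler_wpM2l.
  have k2 : `|- e * (W 2%N x - q.[x])| <= eta.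
    rewrite normrM normrN (gtr0_norm e0); have := hq x x0 x1 => h.
    by apply: le_trans (ler_wpM2l (ltW e0) h) _; rewrite ler_piMl.
  have k3 : `|b x * (W 1%N x - P1.[x])| <= C0 * eta by rewrite normrM ler_pM // hP1.
  have k4 : `|r x * (W 0%N x - P.[x])| <= C0 * eta by rewrite normrM ler_pM // hP.
  apply: le_trans (ler_normD _ _) _; apply: le_trans (lerD k1 (ler_normD _ _)) _.
  apply: le_trans (lerD (lexx _) (lerD (ler_normD _ _) (lexx _))) _.
  have -> : (1 + 2 * A + (1 + 2 * C0) * Ce + A * (5 * K) * b0) * 2^-1 ^+ m =
    A * (5 * K) * b0 * 2^-1 ^+ m + (eta + C0 * eta + C0 * eta) + (1 + 2 * A) * 2^-1 ^+ m.
    by rewrite /eta; ring.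
  have : 0 <= (1 + 2 * A) * 2^-1 ^+ m by rewrite mulr_ge0 ?(ltW p2) //; lra.
  lra.
Qed.

End Expansion.

(** * Approximation in the boundary layer *)

Section Layer.
Context {R : realType}.
Implicit Types x : R.

Lemma jet_approx (X : nat -> R -> R) (C g : R) (nu m : nat) : 0 <= C -> 0 <= g -> (0 < m)%N -> (1 < nu)%N ->
  16 * expR 2 * g <= nu%:R -> jet01 X -> geom_bound C g X ->
  exists2 q : {poly R}, (size q <= nu ^ 2 * m + m)%N &
    forall x, 0 < x -> x < 1 -> `|X 0%N x - q.[x]| <= 2 * expR 1 * C * 8^-1 ^+ m.
Proof.
move=> C_ge0 g0 m0 nu1 hnu jX gX.
have nu0 : 0 < nu%:R :> R by rewrite ltr0n; clear -nu1; lia.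
have hX x : 0 < x -> x < 1 -> `|X m x| <= C * (g * m%:R) ^+ m.
  move=> x0 x1; apply: le_trans (gX m x x0 x1) _; rewrite -mulrA ler_wpM2l //.
  exact: fact_geo_le.
have [q sq hq] := approx01 m0 nu1 C_ge0 g0 (fun k _ => jX k) hX.
exists q => // x x0 x1; apply: le_trans (hq x x0 x1) _.
have h1 : 2 * expR 2 * g / nu%:R <= 8^-1 by rewrite ler_pdivrMr //; lra.
have h2 : 0 <= 2 * expR 2 * g / nu%:R by rewrite divr_ge0 ?(ltW nu0) // mulr_ge0 // mulr_ge0 // expR_ge0.
by rewrite ler_wpM2l ?lerXn2r ?nnegrE // !mulr_ge0 ?expR_ge0.
Qed.

(** The approximation starts from X', so a derivative of order m + 1 enters; this is the origin of
    the factor 2 m. *)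
Lemma jet_approx_deriv (X : nat -> R -> R) (C g : R) (nu m : nat) : 0 <= C -> 0 <= g -> (0 < m)%N -> (1 < nu)%N ->
  32 * expR 2 * g <= nu%:R -> jet01 X -> geom_bound C g X ->
  exists2 q : {poly R}, (size q <= nu ^ 2 * m + m)%N &
    forall x, 0 < x -> x < 1 -> `|X 1%N x - q.[x]| <= 2 * expR 1 * (C * (g * (2 * m%:R))) * 8^-1 ^+ m.
Proof.
move=> C_ge0 g0 m0 nu1 hnu jX gX.
have nu0 : 0 < nu%:R :> R by rewrite ltr0n; clear -nu1; lia.
have m1 : 1 <= m%:R :> R by rewrite ler1n.
have hX x : 0 < x -> x < 1 -> `|X m.+1 x| <= C * (g * (2 * m%:R)) * (2 * g * m%:R) ^+ m.
  move=> x0 x1; apply: le_trans (gX m.+1 x x0 x1) _; rewrite -2!mulrA ler_wpM2l //.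
  have -> : 2 * g * m%:R = g * (2 * m%:R) by ring.
  rewrite -exprS; apply: fact_geo_le => //.
  by rewrite -natrM ler_nat; clear -m0; lia.
have C1 : 0 <= C * (g * (2 * m%:R)) by rewrite !mulr_ge0.
have g20 : 0 <= 2 * g by rewrite mulr_ge0.
have [q sq hq] := approx01 m0 nu1 C1 g20 (fun k _ => jX k.+1) hX.
exists q => // x x0 x1; apply: le_trans (hq x x0 x1) _.
have h1 : 2 * expR 2 * (2 * g) / nu%:R <= 8^-1 by rewrite ler_pdivrMr //; lra.
have h2 : 0 <= 2 * expR 2 * (2 * g) / nu%:R by rewrite divr_ge0 ?(ltW nu0) // !mulr_ge0 // expR_ge0.
by rewrite ler_wpM2l ?lerXn2r ?nnegrE // mulr_ge0 // mulr_ge0 // expR_ge0.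
Qed.

Lemma approx_affine (G : nat -> R -> R) (a h M0 Gam : R) (nu m : nat) : 0 < h -> (0 < m)%N -> (1 < nu)%N ->
  0 <= M0 -> 0 <= Gam -> 16 * expR 2 * Gam <= nu%:R ->
  (forall k, derOn a (a + h) (G k) (G k.+1)) ->
  (forall x, a < x -> x < a + h -> h ^+ m * `|G m x| <= M0 * (Gam * m%:R) ^+ m) ->
  exists2 q : {poly R}, (size q <= nu ^ 2 * m + m)%N &
    forall x, a < x -> x < a + h -> `|G 0%N x - q.[x]| <= 2 * expR 1 * M0 * 8^-1 ^+ m.
Proof.
move=> h0 m0 nu1 M00 Gam0 hnu dG hG.
have nu0 : 0 < nu%:R :> R by rewrite ltr0n; clear -nu1; lia.
have hn0 : h != 0 by rewrite gt_eqF.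
pose H k t := h ^+ k * G k (a + h * t).
have in1 t : 0 < t -> t < 1 -> a < a + h * t /\ a + h * t < a + h.
  by move=> t0 t1; rewrite ltrDl mulr_gt0 // ltrD2l gtr_pMr.
have dH k : derOn 0 1 (H k) (H k.+1).
  move=> t t0 t1; have [i1 i2] := in1 t t0 t1.
  have h1 := d_compose (dD (dC a t) (dZ h (dI t))) (dG k _ i1 i2).
  by apply: (is_derive_eq (dZ (h ^+ k) h1)); rewrite /H exprSr; ring.
have hH t : 0 < t -> t < 1 -> `|H m t| <= M0 * (Gam * m%:R) ^+ m.
  move=> t0 t1; have [i1 i2] := in1 t t0 t1.
  by rewrite /H normrM ger0_norm ?exprn_ge0 ?(ltW h0) //; exact: hG.
have [q sq hq] := approx01 m0 nu1 M00 Gam0 (fun k _ => dH k) hH.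
exists (q \Po (h^-1 *: 'X - (a / h)%:P)).
  apply: leq_trans (size_comp_poly_leq _ _) _.
  have s2 : (size (h^-1 *: 'X - (a / h)%:P : {poly R})%R <= 2)%N.
    apply: leq_trans (size_polyD _ _) _; rewrite geq_max size_polyN.
    apply/andP; split; last exact: leq_trans (size_polyC_leq1 _) _.
    by apply: leq_trans (size_scale_leq _ _) _; rewrite size_polyX.
  move: sq s2; move: (size q) (size _) => z z2; move: (nu ^ 2)%N => n2; clear -m0; nia.
move=> x ax xc; rewrite horner_comp.
have -> : (h^-1 *: 'X - (a / h)%:P).[x] = (x - a) / h by rewrite !hornerE; field.
have t0 : 0 < (x - a) / h by rewrite divr_gt0 // subr_gt0.
have t1 : (x - a) / h < 1 by rewrite ltr_pdivrMr // mul1r; lra.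
have := hq _ t0 t1; rewrite /H expr0 mul1r (_ : a + h * ((x - a) / h) = x); last by field.
move=> /le_trans; apply.
have h1 : 2 * expR 2 * Gam / nu%:R <= 8^-1 by rewrite ler_pdivrMr //; lra.
have h2 : 0 <= 2 * expR 2 * Gam / nu%:R by rewrite divr_ge0 ?(ltW nu0) // mulr_ge0 // mulr_ge0 // expR_ge0.
by rewrite ler_wpM2l ?lerXn2r ?nnegrE // mulr_ge0 // mulr_ge0 // expR_ge0.
Qed.

(* The exact flux [e u' - b u] minus a primitive of the approximate reaction
   terms is almost constant; this makes [S] small. *)
Lemma layer_flux (e h c0 c1 d1 d2 eps epsb Mp Mq : R) (b b1 r f u u1 u2 : R -> R)
    (P Bq Rq Fq : {poly R}) : 0 < e -> 0 < h -> h <= 1 ->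
  derOn (1 - h) 1 b b1 -> derOn (1 - h) 1 u u1 -> derOn (1 - h) 1 u1 u2 ->
  (forall x, 1 - h < x -> x < 1 ->
    [/\ e * u2 x = b x * u1 x + r x * u x - f x, `|b x| <= c0, `|r x| <= c0 & `|b1 x| <= c1]) ->
  (forall x, 1 - h < x -> x < 1 ->
    [/\ `|u x - P.[x]| <= d1, e * `|u1 x - (P^`()).[x]| <= d2, `|P.[x]| <= Mp & `|(P^`()).[x]| <= Mq]) ->
  (forall x, 1 - h < x -> x < 1 ->
    [/\ `|b1 x - (Bq^`()).[x]| <= eps, `|r x - Rq.[x]| <= eps, `|f x - Fq.[x]| <= eps & `|b x - Bq.[x]| <= epsb]) ->
  exists2 S : {poly R}, (size S <= size P + size Bq + size Rq + size Fq + 2)%N &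
    forall x, 1 - h < x -> x < 1 ->
      `|S.[x]| <= 2 * eps * Mp + (c0 + c1) * d1 + eps + d2 + c0 * d1 + epsb * Mp /\
      `|f x - (- e * (P^`()^`()).[x] + b x * (P^`()).[x] + r x * P.[x]) - (S^`()).[x]| <=
         eps + epsb * Mq + eps * Mp.
Proof.
move=> e0 h0 h1 db du du1 hc hP hq.
pose a := 1 - h.
have [T [dT sT vT]] := poly_antideriv ((Rq - Bq^`()) * P - Fq) 1 0.
pose Psi x := e * u1 x - b x * u x - T.[x].
pose Psi1 x := (r x - b1 x) * u x - f x - ((Rq - Bq^`()) * P - Fq).[x].
have dPsi : derOn (1 - h) 1 Psi Psi1.
  move=> x ax x1.
  have hd := dB (dB (dZ e (du1 x ax x1)) (dM (db x ax x1) (du x ax x1))) (dhorner T x).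
  apply: (is_derive_eq hd); rewrite dT /Psi1.
  by have [-> _ _ _] := hc x ax x1; ring.
pose M := 2 * eps * Mp + (c0 + c1) * d1 + eps.
have bPsi x : 1 - h < x -> x < 1 -> `|Psi1 x| <= M.
  move=> ax x1; have [_ _ hr hb1] := hc x ax x1.
  have [q1 q2 q3 q4] := hP x ax x1; have [q5 q6 q7 q8] := hq x ax x1.
  have -> : Psi1 x = (r x - Rq.[x]) * P.[x] - (b1 x - (Bq^`()).[x]) * P.[x] + (r x - b1 x) * (u x - P.[x]) - (f x - Fq.[x]).
    by rewrite /Psi1 !hornerE; ring.
  have k1 : `|(r x - Rq.[x]) * P.[x]| <= eps * Mp by rewrite normrM ler_pM.
  have k2 : `|(b1 x - (Bq^`()).[x]) * P.[x]| <= eps * Mp by rewrite normrM ler_pM.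
  have k3 : `|(r x - b1 x) * (u x - P.[x])| <= (c0 + c1) * d1.
    by rewrite normrM ler_pM //; apply: le_trans (ler_normB _ _) _; rewrite lerD.
  apply: le_trans (ler_normB _ _) _; apply: le_trans (lerD (ler_normD _ _) (lexx _)) _.
  apply: le_trans (lerD (lerD (ler_normB _ _) (lexx _)) (lexx _)) _.
  have -> : M = eps * Mp + eps * Mp + (c0 + c1) * d1 + eps by rewrite /M; ring.
  by rewrite !lerD.
pose xm := 1 - h / 2.
have axm : 1 - h < xm by rewrite /xm; lra.
have xm1 : xm < 1 by rewrite /xm; lra.
(* Here S' = e P'' - Bq P' - Rq P + Fq, so f - L P - S' contains only the errors of the
   coefficients. Subtracting Psi at the midpoint removes the constant part of the flux. *)
pose S := e *: P^`() - Bq * P - T - (Psi xm)%:P.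
have sdP (p : {poly R}) : (size p^`() <= size p)%N.
  by have [->|/lt_size_deriv/ltnW//] := eqVneq p 0; rewrite deriv0.
have sD (p q : {poly R}) n : (size p <= n)%N -> (size q <= n)%N -> (size (p - q)%R <= n)%N.
  by move=> pn qn; apply: leq_trans (size_polyD _ _) _; rewrite geq_max size_polyN pn.
have sM (p q : {poly R}) : (size (p * q)%R <= size p + size q)%N.
  by apply: leq_trans (size_polyMleq _ _) _; exact: leq_pred.
exists S.
  apply: (sD); last by apply: leq_trans (size_polyC_leq1 _) _; rewrite addn2.
  apply: (sD); [apply: (sD)|].
  - apply: leq_trans (size_scale_leq _ _) _; apply: leq_trans (sdP P) _; clear; lia.
  - apply: leq_trans (sM _ _) _; clear; lia.
  - apply: leq_trans sT _; rewrite addn2 ltnS; apply: leqW; apply: (sD); last by clear; lia.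
    apply: leq_trans (sM _ _) _.
    have : (size (Rq - Bq^`())%R <= size Rq + size Bq)%N.
      by apply: sD; [exact: leq_addr|apply: leq_trans (sdP Bq) _; exact: leq_addl].
    move: (size (Rq - Bq^`())%R) => n; clear; lia.
move=> x ax x1; have [_ hb hr hb1] := hc x ax x1.
have [q1 q2 q3 q4] := hP x ax x1; have [q5 q6 q7 q8] := hq x ax x1.
split.
  have -> : S.[x] = (Psi x - Psi xm) - e * (u1 x - (P^`()).[x]) + b x * (u x - P.[x]) + (b x - Bq.[x]) * P.[x].
    by rewrite /S /Psi !hornerE; ring.
  have k1 : `|Psi x - Psi xm| <= M.
    apply: le_trans (lip_oo dPsi bPsi ax x1 axm xm1) _; rewrite -[leRHS]mulr1 ler_wpM2l //.
      exact: le_trans (normr_ge0 _) (bPsi x ax x1).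
    rewrite ler_norml /xm; apply/andP; split; lra.
  have k2 : `|e * (u1 x - (P^`()).[x])| <= d2 by rewrite normrM (gtr0_norm e0).
  have k3 : `|b x * (u x - P.[x])| <= c0 * d1 by rewrite normrM ler_pM.
  have k4 : `|(b x - Bq.[x]) * P.[x]| <= epsb * Mp by rewrite normrM ler_pM.
  apply: le_trans (ler_normD _ _) _; apply: le_trans (lerD (ler_normD _ _) (lexx _)) _.
  apply: le_trans (lerD (lerD (ler_normB _ _) (lexx _)) (lexx _)) _.
  by rewrite -/M !lerD.
have -> : f x - (- e * (P^`()^`()).[x] + b x * (P^`()).[x] + r x * P.[x]) - (S^`()).[x] =
    (f x - Fq.[x]) - (b x - Bq.[x]) * (P^`()).[x] - (r x - Rq.[x]) * P.[x].
  rewrite /S !(derivD, derivN, derivZ, derivM, derivC) dT.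
  rewrite !(hornerD, hornerN, hornerZ, hornerM, hornerC); ring.
have k2 : `|(b x - Bq.[x]) * (P^`()).[x]| <= epsb * Mq by rewrite normrM ler_pM.
have k3 : `|(r x - Rq.[x]) * P.[x]| <= eps * Mp by rewrite normrM ler_pM.
apply: le_trans (ler_normB _ _) _; apply: le_trans (lerD (ler_normB _ _) (lexx _)) _.
by rewrite !lerD.
Qed.

(** Each passage from 8^(-m) to 4^(-m) and from 4^(-m) to 2^(-m) absorbs one factor m. *)
Lemma exp_rates (m : nat) : (0 < m)%N -> let q := (4^-1 : R) ^+ m in
  [/\ 0 < q, m%:R * q <= 2^-1 ^+ m, q <= m%:R * q, m%:R * 8^-1 ^+ m <= q & 8^-1 ^+ m <= q].
Proof.
move=> m0 q; have m1 : 1 <= m%:R :> R by rewrite ler1n.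
have q0 : 0 < q by rewrite exprn_gt0.
have p0 : 0 < (2^-1 : R) ^+ m by rewrite exprn_gt0.
have m2 := natr_le_exp2 (R := R) m.
have q8 : m%:R * 8^-1 ^+ m <= q.
  have -> : q = 2 ^+ m * 8^-1 ^+ m by rewrite /q -exprMn; congr (_ ^+ _); field.
  by rewrite ler_wpM2r // exprn_ge0.
split=> //.
- have -> : q = 2^-1 ^+ m * 2^-1 ^+ m :> R by rewrite /q -exprMn; congr (_ ^+ _); field.
  rewrite mulrA -[leRHS]mul1r ler_wpM2r ?(ltW p0) //.
  by rewrite exprVn ler_pdivrMr ?exprn_gt0 // mul1r.
- by rewrite ler_peMl // ltW.
- by apply: le_trans q8; rewrite ler_peMl // exprn_ge0.
Qed.

(** Since h <= 4 m e, h (1/e + m) is at most 5 m: the rescaled derivatives of u' satisfy the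
    hypothesis of [approx_affine]. Integrating from 1 costs a factor h/e <= 4 m. *)
Lemma layer_primal (A K : R) (nu m : nat) (e h : R) (u : R -> R) :
  1 <= A -> 1 <= K -> (0 < m)%N -> (1 < nu)%N -> 16 * expR 2 * (5 * K) <= nu%:R ->
  0 < e -> e <= 1 -> 0 < h -> h <= 1 -> h <= 4 * m%:R * e ->
  {within `[(1 - h), 1], continuous u} -> u 1 = 0 -> jet01 (jetof u) ->
  (forall x, 0 < x -> x < 1 -> `|jetof u m.+1 x| <= A * (K * (e^-1 + m%:R)) ^+ m.+1) ->
  let C1 := 4 * expR 1 * A * K in let q := 4^-1 ^+ m in
  exists P : {poly R}, [/\ (size P <= (nu ^ 2).+1 * m + 2)%N, P.[1] = 0, P.[1 - h] = u (1 - h) &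
    forall x, 1 - h < x -> x < 1 -> `|u x - P.[x]| <= 8 * C1 * (m%:R * q) /\
      e * `|derive1 u x - (P^`()).[x]| <= 2 * C1 * q].
Proof.
move=> A1 K1 m0 nu1 hnu e0 e1 h0 h1 he cu u1 jU bU C1 q.
have [q0 _ _ q8 _] := exp_rates m0; rewrite -/q in q0 q8.
have m1 : 1 <= m%:R :> R by rewrite ler1n.
set a := 1 - h in cu *.
have a0 : 0 <= a by rewrite subr_ge0.
have a1 : a < 1 by rewrite gtrBl.
have ah : a + h = 1 by rewrite /a subrK.
have nx x : a <= x -> x <= 1 -> `|x - 1| <= h /\ `|1 - x| <= h.
  by rewrite /a => ax x1; rewrite [`|1 - x|]distrC !ler_norml; split; apply/andP; split; lra.
have Kp : 0 <= K by apply: le_trans K1.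
have Ap : 0 <= A by apply: le_trans A1.
have en0 : e != 0 by rewrite gt_eqF.
have hn0 : h != 0 by rewrite gt_eqF.
have ei0 : 0 < e^-1 by rewrite invr_gt0.
pose t := e^-1 + m%:R; rewrite -/t in bU.
have tp : 0 <= t by rewrite addr_ge0 // ltW.
have C10 : 0 <= C1 by rewrite /C1 !mulr_ge0 // expR_ge0.
have ina x : a < x -> 0 < x by move=> ax; apply: le_lt_trans ax.
have M00 : 0 <= A * (K * t) by rewrite !mulr_ge0.
have K50 : 0 <= 5 * K by rewrite mulr_ge0.
set U := jetof u in jU bU.
have dU k : derOn a (a + h) (U k.+1) (U k.+2).
  by rewrite ah => x ax x1; apply: jU => //; exact: ina.
have hUm x : a < x -> x < a + h -> h ^+ m * `|U m.+1 x| <= A * (K * t) * (5 * K * m%:R) ^+ m.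
  rewrite ah => ax x1; have hh := bU x (ina x ax) x1.
  apply: le_trans (ler_wpM2l (exprn_ge0 m (ltW h0)) hh) _.
  have -> : h ^+ m * (A * (K * t) ^+ m.+1) = A * (K * t) * (h * (K * t)) ^+ m.
    by rewrite [(h * (K * t)) ^+ m]exprMn [(K * t) ^+ m.+1]exprS; ring.
  rewrite ler_wpM2l // lerXn2r ?nnegrE ?mulr_ge0 ?(ltW h0) //.
  have -> : h * (K * t) = K * (h / e + h * m%:R) by rewrite /t; field.
  have -> : 5 * K * m%:R = K * (4 * m%:R + m%:R) by ring.
  by rewrite ler_wpM2l // lerD // ?ler_pdivrMr // ler_piMl.
have [p1 sp1 hp1] := approx_affine h0 m0 nu1 M00 K50 hnu dU hUm.
rewrite ah in hp1.
have et2 : e * t <= 2 * m%:R.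
  have -> : e * t = 1 + e * m%:R by rewrite /t; field.
  have : e * m%:R <= m%:R by rewrite ler_piMl.
  lra.
have ebd x : a < x -> x < 1 -> e * `|U 1%N x - p1.[x]| <= C1 * q.
  move=> ax x1; apply: le_trans (ler_wpM2l (ltW e0) (hp1 x ax x1)) _.
  have -> : e * (2 * expR 1 * (A * (K * t)) * 8^-1 ^+ m) = C1 / 2 * ((e * t) * 8^-1 ^+ m) by rewrite /C1; field.
  have -> : C1 * q = C1 / 2 * (2 * q) by field.
  rewrite ler_wpM2l ?divr_ge0 //.
  apply: le_trans (_ : 2 * m%:R * 8^-1 ^+ m <= _); first by rewrite ler_wpM2r // exprn_ge0.
  by rewrite -mulrA ler_wpM2l.
have bd1 x : a < x -> x < 1 -> `|U 1%N x - p1.[x]| <= C1 * q / e.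
  by move=> ax x1; rewrite ler_pdivlMr // mulrC; exact: ebd.
have [P0 [dP0 sP0 vP0]] := poly_antideriv p1 1 0.
have cP0 : {within `[a, 1], continuous (fun x => u x - P0.[x])}.
  by apply: within_continuousB cu _; apply: continuous_subspaceT => y; exact: horner_cont.
have dUP : derOn a 1 (fun x => u x - P0.[x]) (fun x => U 1%N x - p1.[x]).
  move=> x ax x1; apply: dB; first exact: (jU 0%N x (ina x ax) x1).
  by rewrite -dP0; exact: dhorner.
have Cqe : 0 <= C1 * q / e by rewrite divr_ge0 ?mulr_ge0 // ltW.
have C1qh : C1 * q / e * h <= 4 * C1 * (m%:R * q).
  have -> : C1 * q / e * h = C1 * q * (h / e) by ring.
  have -> : 4 * C1 * (m%:R * q) = C1 * q * (4 * m%:R) by ring.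
  by rewrite ler_wpM2l ?ler_pdivrMr // mulr_ge0 // ltW.
have bd0 x : a <= x -> x <= 1 -> `|u x - P0.[x]| <= C1 * q / e * h.
  move=> ax x1; have := lip_cc cP0 dUP bd1 ax x1 (ltW a1) (lexx 1).
  rewrite u1 vP0 subrr subr0 => /le_trans; apply; rewrite ler_wpM2l //.
  by case: (nx x ax x1).
(* A linear correction vanishing at 1 restores the value of u at 1 - h. Its slope is no larger than
   the error of the derivative, so that error at most doubles. *)
pose de := (u a - P0.[a]) / h.
have hde : `|de| <= C1 * q / e.
  by rewrite /de normrM normfV (gtr0_norm h0) ler_pdivrMr //; apply: bd0 => //; exact: ltW.
pose P := P0 + de *: (1 - 'X).
have Px x : P.[x] = P0.[x] + de * (1 - x) by rewrite /P !hornerE.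
have dPx x : (P^`()).[x] = p1.[x] - de.
  by rewrite /P derivD derivZ derivB dP0 derivX derivC sub0r !hornerE mulrN1.
exists P; split.
- apply: leq_trans (size_polyD _ _) _; rewrite geq_max; apply/andP; split.
    by move: sP0 sp1; move: (size P0) (size p1) (nu ^ 2)%N => y1 y2 y3; clear -m0; nia.
  apply: leq_trans (size_scale_leq _ _) _; rewrite -opprB size_polyN size_XsubC addn2 //.
- by rewrite Px vP0 subrr mulr0 addr0.
- by rewrite Px /de (_ : 1 - a = h) ?divfK //; [rewrite addrC subrK|rewrite /a opprB addrC subrK].
move=> x ax x1; split.
  rewrite Px opprD addrA; apply: le_trans (ler_normB _ _) _.
  have k1 := bd0 x (ltW ax) (ltW x1).
  have k2 : `|de * (1 - x)| <= C1 * q / e * h.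
    by rewrite normrM ler_pM //; case: (nx x (ltW ax) (ltW x1)).
  have -> : 8 * C1 * (m%:R * q) = 4 * C1 * (m%:R * q) + 4 * C1 * (m%:R * q) by ring.
  by apply: lerD; [apply: le_trans k1 _|apply: le_trans k2 _].
rewrite dPx opprB addrA [_ + de - _]addrAC.
have k1 := bd1 x ax x1.
have k2 : `|U 1%N x - p1.[x] + de| <= C1 * q / e + C1 * q / e.
  by apply: le_trans (ler_normD _ _) _; rewrite lerD.
apply: le_trans (ler_wpM2l (ltW e0) k2) _.
by rewrite le_eqVlt; apply/orP; left; apply/eqP; field.
Qed.

(** b is approximated through b' with the exact value at 1. The resulting factor 1 - x <= h
    compensates the size 1/e of P' in the term (b - Bq) P'. *)
Lemma layer_coeffs (b r f : R -> R) (C0 g : R) (nu m : nat) : 0 <= C0 -> 0 <= g -> (0 < m)%N -> (1 < nu)%N ->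
  32 * expR 2 * g <= nu%:R ->
  jet01 (jetof b) -> jet01 (jetof r) -> jet01 (jetof f) ->
  geom_bound C0 g (jetof b) -> geom_bound C0 g (jetof r) -> geom_bound C0 g (jetof f) ->
  {within `[0, 1], continuous b} ->
  let eps := 4 * expR 1 * (C0 * (g + 1)) * 4^-1 ^+ m in
  exists Bq Rq Fq : {poly R}, [/\ (size Bq <= (nu ^ 2).+1 * m + 1)%N, (size Rq <= (nu ^ 2).+1 * m)%N,
    (size Fq <= (nu ^ 2).+1 * m)%N &
    forall x, 0 < x -> x < 1 -> [/\ `|jetof b 1 x - (Bq^`()).[x]| <= eps,
      `|r x - Rq.[x]| <= eps, `|f x - Fq.[x]| <= eps & `|b x - Bq.[x]| <= eps * (1 - x)]].
Proof.
move=> C00 g0 m0 nu1 hnu3 jB jQ jF gB gQ gF cb eps.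
have [q0 _ _ q8 q81] := exp_rates m0.
have e20 : 0 < expR 2 :> R := expR_gt0 _.
have e10 : 0 < expR 1 :> R := expR_gt0 _.
have Kg0 : 0 <= expR 2 * g by rewrite mulr_ge0 // ltW.
have hnu2 : 16 * expR 2 * g <= nu%:R by lra.
have [B1 sB1 hB1] := jet_approx_deriv C00 g0 m0 nu1 hnu3 jB gB.
have [Rq sR hR] := jet_approx C00 g0 m0 nu1 hnu2 jQ gQ.
have [Fq sF hF] := jet_approx C00 g0 m0 nu1 hnu2 jF gF.
have c1 : 2 * expR 1 * C0 <= 4 * expR 1 * (C0 * (g + 1)).
  have -> : 4 * expR 1 * (C0 * (g + 1)) = 2 * expR 1 * C0 + (2 * expR 1 * C0 + 4 * expR 1 * (C0 * g)) by ring.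
  by rewrite lerDl addr_ge0 // !mulr_ge0 // ltW.
have c2 : 4 * expR 1 * (C0 * g) <= 4 * expR 1 * (C0 * (g + 1)).
  by rewrite ler_wpM2l ?mulr_ge0 ?(ltW e10) // ler_wpM2l // lerDl.
have cbd : 2 * expR 1 * C0 * 8^-1 ^+ m <= eps.
  by apply: ler_pM q81 => //; rewrite ?exprn_ge0 ?mulr_ge0 ?(ltW e10).
have {}hB1 x : 0 < x -> x < 1 -> `|jetof b 1 x - B1.[x]| <= eps.
  move=> x0 x1; apply: le_trans (hB1 x x0 x1) _.
  have -> : 2 * expR 1 * (C0 * (g * (2 * m%:R))) * 8^-1 ^+ m = 4 * expR 1 * (C0 * g) * (m%:R * 8^-1 ^+ m) by ring.
  by apply: ler_pM q8 => //; rewrite ?mulr_ge0 ?exprn_ge0 ?(ltW e10).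
have [Bq [dBq sBq vBq]] := poly_antideriv B1 1 (b 1).
have E n : (nu ^ 2 * n + n = (nu ^ 2).+1 * n)%N by rewrite mulSn addnC.
rewrite E in sB1 sR sF.
exists Bq, Rq, Fq; split=> //.
  by apply: leq_trans sBq _; rewrite addn1 ltnS.
move=> x x0 x1; split.
- by rewrite dBq; exact: hB1.
- by apply: le_trans (hR x x0 x1) cbd.
- by apply: le_trans (hF x x0 x1) cbd.
have cbB : {within `[0, 1], continuous (fun x => b x - Bq.[x])}.
  by apply: within_continuousB cb _; apply: continuous_subspaceT => y; exact: horner_cont.
have dbB : derOn 0 1 (fun x => b x - Bq.[x]) (fun x => jetof b 1 x - B1.[x]).
  move=> y y0 y1; apply: dB; first exact: (jB 0%N y y0 y1).
  by rewrite -dBq; exact: dhorner.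
have := lip_cc cbB dbB hB1 (ltW x0) (ltW x1) ler01 (lexx 1).
by rewrite vBq subrr subr0 [`|x - 1|]distrC (ger0_norm (_ : 0 <= 1 - x)) // subr_ge0 ltW.
Qed.

(** [layer_primal] supplies P and [layer_flux] supplies S. The critical term is (b - Bq) P', of
    order 4^(-m) h / e, and h / e <= 4 m. *)
Lemma layer_approx (b r f : R -> R) (C0 g A : R) : 0 <= C0 -> 0 <= g -> 1 <= A ->
  jet01 (jetof b) -> jet01 (jetof r) -> jet01 (jetof f) ->
  geom_bound C0 g (jetof b) -> geom_bound C0 g (jetof r) -> geom_bound C0 g (jetof f) ->
  {within `[0, 1], continuous b} ->
  exists (C : R) (J : nat), [/\ 0 < C, (0 < J)%N &
  forall (m : nat) (e h : R) (u : R -> R), (0 < m)%N -> 0 < e -> e <= 1 -> 0 < h -> h <= 1 ->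
    h <= 4 * m%:R * e -> bvp_solution e b r f u ->
    (forall x, 0 < x -> x < 1 -> `|u x| <= A /\ e * `|derive1 u x| <= A) ->
  exists P S : {poly R}, [/\ (size P <= J * m)%N /\ (size S <= J * m)%N,
    P.[1] = 0 /\ P.[1 - h] = u (1 - h) &
    forall x, 1 - h < x -> x < 1 ->
    [/\ `|u x - P.[x]| <= C * 2^-1 ^+ m, e * `|derive1 u x - (P^`()).[x]| <= C * 2^-1 ^+ m,
      `|S.[x]| <= C * 2^-1 ^+ m &
      `|f x - (- e * (P^`()^`()).[x] + b x * (P^`()).[x] + r x * P.[x]) - (S^`()).[x]| <= C * 2^-1 ^+ m]]].
Proof.
move=> C00 g0 A1 jB jQ jF gB gQ gF cb.
pose K := 2 * g + 5 * C0 + 1.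
have K1 : 1 <= K by rewrite /K; lra.
have [nu [nu1 hnu]] := exists_natr_ge (80 * expR 2 * K + 32 * expR 2 * g).
have e20 : 0 < expR 2 :> R := expR_gt0 _.
have Kg0 : 0 <= expR 2 * g by rewrite mulr_ge0 // ltW.
have KK0 : 0 <= expR 2 * K by rewrite mulr_ge0 ?(ltW e20) //; lra.
have hnu1 : 16 * expR 2 * (5 * K) <= nu%:R by lra.
have hnu3 : 32 * expR 2 * g <= nu%:R by lra.
pose C1 := 4 * expR 1 * A * K.
pose C2 := 4 * expR 1 * (C0 * (g + 1)).
have e10 : 0 < expR 1 :> R := expR_gt0 _.
have C10 : 0 <= C1 by rewrite /C1 !mulr_ge0 ?(ltW e10) //; lra.
have C20 : 0 <= C2 by rewrite /C2 mulr_ge0 ?mulr_ge0 ?(ltW e10) //; lra.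
pose Mp := A + 8 * C1.
pose Mq := A + 2 * C1.
pose X1 := 2 * C2 * Mp + (C0 + C0 * g) * (8 * C1) + C2 + 2 * C1 + C0 * (8 * C1) + C2 * Mp.
pose X2 := C2 + 4 * C2 * Mq + C2 * Mp.
have Mp0 : 0 <= Mp by rewrite /Mp; lra.
have Mq0 : 0 <= Mq by rewrite /Mq; lra.
have X10 : 0 <= X1.
  have : 0 <= (C0 + C0 * g) * (8 * C1).
    by apply: mulr_ge0; [rewrite addr_ge0 // mulr_ge0|exact: mulr_ge0].
  have : 0 <= C2 * Mp by rewrite mulr_ge0.
  have : 0 <= C0 * (8 * C1) by apply: mulr_ge0 C00 (mulr_ge0 _ C10).
  by rewrite /X1; lra.
have X20 : 0 <= X2.
  have : 0 <= C2 * Mq by rewrite mulr_ge0.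
  have : 0 <= C2 * Mp by rewrite mulr_ge0.
  by rewrite /X2; lra.
pose C := 1 + 10 * C1 + X1 + X2.
have [Cp CC1 CC2 CX1 CX2] : [/\ 0 < C, 8 * C1 <= C, 2 * C1 <= C, X1 <= C & X2 <= C].
  by rewrite /C; split; lra.
exists C, (4 * (nu ^ 2).+1 + 10)%N; split=> //.
move=> m e h u m0 e0 e1 h0 h1 he hu hA.
have [cu sol u0 u1] := hu.
have [q0 qp qz _ _] := exp_rates m0.
set q := 4^-1 ^+ m in q0 qp qz; set z := m%:R * q in qp qz.
have z0 : 0 < z by apply: lt_le_trans qz.
have zC X : X <= C -> X * z <= C * 2^-1 ^+ m.
  move=> XC; apply: le_trans (ler_wpM2r (ltW z0) XC) _.
  by apply: ler_wpM2l; [exact: ltW|].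
have z1 : z <= 1 by apply: le_trans qp _; rewrite exprn_ile1 //; lra.
have a0 : 0 <= 1 - h by rewrite subr_ge0.
have ina x : 1 - h < x -> 0 < x by move=> ax; apply: le_lt_trans ax.
have t0 : 0 <= m%:R :> R by [].
have ei0 : 0 < e^-1 by rewrite invr_gt0.
have ei1 : 1 <= e^-1 by rewrite invf_ge1.
have et : 1 <= e * (e^-1 + m%:R).
  by rewrite mulrDr divff ?gt_eqF // lerDl mulr_ge0 // ltW.
have t1 : 1 <= e^-1 + m%:R by apply: le_trans ei1 _; rewrite lerDl.
have mt : m%:R <= e^-1 + m%:R by rewrite lerDr ltW.
have [jU eU] := sol_jet jB jQ jF e0 hu.
have bU := sol_deriv_bound C00 g0 jB jQ jF gB gQ gF e0 hu A1 hA et t1 mt.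
have cu' : {within `[(1 - h), 1], continuous u}.
  by apply: continuous_subspaceW cu => y /=; rewrite !in_itv /= => /andP[ay ->]; rewrite (le_trans a0).
have [P [sP P1 Pa hP]] := layer_primal A1 K1 m0 nu1 hnu1 e0 e1 h0 h1 he cu' u1 jU (fun x => bU m.+1 x (leqnSn _)).
rewrite -/C1 -/q -/z in hP.
have [Bq [Rq [Fq [sB sR sF hq]]]] := layer_coeffs C00 g0 m0 nu1 hnu3 jB jQ jF gB gQ gF cb.
rewrite -/C2 -/q in hq.
have C1z : C1 * z <= C1 by rewrite -[leRHS]mulr1 ler_wpM2l.
have C1qz : C1 * q <= C1 * z by rewrite ler_wpM2l.
have hPM x : 1 - h < x -> x < 1 ->
    [/\ `|u x - P.[x]| <= 8 * C1 * z, e * `|jetof u 1 x - (P^`()).[x]| <= 2 * C1 * z, `|P.[x]| <= Mp &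
      `|(P^`()).[x]| <= Mq / e].
  move=> ax x1; have [k1 k2] := hP x ax x1; have [k3 k4] := hA x (ina x ax) x1.
  have k2' : e * `|jetof u 1 x - (P^`()).[x]| <= 2 * C1 * z.
    by apply: le_trans k2 _; apply: ler_wpM2l qz; exact: mulr_ge0.
  split=> //.
  - have -> : P.[x] = u x - (u x - P.[x]) by ring.
    apply: le_trans (ler_normB _ _) _; apply: lerD => //; apply: le_trans k1 _.
    by rewrite -mulrA ler_wpM2l.
  - rewrite ler_pdivlMr // mulrC.
    have -> : (P^`()).[x] = jetof u 1 x - (jetof u 1 x - (P^`()).[x]) by ring.
    apply: le_trans (ler_wpM2l (ltW e0) (ler_normB _ _)) _; rewrite mulrDr; apply: lerD => //.
    by apply: le_trans k2' _; rewrite -mulrA ler_wpM2l.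
have hcM x : 1 - h < x -> x < 1 ->
    [/\ e * jetof u 2 x = b x * jetof u 1 x + r x * u x - f x, `|b x| <= C0, `|r x| <= C0 & `|jetof b 1 x| <= C0 * g].
  move=> ax x1; have x0 := ina x ax; split.
  - by have := eU 0%N x x0 x1; rewrite !leib0.
  - exact: (geom_bound0 gB).
  - exact: (geom_bound0 gQ).
  - by have := gB 1%N x x0 x1; rewrite expr1 mulr1.
have hqM x : 1 - h < x -> x < 1 ->
    [/\ `|jetof b 1 x - (Bq^`()).[x]| <= C2 * q, `|r x - Rq.[x]| <= C2 * q, `|f x - Fq.[x]| <= C2 * q &
      `|b x - Bq.[x]| <= C2 * q * h].
  move=> ax x1; have [k1 k2 k3 k4] := hq x (ina x ax) x1; split=> //.
  have hx : 1 - x <= h by rewrite lerBlDr -lerBlDl ltW.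
  exact: le_trans k4 (ler_wpM2l (mulr_ge0 C20 (ltW q0)) hx).
have db : derOn (1 - h) 1 b (jetof b 1) by move=> x ax x1; exact: (jB 0%N x (ina x ax) x1).
have du : derOn (1 - h) 1 u (jetof u 1) by move=> x ax x1; exact: (jU 0%N x (ina x ax) x1).
have du1 : derOn (1 - h) 1 (jetof u 1) (jetof u 2) by move=> x ax x1; exact: (jU 1%N x (ina x ax) x1).
have [S sS hS] := layer_flux e0 h0 h1 db du du1 hcM hPM hqM.
have C2qz : C2 * q <= C2 * z by rewrite ler_wpM2l.
have C2q0 : 0 <= C2 * q by rewrite mulr_ge0 // ltW.
have C2qh : C2 * q * h <= C2 * z.
  by apply: le_trans C2qz; rewrite -[leRHS]mulr1 ler_wpM2l.
exists P, S; split.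
- split.
    by move: sP; move: (size P) (nu ^ 2)%N => y1 y2; clear -m0; nia.
  move: sS sP sB sR sF; move: (size S) (size P) (size Bq) (size Rq) (size Fq) (nu ^ 2)%N.
  by move=> y1 y2 y3 y4 y5 y6; clear -m0; nia.
- by [].
move=> x ax x1; have [k1 k2 _ _] := hPM x ax x1; have [k5 k6] := hS x ax x1; split.
- by apply: le_trans k1 _; exact: zC.
- by apply: le_trans k2 _; exact: zC.
- apply: le_trans k5 _; apply: le_trans (zC X1 CX1).
  have -> : X1 * z = 2 * (C2 * z) * Mp + (C0 + C0 * g) * (8 * C1 * z) + C2 * z + 2 * C1 * z + C0 * (8 * C1 * z) + C2 * z * Mp.
    by rewrite /X1; ring.
  by rewrite !lerD // ler_wpM2r // ler_wpM2l.
- apply: le_trans k6 _; apply: le_trans (zC X2 CX2).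
  have -> : X2 * z = C2 * z + C2 * Mq * q * (4 * m%:R) + C2 * z * Mp by rewrite /X2 /z; ring.
  have -> : C2 * q * h * (Mq / e) = C2 * Mq * q * (h / e) by ring.
  rewrite !lerD // ?ler_wpM2r //.
  apply: ler_wpM2l; last by rewrite ler_pdivrMr.
  exact: mulr_ge0 (mulr_ge0 C20 Mq0) (ltW q0).
Qed.

End Layer.

(** * The global piecewise polynomial with rate exp(-s p) *)

Section Approximant.
Context {R : realType}.
Implicit Types x : R.

(** Here m stands for the integer part of p / D; the rate 1/(2 D) is admissible because exp(1/2) <=
    2. *)
Lemma exp2_rate (m D : nat) (p : nat) (s : R) : (p < D * m.+1)%N -> (0 < D)%N -> s <= (2 * D%:R)^-1 ->
  2^-1 ^+ m <= 2 * expR (- s * p%:R) :> R.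
Proof.
move=> pD D0 sD.
have e2 : expR (2^-1) <= 2 :> R.
  have := @expR_le_quad R 2^-1; rewrite gtr0_norm ?invr_gt0 // => /(_ (lexx _)); lra.
have D0' : 0 < D%:R :> R by rewrite ltr0n.
have h1 : expR (2^-1 * m.+1%:R) <= 2 ^+ m.+1 :> R.
  by rewrite mulrC expRM_natl lerXn2r ?nnegrE ?expR_ge0.
have h2 : s * p%:R <= 2^-1 * m.+1%:R.
  apply: le_trans (ler_wpM2r (ler0n _ _) sD) _.
  rewrite invfM -mulrA ler_wpM2l // mulrC ler_pdivrMr //.
  by rewrite -natrM ler_nat mulnC ltnW.
have h3 : expR (s * p%:R) <= 2 ^+ m.+1 :> R by apply: le_trans h1; rewrite ler_expR.
rewrite mulNr expRN exprVn -[leLHS]mul1r.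
have p2 : 0 < 2 ^+ m :> R by rewrite exprn_gt0.
rewrite ler_pdivrMr // mulrAC ler_pdivlMr ?expR_gt0 // mul1r; by rewrite -exprS.
Qed.

Section Data.
Variables (b r f : R -> R) (C0 g b0 : R).
Hypotheses (C0_gt0 : 0 < C0) (g_ge0 : 0 <= g) (b0_gt0 : 0 < b0).
Hypotheses (jB : jet01 (jetof b)) (jQ : jet01 (jetof r)) (jF : jet01 (jetof f)).
Hypotheses (gB : geom_bound C0 g (jetof b)) (gQ : geom_bound C0 g (jetof r)) (gF : geom_bound C0 g (jetof f)).
Hypothesis cb : {within `[0, 1], continuous b}.
Hypothesis hb : forall x, 0 < x -> x < 1 -> b0 <= b x.
Hypothesis r_ge0 : forall x, 0 < x -> x < 1 -> 0 <= r x.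

Let Cb := C0 * (1 + g).

Lemma data_bounds x : 0 < x -> x < 1 -> [/\ `|b x| <= Cb, `|jetof b 1 x| <= Cb & `|r x| <= Cb].
Proof.
move=> x0 x1; have gp := g_ge0; have C0p := C0_gt0.
have h : C0 <= Cb by rewrite /Cb ler_peMr ?(ltW C0_gt0) // lerDl.
split.
- by apply: le_trans h; exact: (geom_bound0 gB).
- have := gB 1%N x0 x1; rewrite expr1 mulr1 => /le_trans; apply.
  by rewrite /Cb ler_wpM2l ?(ltW C0_gt0) // lerDr.
- by apply: le_trans h; exact: (geom_bound0 gQ).
Qed.

(** [barrier] without layer term bounds u, then [flux_bound] on the whole interval bounds e u';
    neither bound depends on [e]. *)
Lemma sol_bound : exists2 A : R, 1 <= A & forall (e : R) (u : R -> R), 0 < e -> e <= 1 ->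
  bvp_solution e b r f u -> forall x, 0 < x -> x < 1 -> `|u x| <= A /\ e * `|jetof u 1 x| <= A.
Proof.
have gp := g_ge0; have C0p := C0_gt0; have b0p := b0_gt0.
pose de := 4 * C0 / b0.
have de0 : 0 <= de by rewrite divr_ge0 ?mulr_ge0 // ltW.
have Cb0 : 0 <= Cb by rewrite /Cb mulr_ge0 ?(ltW C0p) //; lra.
have Cde : 0 <= (4 + 4 * Cb) * de by rewrite mulr_ge0 //; lra.
exists (1 + de + (4 + 4 * Cb) * de + C0); first lra.
move=> e u e0 e1 hu x x0 x1.
have [cu sol u0 u1] := hu; have [jU eU] := sol_jet jB jQ jF e0 hu.
have L y : 0 < y -> y < 1 -> `|- e * jetof u 2 y + b y * jetof u 1 y + r y * jetof u 0 y| <= C0.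
  move=> y0 y1; have := eU 0%N y y0 y1; rewrite !leib0 => E.
  have -> : - e * jetof u 2 y + b y * jetof u 1 y + r y * jetof u 0 y = f y.
    by rewrite mulNr E /jetof /=; ring.
  exact: (geom_bound0 gF).
have hv y : 0 <= y -> y <= 1 -> `|u y| <= de.
  move=> y0 y1; have n1 : `|u 1| <= 0 by rewrite u1 normr0.
  have := barrier e0 b0p C0p (lexx 0) r_ge0 hb cu (jU 0%N) (jU 1%N) L u0 n1 y0 y1.
  by rewrite mul0r addr0.
split; first by have := hv x (ltW x0) (ltW x1); lra.
have half : 2^-1 <= 1 :> R by lra.
have := flux_bound e0 e1 half (lexx 1) (jB 0%N) (fun y y0 y1 => data_bounds y0 y1) cu (jU 0%N) (jU 1%N)
  (fun y y0 y1 => hv y (ltW y0) (ltW y1)) L (hv 0 (lexx 0) ler01) (hv 1 ler01 (lexx 1)) x0 x1.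
lra.
Qed.

(** A multiple of x restores the value of u at a; its slope is at most 2 de because a >= 1/2. The
    bound on e (u - P)' comes from [flux_bound] and not from differentiating an approximation. *)
Lemma coarse_correction (e a eta0 de : R) (u : R -> R) (P : {poly R}) : 0 < e -> e <= 1 -> 2^-1 <= a -> a <= 1 ->
  0 <= eta0 -> 0 <= de ->
  bvp_solution e b r f u -> P.[0] = 0 ->
  (forall x, 0 < x -> x < 1 ->
     `|f x - (- e * (P^`()^`()).[x] + b x * (P^`()).[x] + r x * P.[x])| <= eta0) ->
  (forall x, 0 <= x -> x <= a -> `|u x - P.[x]| <= de) ->
  let PL := P - ((P.[a] - u a) / a) *: 'X in
  let X := (6 + 4 * Cb) * de + 4 * Cb * de + eta0 in
  [/\ (size PL <= maxn (size P) 2)%N, PL.[0] = 0, PL.[a] = u a &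
   forall x, 0 < x -> x < a -> [/\ `|u x - PL.[x]| <= X, e * `|jetof u 1 x - (PL^`()).[x]| <= X &
     `|f x - (- e * (PL^`()^`()).[x] + b x * (PL^`()).[x] + r x * PL.[x])| <= X]].
Proof.
move=> e0 e1 a12 a1 eta00 de0 hu P0 hP hde PL X.
have a0 : 0 < a by lra.
have an : a != 0 by rewrite gt_eqF.
have [cu sol u0 u1] := hu; have [jU eU] := sol_jet jB jQ jF e0 hu.
set k := (P.[a] - u a) / a in PL *.
have PLx x : PL.[x] = P.[x] - k * x by rewrite /PL !hornerE.
have dPLx x : (PL^`()).[x] = (P^`()).[x] - k by rewrite /PL derivB derivZ derivX !hornerE.
have ddPLx : PL^`()^`() = P^`()^`() by rewrite /PL derivB derivZ derivX derivB derivZ derivC scaler0 subr0.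
have hk : `|k| <= 2 * de.
  rewrite /k normrM normfV (gtr0_norm a0) ler_pdivrMr //.
  have := hde a (ltW a0) (lexx a); rewrite distrC => h; nra.
have gp := g_ge0; have C0p := C0_gt0.
have Cb0 : 0 <= Cb by rewrite /Cb mulr_ge0 ?(ltW C0p) //; lra.
have Cbd : 0 <= Cb * de by rewrite mulr_ge0.
split.
- apply: leq_trans (size_polyD _ _) _; rewrite geq_max leq_maxl size_polyN /=.
  by apply: leq_trans (size_scale_leq _ _) _; rewrite size_polyX leq_maxr.
- by rewrite PLx P0 mulr0 subr0.
- by rewrite PLx /k divfK //; ring.
move=> x x0 xa; have x1 : x < 1 by apply: lt_le_trans a1.
have kx : `|k * x| <= 2 * de.
  by rewrite normrM (gtr0_norm x0) -[leRHS]mulr1 ler_pM // ltW.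
split.
- rewrite PLx opprB addrA addrAC; apply: le_trans (ler_normD _ _) _.
  by have := hde x (ltW x0) (ltW xa); rewrite /X; lra.
- have da c : derOn 0 1 c.1 c.2 -> derOn 0 a c.1 c.2.
    by move=> h y y0 ya; apply: h => //; exact: lt_le_trans a1.
  have cz : {within `[0, a], continuous (fun y => u y - P.[y])}.
    apply: within_continuousB; last by apply: continuous_subspaceT => y; exact: horner_cont.
    by apply: continuous_subspaceW cu => y /=; rewrite !in_itv /= => /andP[-> ya]; rewrite (le_trans ya).
  have dz1 : derOn 0 a (fun y => u y - P.[y]) (fun y => jetof u 1 y - (P^`()).[y]).
    move=> y y0 ya; exact: (dB (jU 0%N y y0 (lt_le_trans ya a1)) (dhorner P y)).
  have dz2 : derOn 0 a (fun y => jetof u 1 y - (P^`()).[y]) (fun y => jetof u 2 y - (P^`()^`()).[y]).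
    move=> y y0 ya; exact: (dB (jU 1%N y y0 (lt_le_trans ya a1)) (dhorner P^`() y)).
  have Lz y : 0 < y -> y < a -> `|- e * (jetof u 2 y - (P^`()^`()).[y]) + b y * (jetof u 1 y - (P^`()).[y]) + r y * (u y - P.[y])| <= eta0.
    move=> y0 ya; have y1 : y < 1 by apply: lt_le_trans a1.
    have := hP y y0 y1; have := eU 0%N y y0 y1; rewrite !leib0 => E.
    set Y := f y - _; have -> // : Y = - e * (jetof u 2 y - (P^`()^`()).[y]) + b y * (jetof u 1 y - (P^`()).[y]) + r y * (u y - P.[y]).
    have -> : - e * (jetof u 2 y - (P^`()^`()).[y]) = - (e * jetof u 2 y) + e * (P^`()^`()).[y] by ring.
    by rewrite E /Y /jetof /=; ring.
  have db : derOn 0 a b (jetof b 1) by exact: (da (b, jetof b 1) (jB 0%N)).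
  have hD y : 0 < y -> y < a -> [/\ `|b y| <= Cb, `|jetof b 1 y| <= Cb & `|r y| <= Cb].
    by move=> y0 ya; apply: data_bounds => //; exact: lt_le_trans a1.
  have hz y : 0 < y -> y < a -> `|u y - P.[y]| <= de by move=> y0 ya; apply: hde; exact: ltW.
  have := flux_bound e0 e1 a12 a1 db hD cz dz1 dz2 hz Lz (hde 0 (lexx 0) (ltW a0)) (hde a (ltW a0) (lexx a)) x0 xa.
  rewrite dPLx opprB addrA addrAC => h.
  apply: le_trans (ler_wpM2l (ltW e0) (ler_normD _ _)) _; rewrite mulrDr.
  have ek : e * `|k| <= 2 * de.
    by apply: le_trans hk; rewrite ler_piMl.
  by rewrite /X; lra.
- have -> : f x - (- e * (PL^`()^`()).[x] + b x * (PL^`()).[x] + r x * PL.[x]) =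
    (f x - (- e * (P^`()^`()).[x] + b x * (P^`()).[x] + r x * P.[x])) + b x * k + r x * (k * x).
    by rewrite ddPLx dPLx PLx; ring.
  have [hb1 _ hr1] := data_bounds x0 x1.
  have k1 := hP x x0 x1.
  have k2 : `|b x * k| <= Cb * (2 * de) by rewrite normrM ler_pM.
  have k3 : `|r x * (k * x)| <= Cb * (2 * de) by rewrite normrM ler_pM.
  apply: le_trans (ler_normD _ _) _; apply: le_trans (lerD (ler_normD _ _) (lexx _)) _.
  by rewrite /X; lra.
Qed.

(** The polynomial budget p is shared out through m1 = p / D in the layer and m2 = p / D2 in the
    coarse cell (integer quotients). Both rates become exp(-s p), and 1 / D is the mesh
    parameter. *)
Lemma approximant : exists (D : nat) (C s : R), [/\ (0 < D)%N, 0 < C, 0 < s &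
  forall (p : nat) (e : R) (u : R -> R), (0 < p)%N -> 0 < e -> e <= 1 -> bvp_solution e b r f u ->
  let eta := C * expR (- s * p%:R) in
  let h := if D%:R^-1 * p%:R * e < 2^-1 then D%:R^-1 * p%:R * e else 1 in
  exists PR S PL : {poly R}, [/\ [/\ (size PR <= p.+1)%N, (size S <= p)%N & (size PL <= p.+1)%N],
    [/\ PR.[1] = 0, PL.[0] = 0 & PL.[1 - h] = PR.[1 - h]],
    forall x, 1 - h < x -> x < 1 ->
      [/\ `|u x - PR.[x]| <= eta, e * `|jetof u 1 x - (PR^`()).[x]| <= eta, `|S.[x]| <= eta &
      `|f x - (- e * (PR^`()^`()).[x] + b x * (PR^`()).[x] + r x * PR.[x]) - (S^`()).[x]| <= eta] &
    forall x, 0 < x -> x < 1 - h ->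
      [/\ `|u x - PL.[x]| <= eta, e * `|jetof u 1 x - (PL^`()).[x]| <= eta &
      `|f x - (- e * (PL^`()^`()).[x] + b x * (PL^`()).[x] + r x * PL.[x])| <= eta]]].
Proof.
have gp := g_ge0; have C0p := C0_gt0; have b0p := b0_gt0; have C00 := ltW C0p.
have [A A1 hA] := sol_bound.
have [Cl [Jl [Cl0 Jl0 hL]]] := layer_approx C00 gp A1 jB jQ jF gB gQ gF cb.
have [Cc [K2 [Jc [Cc0 K20 Jc0 hC]]]] := smooth_coarse_approx C00 gp b0p jB jQ jF gB gQ gF hb.
have [N [N1 hN]] := exists_natr_ge K2.
(* The factor N, at least K2, in [D2] guarantees e K2 m2 <= p e / D, which is below 1/2 on the
   two-cell mesh, as [smooth_coarse_approx] requires. *)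
pose D := Jl; pose D2 := (D * (N * Jc))%N.
have D0 : (0 < D)%N by [].
have N0 : (0 < N)%N by apply: ltn_trans N1.
have NJ0 : (0 < N * Jc)%N by rewrite muln_gt0 N0.
have D20 : (0 < D2)%N by rewrite muln_gt0 D0.
have DR0 : 0 < D%:R :> R by rewrite ltr0n.
have D2R0 : 0 < D2%:R :> R by rewrite ltr0n.
(* The second bound makes exp(-b0 h / e) = exp(-(b0 / D) p) at most exp(-s p): the layer has decayed
   at the transition point. *)
pose s := Num.min (2 * D2%:R)^-1 (b0 / D%:R).
have s0 : 0 < s by rewrite lt_min invr_gt0 !mulr_gt0 ?invr_gt0.
have s1 : s <= (2 * D2%:R)^-1 by rewrite ge_min lexx.
have s2 : s <= b0 / D%:R by rewrite ge_min lexx orbT.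
have Cb0 : 0 <= Cb by rewrite /Cb mulr_ge0 //; lra.
pose Y := 8 * Cc / b0 + Cc.
have Y0 : 0 <= Y by rewrite /Y addr_ge0 ?(ltW Cc0) // divr_ge0 ?(ltW b0p) // mulr_ge0 // ltW.
have CbY : 0 <= Cb * Y by rewrite mulr_ge0.
pose C := 2 * A + 2 * C0 + 2 * Cl + ((6 + 4 * Cb) * Y + 4 * Cb * Y + 2 * Cc).
have [Cp CA CC0 CCl CX] : [/\ 0 < C, 2 * A <= C, 2 * C0 <= C, 2 * Cl <= C & (6 + 4 * Cb) * Y + 4 * Cb * Y + 2 * Cc <= C].
  by rewrite /C; split; lra.
exists D, C, s; split=> //.
move=> p e u p0 e0 e1 hu eta h.
have pR0 : 0 < p%:R :> R by rewrite ltr0n.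
have hAu := hA e u e0 e1 hu.
pose m1 := (p %/ D)%N; pose m2 := (p %/ D2)%N.
pose th : R := expR (- s * p%:R).
have th0 : 0 < th := expR_gt0 _.
have r2 : 2^-1 ^+ m2 <= 2 * th by apply: (@exp2_rate m2 D2); rewrite // mulnC ltn_ceil.
have etaC X : X <= C -> X * th <= eta by move=> XC; rewrite /eta ler_wpM2r // ltW.
have De0 : 0 < D%:R^-1 * p%:R * e by rewrite !mulr_gt0 ?invr_gt0.
have [h0 h1] : 0 < h /\ h <= 1.
  by rewrite /h; case: ifP => [hlt|_]; split=> //; lra.
(* For p < D2 the zero polynomials suffice: then 1 <= 2 th, so the a priori bounds are already below
   eta. *)
have [m20|m2p] := posnP m2.
  have t1 : 1 <= 2 * th by move: r2; rewrite m20 expr0.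
  have eA : A <= eta.
    apply: le_trans (etaC _ CA).
    have -> : 2 * A * th = A * (2 * th) by ring.
    by rewrite ler_peMr // (le_trans ler01).
  have eC0 : C0 <= eta.
    apply: le_trans (etaC _ CC0).
    have -> : 2 * C0 * th = C0 * (2 * th) by ring.
    by rewrite ler_peMr.
  have eta0 : 0 <= eta by apply: le_trans eC0.
  have d0 : (0 : {poly R})^`() = 0 by rewrite deriv0.
  exists 0, 0, 0; split.
  - by rewrite size_poly0.
  - by rewrite !horner0.
  - move=> x ax x1; have x0 : 0 < x by apply: le_lt_trans ax; rewrite subr_ge0.
    have [k1 k2] := hAu x x0 x1.
    rewrite !d0 !horner0 !mulr0 !addr0 !subr0 normr0; split=> //.
    + exact: le_trans eA.
    + exact: le_trans eA.
    + by apply: le_trans eC0; exact: (geom_bound0 gF).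
  - move=> x x0 xa; have x1 : x < 1 by apply: lt_trans xa _; rewrite gtrBl.
    have [k1 k2] := hAu x x0 x1.
    rewrite !d0 !horner0 !mulr0 !addr0 !subr0; split=> //.
    + exact: le_trans eA.
    + exact: le_trans eA.
    + by apply: le_trans eC0; exact: (geom_bound0 gF).
have pD2 : (D2 <= p)%N by rewrite -divn_gt0.
have DD2 : (D <= D2)%N by rewrite /D2 leq_pmulr.
have m1p : (0 < m1)%N by rewrite divn_gt0 // (leq_trans DD2).
have m21 : (m2 <= m1)%N by exact: leq_div2l.
have m1D : (D * m1 <= p)%N by rewrite mulnC leq_divM.
have m2D : (D2 * m2 <= p)%N by rewrite mulnC leq_divM.
have r1 : 2^-1 ^+ m1 <= 2 * th.
  by apply: le_trans r2; apply: ler_wiXn2l => //; lra.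
have pm1 : p%:R <= 2 * D%:R * m1%:R :> R.
  rewrite -!natrM ler_nat; have : (p < D * m1.+1)%N by rewrite mulnC ltn_ceil.
  rewrite mulnS => hh; apply: leq_trans (ltnW hh) _.
  by rewrite -mulnA mul2n -addnn leq_add2r leq_pmulr.
have he : h <= 4 * m1%:R * e.
  rewrite /h; case: ifP => [_|/negbT].
    rewrite ler_pM2r // mulrC ler_pdivrMr //; apply: le_trans pm1 _.
    have : 0 <= m1%:R * D%:R :> R by rewrite mulr_ge0.
    lra.
  rewrite -leNgt => hge.
  have : D%:R^-1 * p%:R * e <= 2 * m1%:R * e.
    rewrite ler_pM2r // mulrC ler_pdivrMr //; apply: le_trans pm1 _; lra.
  lra.
have [PR [S [[sPR sS] [PR1 PRa] hR]]] := hL m1 e h u m1p e0 e1 h0 h1 he hu hAu.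
have sPRp : (size PR <= p)%N by apply: leq_trans sPR _.
have ClE : Cl * 2^-1 ^+ m1 <= eta.
  apply: le_trans (etaC _ CCl); have -> : 2 * Cl * th = Cl * (2 * th) by ring.
  by rewrite ler_wpM2l // ltW.
have hR' x : 1 - h < x -> x < 1 ->
      [/\ `|u x - PR.[x]| <= eta, e * `|jetof u 1 x - (PR^`()).[x]| <= eta, `|S.[x]| <= eta &
      `|f x - (- e * (PR^`()^`()).[x] + b x * (PR^`()).[x] + r x * PR.[x]) - (S^`()).[x]| <= eta].
  by move=> ax x1; have [k1 k2 k3 k4] := hR x ax x1; split;
    [exact: le_trans k1 ClE|exact: le_trans k2 ClE|exact: le_trans k3 ClE|exact: le_trans k4 ClE].
have [cu _ u0 u1] := hu.
(* On the one-cell mesh h = 1 and the layer polynomial serves on the whole interval. *)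
have [hlt|hge] := boolP (D%:R^-1 * p%:R * e < 2^-1); last first.
  have hE : h = 1 by rewrite /h (negbTE hge).
  exists PR, S, 0; split=> //.
  - split; [exact: leqW|exact: leq_trans sS _|by rewrite size_poly0].
  - by rewrite !horner0 PRa hE subrr u0.
  - by move=> x x0; rewrite hE subrr => xn; have := lt_trans x0 xn; rewrite ltxx.
have hE : h = D%:R^-1 * p%:R * e by rewrite /h hlt.
have em : e * (K2 * m2%:R) <= 1.
  have k1 : K2 * m2%:R <= D%:R^-1 * p%:R.
    rewrite ler_pdivlMl //; apply: le_trans (_ : (D2 * m2)%:R <= _); last by rewrite ler_nat.
    rewrite /D2 natrM natrM -!mulrA ler_wpM2l ?(ltW DR0) // natrM.
    apply: le_trans (ler_wpM2r (ler0n _ _) hN) _; rewrite -mulrA ler_wpM2l //.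
    by rewrite ler_peMl // ler1n.
  apply: le_trans (ler_wpM2l (ltW e0) k1) _; rewrite mulrC ltW // (lt_trans hlt) //.
  by rewrite invf_lt1 ?ltr1n.
have [P [sP P0 Pb hP]] := hC m2 e m2p e0 e1 em.
pose eta0 := Cc * 2^-1 ^+ m2.
have eta00 : 0 < eta0 by rewrite mulr_gt0 // exprn_gt0.
have eta0th : eta0 <= 2 * Cc * th.
  have -> : 2 * Cc * th = Cc * (2 * th) by ring.
  by rewrite ler_wpM2l // ltW.
pose a := 1 - h.
have a12 : 2^-1 <= a.
  by rewrite /a hE lerBrDl -lerBrDr (_ : 1 - 2^-1 = 2^-1) ?ltW //; field.
have a1 : a <= 1 by rewrite /a gerBl ltW.
have [jU eU] := sol_jet jB jQ jF e0 hu.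
(* u - P has residual eta0 and an error of order 1 at x = 1 only; by [barrier] the latter decays to
   exp(-b0 h / e) on [0,a]. *)
have hde x : 0 <= x -> x <= a -> `|u x - P.[x]| <= Y * th.
  move=> x0 xa.
  have cz : {within `[0, 1], continuous (fun y => u y - P.[y])}.
    by apply: within_continuousB cu _; apply: continuous_subspaceT => y; exact: horner_cont.
  have dz1 : derOn 0 1 (fun y => u y - P.[y]) (fun y => jetof u 1 y - (P^`()).[y]).
    by move=> y y0 y1; exact: (dB (jU 0%N y y0 y1) (dhorner P y)).
  have dz2 : derOn 0 1 (fun y => jetof u 1 y - (P^`()).[y]) (fun y => jetof u 2 y - (P^`()^`()).[y]).
    by move=> y y0 y1; exact: (dB (jU 1%N y y0 y1) (dhorner P^`() y)).
  have Lz y : 0 < y -> y < 1 -> `|- e * (jetof u 2 y - (P^`()^`()).[y]) + b y * (jetof u 1 y - (P^`()).[y]) + r y * (u y - P.[y])| <= eta0.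
    move=> y0 y1.
    have := hP y y0 y1; have := eU 0%N y y0 y1; rewrite !leib0 => E.
    set Z := f y - _; have -> // : Z = - e * (jetof u 2 y - (P^`()^`()).[y]) + b y * (jetof u 1 y - (P^`()).[y]) + r y * (u y - P.[y]).
    have -> : - e * (jetof u 2 y - (P^`()^`()).[y]) = - (e * jetof u 2 y) + e * (P^`()^`()).[y] by ring.
    by rewrite E /Z /jetof /=; ring.
  have z0 : u 0 - P.[0] = 0 by rewrite u0 P0 subrr.
  have z1 : `|u 1 - P.[1]| <= Cc by rewrite u1 sub0r normrN Pb.
  have := barrier e0 b0p eta00 (ltW Cc0) r_ge0 hb cz dz1 dz2 Lz z0 z1 x0 (le_trans xa a1).
  move=> /le_trans; apply.
  have k1 : 4 * eta0 / b0 <= 8 * Cc / b0 * th.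
    rewrite [leRHS]mulrAC ler_pM2r ?invr_gt0 //.
    have -> : 8 * Cc * th = 4 * (2 * Cc * th) by ring.
    by rewrite ler_wpM2l.
  have k2 : expR (- (b0 / e) * (1 - x)) <= th.
    rewrite /th ler_expR !mulNr lerN2.
    apply: le_trans (_ : b0 / e * h <= _); last first.
      by rewrite ler_wpM2l ?divr_ge0 ?(ltW e0) ?(ltW b0p) // lerBrDr -lerBrDl.
    have -> : b0 / e * h = b0 / D%:R * p%:R by rewrite hE; field; rewrite !gt_eqF.
    by rewrite ler_wpM2r.
  rewrite /Y [leRHS]mulrDl; apply: lerD k1 _; by rewrite ler_wpM2l // ltW.
have Yth : 0 <= Y * th by rewrite mulr_ge0 // ltW.
have [sPL PL0 PLa hPL] := coarse_correction e0 e1 a12 a1 (ltW eta00) Yth hu P0 hP hde.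
set PL := P - _ in sPL PL0 PLa hPL.
have XE : (6 + 4 * Cb) * (Y * th) + 4 * Cb * (Y * th) + eta0 <= eta.
  apply: le_trans (etaC _ CX).
  have -> : ((6 + 4 * Cb) * Y + 4 * Cb * Y + 2 * Cc) * th =
    (6 + 4 * Cb) * (Y * th) + 4 * Cb * (Y * th) + 2 * Cc * th by ring.
  by rewrite lerD2l.
exists PR, S, PL; split=> //.
- split; [exact: leqW|exact: leq_trans sS _|].
  apply: leq_trans sPL _; rewrite geq_max ltnS p0 andbT.
  apply: leqW; apply: leq_trans sP _; apply: leq_trans m2D.
  by rewrite leq_mul2r /D2 mulnA leq_pmull ?orbT // muln_gt0 D0.
- by rewrite PRa PLa.
- by move=> x x0 xa; have [k1 k2 k3] := hPL x x0 xa; split;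
    [exact: le_trans k1 XE|exact: le_trans k2 XE|exact: le_trans k3 XE].
Qed.

End Data.
End Approximant.

(** * Weak derivatives on one cell *)

Section PolyIntegrals.
Context {R : realType}.
Implicit Types (a c x : R) (p q : {poly R}).

Lemma poly_nice a c p : nice a c (horner p).
Proof.
elim/poly_ind: p => [|p k IH].
  by apply: (nice_ext (f := fun=> 0)) => [x _ _|]; [rewrite horner0|exact: niceC].
have hX : nice a c (fun x => x).
  split=> [x _ _|]; first exact: cvg_id.
  exists (`|a| + `|c|) => x ax xc; rewrite ler_norml.
  have := ler_norm a; have := ler_norm c; have := ler_norm (- a); have := ler_norm (- c).
  by rewrite !normrN; have := normr_ge0 a; have := normr_ge0 c; lra.
apply: (nice_ext (f := fun x => p.[x] * x + k)) => [x _ _|]; first by rewrite hornerMXaddC.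
by apply: niceD; [exact: niceM|exact: niceC].
Qed.

Lemma Itg_poly a c p : a < c -> Itg a c (horner p^`()) = p.[c] - p.[a].
Proof.
move=> ac; apply: Itg_FTC => //.
- by apply: continuous_subspaceT => y; exact: horner_cont.
- by move=> x _ _; exact: dhorner.
- exact: poly_nice.
Qed.

Lemma poly_eq0_itv a c p : a < c -> (forall x, a < x -> x < c -> p.[x] = 0) -> p = 0.
Proof.
move=> ac hp; apply/eqP/negPn/negP => pn0.
pose F (k : nat) := a + (c - a) / k.+2%:R.
have ca : 0 < c - a by rewrite subr_gt0.
have Fi : injective F.
  move=> i j /addrI /(mulfI (lt0r_neq0 ca)) /invr_inj /eqP.
  by rewrite eqr_nat => /eqP [].
have := @max_poly_roots _ p [seq F k | k <- iota 0 (size p)] pn0.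
rewrite size_map size_iota ltnn => h; suff : false by [].
apply: h; last by rewrite map_inj_uniq // iota_uniq.
apply/allP => x /mapP[k _ ->]; rewrite rootE hp //.
  by rewrite ltrDl divr_gt0.
have : (c - a) / k.+2%:R < c - a by rewrite ltr_pdivrMr // ltr_pMr // ltr1n.
by rewrite /F -ltrBrDl.
Qed.

(** The primitive of p^2 is monotone with equal end values, hence constant. *)
Lemma Itg_sqr_eq0 a c p : a < c -> Itg a c (fun x => p.[x] * p.[x]) = 0 -> p = 0.
Proof.
move=> ac h0.
have [F [dF _ _]] := poly_antideriv (p * p) a 0.
have E s t : s < t -> Itg s t (fun x => p.[x] * p.[x]) = F.[t] - F.[s].
  by move=> st; rewrite -Itg_poly // dF; apply: Itg_ext => x _ _; rewrite hornerM.
have ge s t : 0 <= Itg s t (fun x => p.[x] * p.[x]).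
  by apply: Itg_ge0 => x _ _; rewrite -expr2 sqr_ge0.
have Fc : F - (F.[a])%:P = 0.
  apply: (poly_eq0_itv ac) => x ax xc; rewrite hornerD hornerN hornerC.
  have := ge a x; have := ge x c; rewrite !E // in h0 *; lra.
have : p * p = 0 by rewrite -dF -(subrK (F.[a])%:P F) Fc add0r derivC.
by move/eqP; rewrite mulf_eq0 orbb => /eqP.
Qed.

Lemma nice_sum n (F : 'I_n -> R -> R) a c : (forall i, nice a c (F i)) ->
  nice a c (fun x => \sum_(i < n) F i x).
Proof.
elim: n F => [|n IH] F h.
  by apply: (nice_ext (f := fun=> 0)) => [x _ _|]; [rewrite big_ord0|exact: niceC].
apply: (nice_ext (f := fun x => \sum_(i < n) F (widen_ord (leqnSn n) i) x + F ord_max x)).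
  by move=> x _ _; rewrite big_ord_recr.
by apply: niceD => //; apply: IH.
Qed.

Lemma Itg_sum n (F : 'I_n -> R -> R) a c : (forall i, nice a c (F i)) ->
  Itg a c (fun x => \sum_(i < n) F i x) = \sum_(i < n) Itg a c (F i).
Proof.
elim: n F => [|n IH] F h.
  rewrite big_ord0 (Itg_ext (g := fun=> 0 * 0)); last by move=> x _ _; rewrite big_ord0 mul0r.
  by rewrite ItgZ ?mul0r //; exact: niceC.
rewrite big_ord_recr /= -IH // -ItgD //; last by apply: nice_sum.
by apply: Itg_ext => x _ _; rewrite big_ord_recr.
Qed.

(** The Gram matrix of the monomials is invertible, since a kernel vector gives a polynomial of zero
    norm. This provides the existence of the weak derivatives. *)
Lemma riesz n a c (l : {poly R} -> R) : a < c ->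
  (forall p q, l (p + q) = l p + l q) -> (forall k p, l (k *: p) = k * l p) ->
  exists2 d : {poly R}, (size d <= n)%N &
    forall q, (size q <= n)%N -> Itg a c (fun x => d.[x] * q.[x]) = l q.
Proof.
move=> ac lD lZ.
pose P (v : 'rV[R]_n) : {poly R} := \sum_(i < n) v 0 i *: 'X^i.
have Px v x : (P v).[x] = \sum_(i < n) v 0 i * x ^+ i.
  by rewrite /P horner_sum; apply: eq_bigr => i _; rewrite !hornerE.
have nX (i j : 'I_n) (k : R) : nice a c (fun x => k * (x ^+ i * x ^+ j)).
  apply: niceM; first exact: niceC.
  by apply: (nice_ext (f := horner ('X^i * 'X^j))) => [x _ _|]; [rewrite !hornerE|exact: poly_nice].
pose G : 'M[R]_n := \matrix_(i, j) Itg a c (fun x => x ^+ i * x ^+ j).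
have GE v j : (v *m G) 0 j = Itg a c (fun x => (P v).[x] * ('X^j).[x]).
  rewrite mxE (Itg_ext (g := fun x => \sum_(i < n) v 0 i * (x ^+ i * x ^+ j))); last first.
    by move=> x _ _; rewrite Px hornerXn mulr_suml; apply: eq_bigr => i _; rewrite mulrA.
  rewrite Itg_sum //; apply: eq_bigr => i _; rewrite mxE ItgZ //.
  by have := nX i j 1; apply: nice_ext => x _ _; rewrite mul1r.
have nP v w : nice a c (fun x => (P v).[x] * w.[x]).
  by apply: niceM; exact: poly_nice.
have PG v w : Itg a c (fun x => (P v).[x] * (P w).[x]) = \sum_(j < n) w 0 j * (v *m G) 0 j.
  rewrite (Itg_ext (g := fun x => \sum_(j < n) w 0 j * ((P v).[x] * ('X^j).[x]))); last first.
    by move=> x _ _; rewrite (Px w) mulr_sumr; apply: eq_bigr => j _; rewrite hornerXn mulrCA.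
  rewrite Itg_sum; last by move=> j; apply: niceM; [exact: niceC|exact: nP].
  by apply: eq_bigr => j _; rewrite GE ItgZ.
have Gu : G \in unitmx.
  rewrite -row_free_unit -kermx_eq0; apply/eqP/row_matrixP => i; rewrite row0.
  set v := row i (kermx G).
  have vG : v *m G = 0 by rewrite /v -row_mul mulmx_ker row0.
  have : P v = 0.
    apply: (Itg_sqr_eq0 ac); rewrite PG vG big1 // => j _; by rewrite [X in _ * X]mxE mulr0.
  move=> Pv0; apply/rowP => j; rewrite [RHS]mxE.
  have : (P v)`_j = 0 by rewrite Pv0 coef0.
  rewrite /P coef_sum (bigD1 j) //= big1 ?addr0 ?coefZ ?coefXn ?eqxx ?mulr1 //.
  move=> k kj; rewrite coefZ coefXn; case: eqP => [E|_]; last by rewrite mulr0.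
  by move: kj; rewrite -(inj_eq val_inj) /= E eqxx.
pose L : 'rV[R]_n := \row_j l 'X^j.
exists (P (L *m invmx G)).
  apply: leq_trans (size_sum _ _ _) _; apply/bigmax_leqP => j _.
  apply: leq_trans (size_scale_leq _ _) _; rewrite size_polyXn; exact: ltn_ord.
move=> q qn.
have qE : q = P (\row_j q`_j).
  rewrite /P; apply/polyP => k; rewrite coef_sum.
  have [kn|nk] := ltnP k n; last first.
    rewrite nth_default ?(leq_trans qn) // big1 // => j _.
    rewrite coefZ coefXn; case: eqP => [E|_]; last by rewrite mulr0.
    by have := ltn_ord j; rewrite -E ltnNge nk.
  rewrite (bigD1 (Ordinal kn)) //= big1 ?addr0 ?coefZ ?coefXn ?eqxx ?mulr1 ?mxE //.
  move=> j jk; rewrite coefZ coefXn; case: eqP => [E|_]; last by rewrite mulr0.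
  by move: jk; rewrite -(inj_eq val_inj) /= E eqxx.
have lsum m (F : 'I_m -> {poly R}) : l (\sum_(i < m) F i) = \sum_(i < m) l (F i).
  elim: m F => [|m IH] F; first by rewrite !big_ord0 -(scale0r (0 : {poly R})) lZ mul0r.
  by rewrite !big_ord_recr /= lD IH.
rewrite {1}qE PG -mulmxA mulVmx // mulmx1 {2}qE /P lsum.
by apply: eq_bigr => j _; rewrite lZ !mxE.
Qed.

(** The weights are chosen so that one application uses a quarter of an energy term. *)
Lemma Itg_young a c (f h : R -> R) (t M : R) : 0 < t -> nice a c f -> nice a c h ->
  a <= c -> (forall x, a < x -> x < c -> `|f x| <= M) ->
  `|Itg a c (fun x => f x * h x)| <= t / 4 * Itg a c (fun x => h x * h x) + M ^+ 2 / t * (c - a).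
Proof.
move=> t0 nf nh ac hM.
have nhh := niceM nh nh; have nfh := niceM nf nh.
have n1 : nice a c (fun x => t / 4 * (h x * h x)) by apply: niceM nhh; exact: niceC.
have n2 : nice a c (fun=> M ^+ 2 / t) by exact: niceC.
have -> : t / 4 * Itg a c (fun x => h x * h x) + M ^+ 2 / t * (c - a) =
    Itg a c (fun x => t / 4 * (h x * h x) + M ^+ 2 / t).
  by rewrite ItgD // ItgZ // Itg_cst.
have nr : nice a c (fun x => t / 4 * (h x * h x) + M ^+ 2 / t).
  by apply: niceD; [apply: niceM nhh; exact: niceC|exact: niceC].
have key x : a < x -> x < c -> `|f x * h x| <= t / 4 * (h x * h x) + M ^+ 2 / t.
  move=> ax xc; rewrite normrM.
  have h1 : `|f x| * `|h x| <= M * `|h x| by rewrite ler_wpM2r // hM.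
  apply: le_trans h1 _.
  have -> : h x * h x = `|h x| ^+ 2 by rewrite real_normK ?num_real // expr2.
  rewrite -subr_ge0.
  have -> : t / 4 * `|h x| ^+ 2 + M ^+ 2 / t - M * `|h x| = t * (`|h x| / 2 - M / t) ^+ 2.
    by field; rewrite gt_eqF.
  by rewrite mulr_ge0 ?sqr_ge0 // ltW.
rewrite ler_norml; apply/andP; split.
  rewrite lerNl -mulN1r -ItgZ //; apply: Itg_le => //.
    by apply: niceM nfh; exact: niceC.
  move=> x ax xc; apply: le_trans (key x ax xc).
  by rewrite mulN1r -normrN ler_norm.
by apply: Itg_le => // x ax xc; apply: le_trans (key x ax xc); exact: ler_norm.
Qed.

(* [K = e E' E - b E^2 / 2] satisfies [K' = e E'^2 + (r E - L E) E - b' E^2 / 2]. *)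
Lemma energy_bound (e eta Cb a : R) (b b1 r E E1 E2 : R -> R) : 0 < e -> 0 < a -> a <= 1 -> 0 <= Cb -> 0 <= eta ->
  derOn 0 a b b1 -> derOn 0 a E E1 -> derOn 0 a E1 E2 ->
  nice 0 a b1 -> nice 0 a E -> nice 0 a E1 -> nice 0 a E2 ->
  (forall x, 0 < x -> x < a -> [/\ `|b x| <= Cb, `|b1 x| <= Cb & `|r x| <= Cb]) ->
  (forall x, 0 < x -> x < a -> [/\ `|E x| <= eta, e * `|E1 x| <= eta &
     `|- e * E2 x + b x * E1 x + r x * E x| <= eta]) ->
  e * Itg 0 a (fun x => E1 x * E1 x) <= (3 + 4 * Cb) * eta ^+ 2.
Proof.
move=> e0 a0 a1 Cb0 eta0 db dE dE1 nb1 nE nE1 nE2 hC hE.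
pose K x := e * (E1 x * E x) - 2^-1 * (b x * (E x * E x)).
pose K1 x := e * (E2 x * E x + E1 x * E1 x) - 2^-1 * (b1 x * (E x * E x) + b x * (E1 x * E x + E x * E1 x)).
have dK : derOn 0 a K K1.
  move=> x x0 xa; have d1 := dM (dE1 x x0 xa) (dE x x0 xa).
  by apply: (dB (dZ e d1) (dZ 2^-1 (dM (db x x0 xa) (dM (dE x x0 xa) (dE x x0 xa))))).
have nb : nice 0 a b.
  split; last by exists Cb => x x0 xa; case: (hC x x0 xa).
  by move=> x x0 xa; exact: (d_cont (db x x0 xa)).
have nK1 : nice 0 a K1.
  apply: niceB; (apply: niceM; first exact: niceC); apply: niceD; (apply: niceM => //); try exact: niceM.
  by apply: niceD; exact: niceM.
pose M := (1 + Cb) * eta ^+ 2.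
have M0 : 0 <= M by rewrite mulr_ge0 ?sqr_ge0 // addr_ge0.
have Cbe : 0 <= Cb * eta ^+ 2 by rewrite mulr_ge0 ?sqr_ge0.
have hK x : 0 < x -> x < a -> `|K x| <= M.
  move=> x0 xa; have [k1 k2 k3] := hE x x0 xa; have [c1 _ _] := hC x x0 xa.
  apply: le_trans (ler_normB _ _) _.
  have h1 : `|e * (E1 x * E x)| <= eta ^+ 2.
    by rewrite !normrM (gtr0_norm e0) mulrA expr2 ler_pM // mulr_ge0 // ltW.
  have h2 : `|b x * (E x * E x)| <= Cb * eta ^+ 2.
    by rewrite !normrM expr2 ler_pM // ?mulr_ge0 // ler_pM.
  have h12 : `|2^-1| = 2^-1 :> R by rewrite gtr0_norm // invr_gt0.
  rewrite [`|2^-1 * _|]normrM h12 /M; lra.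
have n11 := niceM nE1 nE1.
have key x : 0 < x -> x < a -> e * (E1 x * E1 x) <= K1 x + (1 + 2 * Cb) * eta ^+ 2.
  move=> x0 xa; have [k1 k2 k3] := hE x x0 xa; have [_ c1 c2] := hC x x0 xa.
  have -> : K1 x = e * (E1 x * E1 x) - (- e * E2 x + b x * E1 x + r x * E x) * E x + r x * (E x * E x) - 2^-1 * (b1 x * (E x * E x)).
    by rewrite /K1; field.
  have h1 : `|(- e * E2 x + b x * E1 x + r x * E x) * E x| <= eta ^+ 2 by rewrite normrM expr2 ler_pM.
  have h2 : `|r x * (E x * E x)| <= Cb * eta ^+ 2 by rewrite !normrM expr2 ler_pM // ?mulr_ge0 // ler_pM.
  have h3 : `|b1 x * (E x * E x)| <= Cb * eta ^+ 2 by rewrite !normrM expr2 ler_pM // ?mulr_ge0 // ler_pM.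
  move: h1 h2 h3; rewrite !ler_norml => /andP[? ?] /andP[? ?] /andP[? ?]; lra.
rewrite -ItgZ //.
apply: (@le_trans _ _ (Itg 0 a (fun x => K1 x + (1 + 2 * Cb) * eta ^+ 2))).
  apply: Itg_le => //; first by apply: niceM n11; exact: niceC.
  by apply: niceD => //; exact: niceC.
rewrite ItgD //; last exact: niceC.
rewrite Itg_cst ?(ltW a0) // subr0.
have h1 : (1 + 2 * Cb) * eta ^+ 2 * a <= (1 + 2 * Cb) * eta ^+ 2.
  by rewrite ler_piMr // mulr_ge0 ?sqr_ge0 // addr_ge0 // mulr_ge0.
suff h2 : Itg 0 a K1 <= 2 * M by rewrite /M in h2; lra.
have [_ [B hB]] := nK1.
(* K is controlled only inside (0,a), so the integral of K1 is evaluated on (d, a - d). *)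
apply: (le_limit (D := a / 2) (C := 2 * B)); first lra.
move=> d d0 da.
have dd : d < a - d by lra.
have n1 : nice 0 d K1 by apply: nice_sub nK1 => //; lra.
have n2 : nice d (a - d) K1 by apply: nice_sub nK1; lra.
have n3 : nice (a - d) a K1 by apply: nice_sub nK1; lra.
have n4 : nice d a K1 by apply: nice_sub nK1; lra.
have da' : d < a by lra.
have ada : a - d < a by lra.
rewrite (Itg_split d0 da' n1 n4) (Itg_split dd ada n2 n3).
have F : Itg d (a - d) K1 = K (a - d) - K d.
  apply: Itg_FTC => //; first by apply: (derOn_cont dK); lra.
  by move=> y y0 ya; apply: dK; lra.
have g1 : `|Itg 0 d K1| <= B * (d - 0).
  by apply: Itg_norm_le => //; [lra|move=> y y0 yd; apply: hB; lra].
have g2 : `|Itg (a - d) a K1| <= B * (a - (a - d)).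
  by apply: Itg_norm_le => //; [lra|move=> y y0 yd; apply: hB; lra].
have g3 : `|K (a - d)| <= M by apply: hK; lra.
have g4 : `|K d| <= M by apply: hK; lra.
rewrite F; move: g1 g2 g3 g4; rewrite !ler_norml => /andP[? ?] /andP[? ?] /andP[? ?] /andP[? ?].
have E3 : B * (a - (a - d)) = B * d by congr (_ * _); ring.
lra.
Qed.

End PolyIntegrals.

(** * Stability and consistency on one cell *)

Section Cell.
Context {R : realType}.
Implicit Types x : R.

(* The functional defining the weak derivatives on the cell [(xl, xr)]. *)
Definition weak_pairing (xl xr : R) (v : R -> R) (vl vr : R) (q q1 : R -> R) : R :=
  - Itg xl xr (fun x => v x * q1 x) + vr * q xr - vl * q xl.

Lemma weak_pairing_parts (xl xr : R) (v v1 q q1 : R -> R) : xl < xr ->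
  {within `[xl, xr], continuous v} -> {within `[xl, xr], continuous q} ->
  derOn xl xr v v1 -> derOn xl xr q q1 ->
  nice xl xr v -> nice xl xr v1 -> nice xl xr q -> nice xl xr q1 ->
  weak_pairing xl xr v (v xl) (v xr) q q1 = Itg xl xr (fun x => v1 x * q x).
Proof.
move=> lr cv cq dv dq nv nv1 nq nq1; rewrite /weak_pairing.
have F : Itg xl xr (fun x => v1 x * q x + v x * q1 x) = v xr * q xr - v xl * q xl.
  apply: (@Itg_FTC _ xl xr (fun x => v x * q x)) => //; first exact: within_continuousM.
    by move=> x ax xc; exact: (dM (dv x ax xc) (dq x ax xc)).
  by apply: niceD; exact: niceM.
rewrite ItgD in F; [|exact: niceM|exact: niceM].
lra.
Qed.

Lemma poly_within (A : set R) (p : {poly R}) : {within A, continuous (horner p)}.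
Proof. by apply: continuous_subspaceT => y; exact: horner_cont. Qed.

Lemma weak_pairing_poly (xl xr : R) (p q : {poly R}) : xl < xr ->
  weak_pairing xl xr (horner p) p.[xl] p.[xr] (horner q) (horner q^`()) = Itg xl xr (fun x => (p^`()).[x] * q.[x]).
Proof.
move=> lr; apply: weak_pairing_parts => //; try exact: poly_within; try exact: poly_nice;
  move=> x _ _; exact: dhorner.
Qed.

Lemma weak_pairing_add (xl xr : R) (v w : R -> R) (vl vr wwl wr : R) (q q1 : R -> R) :
  nice xl xr v -> nice xl xr w -> nice xl xr q1 ->
  weak_pairing xl xr (fun x => v x + w x) (vl + wwl) (vr + wr) q q1 = weak_pairing xl xr v vl vr q q1 + weak_pairing xl xr w wwl wr q q1.
Proof.
move=> nv nw nq; rewrite /weak_pairing.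
rewrite (Itg_ext (g := fun x => v x * q1 x + w x * q1 x)); last by move=> x _ _; rewrite mulrDl.
rewrite ItgD; [ring|exact: niceM|exact: niceM].
Qed.

Lemma weak_pairing_ext (xl xr : R) (v w : R -> R) (vl vr : R) (q q1 q2 : R -> R) :
  (forall x, xl < x -> x < xr -> v x = w x /\ q1 x = q2 x) ->
  weak_pairing xl xr v vl vr q q1 = weak_pairing xl xr w vl vr q q2.
Proof.
by move=> h; rewrite /weak_pairing; congr (- _ + _ - _); apply: Itg_ext => x ax xc; have [-> ->] := h x ax xc.
Qed.

Variables (xl xr e gam eta etaS : R) (b b1 r f : R -> R) (p : nat).
Variables (P E De Dup Dc S : {poly R}) (el er : R).
Hypotheses (lr : xl < xr) (e_gt0 : 0 < e) (gam_gt0 : 0 < gam) (p_gt0 : (0 < p)%N).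
Hypotheses (sP : (size P <= p.+1)%N) (sE : (size E <= p.+1)%N).
Hypotheses (sDe : (size De <= p)%N) (sS : (size S <= p)%N).
Hypotheses (cb : {within `[xl, xr], continuous b}) (db : derOn xl xr b b1).
Hypotheses (nb : nice xl xr b) (nb1 : nice xl xr b1) (nr : nice xl xr r) (nf : nice xl xr f).
Hypothesis hgam : forall x, xl < x -> x < xr -> gam <= r x - 2^-1 * b1 x.
Hypothesis specE : forall q : {poly R}, (size q <= p)%N ->
  Itg xl xr (fun x => De.[x] * q.[x]) = weak_pairing xl xr (horner E) el er (horner q) (horner q^`()).
Hypothesis specU : forall q : {poly R}, (size q <= p)%N ->
  Itg xl xr (fun x => Dup.[x] * q.[x]) =
  weak_pairing xl xr (fun x => P.[x] + E.[x]) (P.[xl] + el) (P.[xr] + er) (horner q) (horner q^`()).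
Hypothesis specC : forall q : {poly R}, (size q <= p.+1)%N ->
  Itg xl xr (fun x => Dc.[x] * q.[x]) =
  weak_pairing xl xr (fun x => P.[x] + E.[x]) (P.[xl] + el) (P.[xr] + er) (fun x => b x * q.[x])
    (fun x => b1 x * q.[x] + b x * (q^`()).[x]).
Let g x := f x - (- e * (P^`()^`()).[x] + b x * (P^`()).[x] + r x * P.[x]) - (S^`()).[x].
Hypothesis hg : forall x, xl < x -> x < xr -> `|g x| <= eta.
Hypothesis hS : forall x, xl < x -> x < xr -> `|S.[x]| <= etaS.
(** The boundary terms of the convection: the squared jumps at both ends, and a difference of b
    e_b^2 / 2 that telescopes over the cells. *)
Let J := - (2^-1 * (b xr * (E.[xr] - er) ^+ 2)) + 2^-1 * (b xl * (E.[xl] - el) ^+ 2)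
  + 2^-1 * (b xr * er ^+ 2 - b xl * el ^+ 2).

Let I (h : R -> R) := Itg xl xr h.

Let np (q : {poly R}) : nice xl xr (horner q). Proof. exact: poly_nice. Qed.

(** Twice E (b E)' is (b E^2)' + b' E^2; completing squares with the nodal values turns the boundary
    terms into [J]. *)
Lemma cell_convection : I (fun x => Dc.[x] * E.[x]) =
  I (fun x => b x * (P^`()).[x] * E.[x]) - 2^-1 * I (fun x => b1 x * (E.[x] * E.[x])) + J.
Proof.
have dbE (q : {poly R}) : derOn xl xr (fun x => b x * q.[x]) (fun x => b1 x * q.[x] + b x * (q^`()).[x]).
  by move=> x ax xc; exact: (dM (db ax xc) (dhorner q x)).
have cbE (q : {poly R}) : {within `[xl, xr], continuous (fun x => b x * q.[x])}.
  by apply: within_continuousM cb _; exact: poly_within.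
have nbE (q : {poly R}) : nice xl xr (fun x => b x * q.[x]) by exact: niceM.
have nbE1 (q : {poly R}) : nice xl xr (fun x => b1 x * q.[x] + b x * (q^`()).[x]).
  by apply: niceD; exact: niceM.
have H1 : I (fun x => Dc.[x] * E.[x]) = _ := specC sE.
rewrite weak_pairing_add // in H1.
have H2 : weak_pairing xl xr (horner P) P.[xl] P.[xr] (fun x => b x * E.[x]) (fun x => b1 x * E.[x] + b x * (E^`()).[x])
   = I (fun x => (P^`()).[x] * (b x * E.[x])).
  by apply: weak_pairing_parts => //; [exact: poly_within|move=> x _ _; exact: dhorner].
have H3 : I (fun x => (b1 x * E.[x] + b x * (E^`()).[x]) * E.[x] + b x * E.[x] * (E^`()).[x]) =
   b xr * E.[xr] * E.[xr] - b xl * E.[xl] * E.[xl].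
  apply: (@Itg_FTC _ _ _ (fun x => b x * E.[x] * E.[x])) => //.
  - have cE : {within `[xl, xr], continuous (horner E)} by exact: poly_within.
    exact: (within_continuousM (cbE E) cE).
  - by move=> x ax xc; exact: (dM (dbE E x ax xc) (dhorner E x)).
  - by apply: niceD; apply: niceM.
have n1 : nice xl xr (fun x => E.[x] * (b1 x * E.[x] + b x * (E^`()).[x])) by exact: niceM.
have n2 : nice xl xr (fun x => b1 x * (E.[x] * E.[x])) by apply: niceM => //; exact: niceM.
have H4 : 2 * I (fun x => E.[x] * (b1 x * E.[x] + b x * (E^`()).[x])) - I (fun x => b1 x * (E.[x] * E.[x])) =
   b xr * E.[xr] * E.[xr] - b xl * E.[xl] * E.[xl].
  rewrite -H3 /I -ItgZ // -ItgB //; last by apply: niceM => //; exact: niceC.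
  by apply: Itg_ext => x _ _; ring.
rewrite H1 H2.
have -> : I (fun x => (P^`()).[x] * (b x * E.[x])) = I (fun x => b x * (P^`()).[x] * E.[x]).
  by apply: Itg_ext => x _ _; ring.
rewrite /weak_pairing -/(I _) /J.
by have := H4; set X := I _; set Y := I _; lra.
Qed.

(** The left-hand equation is rewritten through f - L P - S'. Since P' and S have degree at most p -
    1, they may be used as test functions for the weak derivative of E; thus (S', E) becomes -(S,
    De) plus nodal terms. The two Young inequalities take a quarter of the diffusion and of the
    reaction, and the flux e P' - S remains at the nodes. *)
Lemma cell_lower :
  3 / 4 * (e * I (fun x => De.[x] * De.[x])) + 3 / 4 * (gam * I (fun x => E.[x] * E.[x])) + J
   - (eta ^+ 2 / gam + etaS ^+ 2 / e) * (xr - xl)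
   + (er * (e * (P^`()).[xr] - S.[xr]) - el * (e * (P^`()).[xl] - S.[xl])) <=
  e * I (fun x => Dup.[x] * De.[x]) + I (fun x => Dc.[x] * E.[x]) +
  I (fun x => r x * (P.[x] + E.[x]) * E.[x]) - I (fun x => f x * E.[x]).
Proof.
have lr' := ltW lr; have e0 := e_gt0; have gam0 := gam_gt0.
have sdP : (size P^`() <= p)%N.
  have [->|Pn0] := eqVneq P 0; first by rewrite deriv0 size_poly0.
  by rewrite -ltnS; apply: leq_trans (lt_size_deriv Pn0) sP.
have H1 : I (fun x => Dup.[x] * De.[x]) =
    I (fun x => (P^`()).[x] * De.[x]) + I (fun x => De.[x] * De.[x]).
  by rewrite /I specU // weak_pairing_add // weak_pairing_poly // specE.
have H2 : I (fun x => (P^`()).[x] * De.[x]) =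
   - I (fun x => E.[x] * (P^`()^`()).[x]) + er * (P^`()).[xr] - el * (P^`()).[xl].
  rewrite -[RHS]/(weak_pairing xl xr (horner E) el er (horner P^`()) (horner P^`()^`())) -specE //.
  by apply: Itg_ext => x _ _; rewrite mulrC.
have H3 : I (fun x => De.[x] * S.[x]) = - I (fun x => E.[x] * (S^`()).[x]) + er * S.[xr] - el * S.[xl].
  exact: specE.
have H4 := cell_convection.
have nE2 : nice xl xr (fun x => E.[x] * E.[x]) by exact: niceM.
have nD2 : nice xl xr (fun x => De.[x] * De.[x]) by exact: niceM.
have ng : nice xl xr g.
  have h1 := niceD (niceD (niceM (niceC xl xr (- e)) (np P^`()^`())) (niceM nb (np P^`()))) (niceM nr (np P)).
  exact: (niceB (niceB nf h1) (np S^`())).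
have Y1 := Itg_young gam0 ng (np E) lr' hg.
have Y2 := Itg_young e0 (np S) (np De) lr' hS.
have H5 : I (fun x => r x * (P.[x] + E.[x]) * E.[x]) - I (fun x => f x * E.[x])
    + I (fun x => b x * (P^`()).[x] * E.[x]) - 2^-1 * I (fun x => b1 x * (E.[x] * E.[x]))
    - e * I (fun x => E.[x] * (P^`()^`()).[x]) =
  I (fun x => (r x - 2^-1 * b1 x) * (E.[x] * E.[x])) - I (fun x => g x * E.[x]) - I (fun x => E.[x] * (S^`()).[x]).
  have n1 : nice xl xr (fun x => r x * (P.[x] + E.[x]) * E.[x]).
    by apply: niceM => //; apply: niceM => //; exact: niceD.
  have n2 : nice xl xr (fun x => f x * E.[x]) by exact: niceM.
  have n3 : nice xl xr (fun x => b x * (P^`()).[x] * E.[x]) by apply: niceM => //; exact: niceM.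
  have n4 : nice xl xr (fun x => b1 x * (E.[x] * E.[x])) by exact: niceM.
  have n5 : nice xl xr (fun x => E.[x] * (P^`()^`()).[x]) by exact: niceM.
  have n6 : nice xl xr (fun x => (r x - 2^-1 * b1 x) * (E.[x] * E.[x])).
    by apply: niceM => //; apply: niceB => //; apply: niceM => //; exact: niceC.
  have n7 : nice xl xr (fun x => g x * E.[x]) by exact: niceM.
  have n8 : nice xl xr (fun x => E.[x] * (S^`()).[x]) by exact: niceM.
  have n4' : nice xl xr (fun x => 2^-1 * (b1 x * (E.[x] * E.[x]))) by apply: niceM => //; exact: niceC.
  have n5' : nice xl xr (fun x => e * (E.[x] * (P^`()^`()).[x])) by apply: niceM => //; exact: niceC.
  have m1 := niceB n1 n2; have m2 := niceD m1 n3; have m3 := niceB m2 n4'.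
  rewrite /I -(ItgZ _ n4) -(ItgZ _ n5) -(ItgB n1 n2) -(ItgD m1 n3) -(ItgB m2 n4') -(ItgB m3 n5').
  rewrite -(ItgB n6 n7) -(ItgB (niceB n6 n7) n8).
  by apply: Itg_ext => x _ _; rewrite /g; ring.
have H6 : gam * I (fun x => E.[x] * E.[x]) <= I (fun x => (r x - 2^-1 * b1 x) * (E.[x] * E.[x])).
  rewrite /I -ItgZ //; apply: Itg_le.
  - by apply: niceM => //; exact: niceC.
  - by apply: niceM => //; apply: niceB => //; apply: niceM => //; exact: niceC.
  - by move=> x ax xc; rewrite ler_wpM2r ?hgam // -expr2 sqr_ge0.
have Y2' : Itg xl xr (fun x => S.[x] * De.[x]) = I (fun x => De.[x] * S.[x]).
  by apply: Itg_ext => x _ _; rewrite mulrC.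
rewrite Y2' in Y2.
rewrite H1 H4.
move: Y1 Y2; rewrite !ler_norml => /andP[_ Y1] /andP[Y2 _].
rewrite -!/(I _) in Y1 Y2.
have EH : e * (I (fun x => (P^`()).[x] * De.[x]) + I (fun x => De.[x] * De.[x])) =
  e * I (fun x => De.[x] * De.[x]) - e * I (fun x => E.[x] * (P^`()^`()).[x])
   + (er * (e * (P^`()).[xr]) - el * (e * (P^`()).[xl])) by rewrite H2; ring.
rewrite EH.
clear specE specU specC H1 H2 H4 EH Y2' hg hS hgam ng nE2 nD2.
move: (I (fun x => De.[x] * De.[x])) (I (fun x => E.[x] * (P^`()^`()).[x]))
  (I (fun x => De.[x] * S.[x])) (I (fun x => E.[x] * (S^`()).[x]))
  (I (fun x => r x * (P.[x] + E.[x]) * E.[x])) (I (fun x => f x * E.[x]))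
  (I (fun x => b x * (P^`()).[x] * E.[x])) (I (fun x => b1 x * (E.[x] * E.[x])))
  (I (fun x => (r x - 2^-1 * b1 x) * (E.[x] * E.[x]))) (I (fun x => g x * E.[x]))
  (I (fun x => E.[x] * E.[x])) H3 H5 H6 Y1 Y2 => X1 X2 X3 X4 X5 X6 X7 X8 X9 X10 X11.
move: J (P^`()).[xr] (P^`()).[xl] S.[xr] S.[xl] => j p1 p2 s1 s2.
move=> H3 H5 H6 Y1 Y2.
have -> : 3 / 4 * (e * X1) + 3 / 4 * (gam * X11) + j - (eta ^+ 2 / gam + etaS ^+ 2 / e) * (xr - xl) +
  (er * (e * p1 - s1) - el * (e * p2 - s2)) =
  3 / 4 * (e * X1) + 3 / 4 * (gam * X11) + j - eta ^+ 2 / gam * (xr - xl) - etaS ^+ 2 / e * (xr - xl)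
   + (er * (e * p1) - el * (e * p2)) - (er * s1 - el * s2) by ring.
move: (er * (e * p1)) (el * (e * p2)) (eta ^+ 2 / gam * (xr - xl)) (etaS ^+ 2 / e * (xr - xl)) (e * X2) Y1 Y2 H5 => y1 y2 y3 y4 y5 Y1 Y2 H5.
have k1 : gam / 4 * X11 = 4^-1 * (gam * X11) by ring.
have k2 : e / 4 * X1 = 4^-1 * (e * X1) by ring.
rewrite k1 in Y1; rewrite k2 in Y2.
move: (gam * X11) (e * X1) (er * s1) (el * s2) Y1 Y2 H3 H5 H6 => z1 z2 z3 z4 Y1 Y2 H3 H5 H6.
lra.
Qed.

End Cell.

(** * Discrete error on a mesh *)

Section MeshTools.
Context {R : realType}.
Notation mu := (@lebesgue_measure R).
Implicit Types x : R.

Lemma ex2_and (T : Type) (A B : T -> Prop) : (exists2 y, A y & B y) -> exists y, A y /\ B y.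
Proof. by move=> [y Ay By]; exists y. Qed.

Lemma bounded_L2 (D : set R) (v : R -> R) (M : R) : measurable D -> (mu D < +oo)%E -> measurable_fun D v ->
  (forall x, D x -> `|v x| <= M) -> L2 D v.
Proof.
move=> mD fD mv hM; rewrite /L2 inE; apply/andP; split; rewrite inE /=.
  exact/(measurable_restrictT v mD).
rewrite /finite_norm unlock poweR_lty //.
have i2 : mu.-integrable D (EFin \o (fun x => v x ^+ 2)).
  apply: (@bounded_int _ _ _ (M ^+ 2)) => //; first exact: measurable_funX.
  by move=> x Dx; rewrite normrX lerXn2r ?nnegrE ?hM // (le_trans (normr_ge0 _) (hM x Dx)).
have /integrableP[_ h] := i2; rewrite [X in (X < _)%E]integral_mkcond in h.
apply: le_lt_trans h; rewrite le_eqVlt; apply/orP; left; apply/eqP.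
congr (integral _ _ _); apply: funext => x; rewrite /patch /=; case: ifP => _ /=.
  by rewrite powR_mulrn // normrX.
by rewrite normr0 powR0 // pnatr_eq0.
Qed.

Lemma poly_H1 (s t : R) (v : R -> R) (q : {poly R}) : (forall x, s < x -> x < t -> v x = q.[x]) -> H1 s t v.
Proof.
move=> vq; have n1 := poly_nice s t q; have n2 := poly_nice s t q^`().
have L (p : {poly R}) : L2 `]s, t[ (horner p).
  have np := poly_nice s t p; have [_ [M hM]] := np.
  apply: (@bounded_L2 _ _ M); [exact: measurable_itv|exact: oo_fin|exact: nice_measurable|].
  by move=> x /=; rewrite in_itv /= => /andP[? ?]; exact: hM.
split.
  have nv : nice s t v by apply: nice_ext n1 => x sx xt; rewrite vq.
  have [_ [M hM]] := nv.
  apply: (@bounded_L2 _ _ M); [exact: measurable_itv|exact: oo_fin|exact: nice_measurable|].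
  by move=> x /=; rewrite in_itv /= => /andP[? ?]; exact: hM.
exists (horner q^`()); first exact: L.
move=> y z sy yz zt.
have [->|yz'] := eqVneq y z.
  by rewrite subrr set_itv1 Rintegral_set1.
have {}yz : y < z by rewrite lt_neqAle yz'.
rewrite vq ?vq //; [|exact: lt_trans zt|exact: lt_trans sy yz].
rewrite -Itg_poly // /Itg Rintegral_itv_bndo_bndc; last exact: (nice_int (poly_nice _ _ _)).
rewrite -Rintegral_itv_obnd_cbnd //.
apply: (@bounded_int _ _ _ (let: h := poly_nice (y - 1) (z + 1) q^`() in projT1 (cid h.2))).
- exact: measurable_itv.
- apply: itv_fin; exists (`|y| + `|z|) => x; rewrite in_itv /= => /andP[yx xz].
  rewrite ler_norml; have := ler_norm y; have := ler_norm z; have := ler_norm (- y); have := ler_norm (- z).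
  by rewrite !normrN; have := normr_ge0 y; have := normr_ge0 z; lra.
- apply: (@measurable_funS _ _ _ _ `]y - 1, z + 1[); first exact: measurable_itv.
    by move=> x /=; rewrite !in_itv /=; lra.
  exact: nice_measurable (poly_nice _ _ _).
- move=> x /=; rewrite in_itv /= => /andP[yx xz].
  case: cid => M hM /=; apply: hM; lra.
Qed.

Lemma lim_left (s t : R) (v h : R -> R) : s < t -> (forall x, s < x -> x < t -> v x = h x) ->
  {within `[s, t], continuous h} -> lim (v x @[x --> t^'-]) = h t.
Proof.
move=> st vh /(continuous_within_itvP _ st)[_ _ ht].
apply/cvg_lim => //; apply: cvg_trans ht; apply: near_eq_cvg.
near=> x; apply/esym/vh; near: x; [exact: nbhs_left_gt|exact: nbhs_left_lt].
Unshelve. all: by end_near. Qed.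

Lemma lim_right (s t : R) (v h : R -> R) : s < t -> (forall x, s < x -> x < t -> v x = h x) ->
  {within `[s, t], continuous h} -> lim (v x @[x --> s^'+]) = h s.
Proof.
move=> st vh /(continuous_within_itvP _ st)[_ hs _].
apply/cvg_lim => //; apply: cvg_trans hs; apply: near_eq_cvg.
near=> x; apply/esym/vh; near: x; [exact: nbhs_right_gt|exact: nbhs_right_lt].
Unshelve. all: by end_near. Qed.

Variable om : mesh R.
Notation xl j := (node (lidx j)).
Notation xr j := (node (ridx j)).

(** What the analysis needs of a mesh, so that the one-cell and two-cell cases are treated together:
    besides the mesh axiom, disjoint cells and additivity of the integral. *)
Definition mesh_ok : Prop :=
  [/\ mesh_axiom om,
      forall j : 'I_(cells om), 0 <= xl j /\ xr j <= 1,
      forall (i j : 'I_(cells om)) x, cell i x -> cell j x -> i = j &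
      forall k, (forall j : 'I_(cells om), nice (xl j) (xr j) k) ->
        Itg 0 1 k = \sum_(j < cells om) Itg (xl j) (xr j) k].

Hypothesis ok : mesh_ok.

Lemma mesh_lt (j : 'I_(cells om)) : xl j < xr j.
Proof. by have [[_ _ h] _ _ _] := ok. Qed.

Lemma pwfun_cell (d : pwpoly om) (j : 'I_(cells om)) x : xl j < x -> x < xr j -> pwfun d x = (d j).[x].
Proof.
move=> lx xr'; have cj : cell j x by rewrite /cell /= in_itv /= lx.
have [_ _ dis _] := ok.
rewrite /pwfun (bigD1 j) //= indicE mem_set // mulr1 big1 ?addr0 // => i ij.
rewrite indicE memNset ?mulr0 // => ci; move/negP: ij; apply; apply/eqP; exact: dis ci cj.
Qed.

Lemma mesh_tele (F : 'I_(cells om).+1 -> R) :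
  \sum_(j < cells om) (F (ridx j) - F (lidx j)) = F ord_max - F ord0.
Proof.
have h : F ord0 + \sum_(i < cells om) F (lift ord0 i) =
    \sum_(i < cells om) F (widen_ord (leqnSn (cells om)) i) + F ord_max.
  by rewrite -big_ord_recl big_ord_recr.
rewrite sumrB /ridx /lidx; move: h.
by set X := \sum_(i < _) F (lift ord0 i); set Y := \sum_(i < _) F (widen_ord _ i); lra.
Qed.

(** [weakD] selects by [xget], which is meaningful once an element exists; [riesz] gives one on each
    cell and the choices are assembled. *)
Lemma weakD_ex n (v : wpair om) : (forall j : 'I_(cells om), nice (xl j) (xr j) v.1) ->
  exists d : pwpoly om, weakD n v = pwfun d /\ forall j, (size (d j) <= n.+1)%N /\
    forall q : {poly R}, (size q <= n.+1)%N ->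
      Itg (xl j) (xr j) (fun x => (d j).[x] * q.[x]) =
      weak_pairing (xl j) (xr j) v.1 (v.2 (lidx j)) (v.2 (ridx j)) (horner q) (horner q^`()).
Proof.
move=> nv.
have ex (j : 'I_(cells om)) : exists d : {poly R}, (size d <= n.+1)%N /\ forall q : {poly R}, (size q <= n.+1)%N ->
      Itg (xl j) (xr j) (fun x => d.[x] * q.[x]) =
      weak_pairing (xl j) (xr j) v.1 (v.2 (lidx j)) (v.2 (ridx j)) (horner q) (horner q^`()).
  apply: ex2_and; apply: riesz (mesh_lt j) _ _.
  - move=> p q; rewrite /weak_pairing !hornerD.
    rewrite (Itg_ext (g := fun x => v.1 x * (p^`()).[x] + v.1 x * (q^`()).[x])); last first.
      by move=> x _ _; rewrite derivD hornerD mulrDr.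
    by rewrite ItgD; [ring|apply: niceM => //; exact: poly_nice|apply: niceM => //; exact: poly_nice].
  - move=> k p; rewrite /weak_pairing !hornerZ.
    rewrite (Itg_ext (g := fun x => k * (v.1 x * (p^`()).[x]))); last first.
      by move=> x _ _; rewrite derivZ hornerZ; ring.
    by rewrite ItgZ; [ring|apply: niceM => //; exact: poly_nice].
have [d hd] := choice ex.
have H : exists d : {ffun 'I_(cells om) -> {poly R}}, is_weakD n v d.
  exists (finfun d); split=> j; first by rewrite ffunE; case: (hd j).
  move=> q sq; have [_ h] := hd j; apply: etrans (h q sq).
  by apply: Itg_ext => x lx xr'; rewrite (pwfun_cell _ lx xr') ffunE.
have := xgetPex [ffun=> 0] H; rewrite /weakD; set D := xget _ _ => -[sD hD].
exists D; split=> // j; split; first exact: sD.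
move=> q sq; rewrite /weak_pairing /Itg -(hD j q sq); apply: Itg_ext => x lx xr'.
by rewrite (pwfun_cell _ lx xr').
Qed.

(** As for [weakD_ex]; the product rule replaces [derive1] of b q, which is legitimate inside the
    cells. *)
Lemma weakDc_ex (b b1 : R -> R) n (v : wpair om) : (forall j : 'I_(cells om), nice (xl j) (xr j) v.1) ->
  (forall j : 'I_(cells om), nice (xl j) (xr j) b) -> (forall j : 'I_(cells om), nice (xl j) (xr j) b1) ->
  (forall j : 'I_(cells om), derOn (xl j) (xr j) b b1) ->
  exists d : pwpoly om, weakDc b n v = pwfun d /\ forall j, (size (d j) <= n.+1)%N /\
    forall q : {poly R}, (size q <= n.+1)%N ->
      Itg (xl j) (xr j) (fun x => (d j).[x] * q.[x]) =
      weak_pairing (xl j) (xr j) v.1 (v.2 (lidx j)) (v.2 (ridx j)) (fun x => b x * q.[x])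
       (fun x => b1 x * q.[x] + b x * (q^`()).[x]).
Proof.
move=> nv nb nb1 db.
have nvb (j : 'I_(cells om)) (q : {poly R}) : nice (xl j) (xr j) (fun x => v.1 x * (b1 x * q.[x] + b x * (q^`()).[x])).
  exact: (niceM (nv j) (niceD (niceM (nb1 j) (poly_nice _ _ _)) (niceM (nb j) (poly_nice _ _ _)))).
have ex (j : 'I_(cells om)) : exists d : {poly R}, (size d <= n.+1)%N /\ forall q : {poly R}, (size q <= n.+1)%N ->
      Itg (xl j) (xr j) (fun x => d.[x] * q.[x]) =
      weak_pairing (xl j) (xr j) v.1 (v.2 (lidx j)) (v.2 (ridx j)) (fun x => b x * q.[x])
       (fun x => b1 x * q.[x] + b x * (q^`()).[x]).
  apply: ex2_and; apply: riesz (mesh_lt j) _ _.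
  - move=> p q; rewrite /weak_pairing !hornerD.
    rewrite (Itg_ext (g := fun x => v.1 x * (b1 x * p.[x] + b x * (p^`()).[x]) + v.1 x * (b1 x * q.[x] + b x * (q^`()).[x]))); last first.
      by move=> x _ _; rewrite derivD !hornerD; ring.
    by rewrite ItgD //; ring.
  - move=> k p; rewrite /weak_pairing !hornerZ.
    rewrite (Itg_ext (g := fun x => k * (v.1 x * (b1 x * p.[x] + b x * (p^`()).[x])))); last first.
      by move=> x _ _; rewrite derivZ !hornerZ; ring.
    by rewrite ItgZ //; ring.
have [d hd] := choice ex.
have dE (j : 'I_(cells om)) (q : {poly R}) x : xl j < x -> x < xr j -> derive1 (fun x => b x * q.[x]) x = b1 x * q.[x] + b x * (q^`()).[x].
  by move=> lx xr'; exact: (d_derive1 (dM (db j x lx xr') (dhorner q x))).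
have E (j : 'I_(cells om)) (q : {poly R}) : weak_pairing (xl j) (xr j) v.1 (v.2 (lidx j)) (v.2 (ridx j)) (fun x => b x * q.[x])
       (fun x => b1 x * q.[x] + b x * (q^`()).[x]) =
   weak_pairing (xl j) (xr j) v.1 (v.2 (lidx j)) (v.2 (ridx j)) (fun x => b x * q.[x]) (derive1 (fun x => b x * q.[x])).
  by apply: weak_pairing_ext => x lx xr'; rewrite (dE j).
have H : exists d : {ffun 'I_(cells om) -> {poly R}}, is_weakDc b n v d.
  exists (finfun d); split=> j; first by rewrite ffunE; case: (hd j).
  move=> q sq bq; have [_ h] := hd j; apply: etrans (etrans (h q sq) (E _ _)).
  by apply: Itg_ext => x lx xr'; rewrite (pwfun_cell _ lx xr') ffunE.
have := xgetPex [ffun=> 0] H; rewrite /weakDc; set D := xget _ _ => -[sD hD].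
exists D; split=> // j; split; first exact: sD.
move=> q sq; rewrite E /weak_pairing /Itg -(hD j q sq); apply: Itg_ext => x lx xr'.
by rewrite (pwfun_cell _ lx xr').
Qed.

Lemma ipI_cells (v w : R -> R) (h : 'I_(cells om) -> R -> R) :
  (forall j : 'I_(cells om), nice (xl j) (xr j) (h j)) ->
  (forall (j : 'I_(cells om)) x, xl j < x -> x < xr j -> v x * w x = h j x) ->
  ipI v w = \sum_(j < cells om) Itg (xl j) (xr j) (h j).
Proof.
move=> nh E; have [_ _ _ sp] := ok.
rewrite /ipI -/(Itg 0 1 _) sp.
  by apply: eq_bigr => j _; apply: Itg_ext => x lx xr'; exact: E.
by move=> j; apply: nice_ext (nh j) => x lx xr'; rewrite (E j).
Qed.

Lemma pw_inV (p : nat) (d : pwpoly om) (vb : 'I_(cells om).+1 -> R) : (forall j, (size (d j) <= p.+1)%N) ->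
  inV p ((pwfun d, vb) : wpair om).
Proof.
move=> sd; split; last first.
  move=> j; exists (d j) => //= x; rewrite /cell /= in_itv /= => /andP[? ?]; exact: pwfun_cell.
split; last by move=> j; apply: (poly_H1 (q := d j)) => x lx xr'; exact: pwfun_cell.
have b01 (q : {poly R}) : exists M, forall x, 0 < x -> x < 1 -> `|q.[x]| <= M.
  by have [_ h] := poly_nice 0 1 q.
have [M hM] := choice (fun j => b01 (d j)).
apply: (@bounded_L2 _ _ (\sum_(j < cells om) `|M j|)); [exact: measurable_itv|exact: oo_fin| |].
  rewrite /= /pwfun; apply: measurable_sum => j.
  apply: measurable_funM; last by apply: measurable_indic; exact: measurable_itv.
  exact: nice_measurable (poly_nice 0 1 _).
move=> x /=; rewrite in_itv /= => /andP[x0 x1]; rewrite /pwfun.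
apply: le_trans (ler_norm_sum _ _ _) _; apply: ler_sum => j _.
rewrite normrM; apply: le_trans (_ : `|(d j).[x]| <= _).
  by rewrite ler_piMr // indicE; case: (_ \in _); rewrite ?normr1 ?normr0.
by apply: le_trans (hM j x x0 x1) (ler_norm _).
Qed.

End MeshTools.

(** Linear bookkeeping with the products made atomic. Of 3/4 of the diffusion the flux term takes
    1/4, and of the upwind term c the convection boundary terms take half. *)
Lemma energy_balance (R : realType) (e g d1 d2 d3 d4 d5 d6 j s c z zf F : R) :
  e * d1 + d2 + d3 + s + c = d4 -> - (2^-1 * c) <= j -> - F <= 4^-1 * (e * d5) + zf ->
  3 / 4 * (e * d5) + 3 / 4 * (g * d6) + j - z + F <= e * d1 + d2 + d3 - d4 ->
  2^-1 * (e * d5) + 3 / 4 * (g * d6) + s + 2^-1 * c <= z + zf.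
Proof. by move: (e * d1) (e * d5) (g * d6) => x1 x5 x6; lra. Qed.

(** The energy controls gam times the squared L2 norm; the factor 4 / gam recovers the norm
    itself. *)
Lemma norm_balance (R : realType) (g z1 z2 a a' c c' s k J Z : R) : 0 < g ->
  a <= 2 * z1 + 2 * a' -> c <= 2 * z2 + 2 * c' -> 0 <= a' -> 0 <= c' -> 0 <= s -> 0 <= k -> J <= k ->
  2^-1 * a' + 3 / 4 * (g * c') + s + 2^-1 * k <= Z ->
  a + c + s + k + J <= 2 * z1 + 2 * z2 + (4 + 4 / g) * Z.
Proof.
move=> g0 h1 h2 a0 c0 s0 k0 J0 hZ.
have gc : 0 <= g * c' by apply: mulr_ge0 => //; exact: ltW.
have cZ : 2 * c' <= 4 / g * Z.
  have -> : 2 * c' = 4 / g * (2^-1 * (g * c')) by field; rewrite gt_eqF.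
  apply: ler_wpM2l; first by apply: divr_ge0 => //; exact: ltW.
  move: (g * c') gc hZ => y y0 hZ; clear -a0 s0 k0 y0 hZ.
lra.
rewrite (mulrDl 4); move: (4 / g * Z) (g * c') cZ gc hZ => y y' cZ gc hZ; clear g0.
lra.
Qed.

(** * The error estimate on a general mesh *)

Section WGError.
Context {R : realType}.
Implicit Types x : R.
Variable om : mesh R.
Notation N := (cells om).
Notation xl j := (node (@lidx R om j)).
Notation xr j := (node (@ridx R om j)).
Hypothesis ok : mesh_ok om.

Lemma rjumpE (v : wpair om) (j : 'I_N) (h : R -> R) : (forall x, xl j < x -> x < xr j -> v.1 x = h x) ->
  {within `[xl j, xr j], continuous h} -> rjump v j = h (xr j) - v.2 (ridx j).
Proof. by move=> vh ch; rewrite /rjump (lim_left (mesh_lt ok j) vh ch). Qed.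

Lemma ljumpE (v : wpair om) (j : 'I_N) (h : R -> R) : (forall x, xl j < x -> x < xr j -> v.1 x = h x) ->
  {within `[xl j, xr j], continuous h} -> ljump v j = h (xl j) - v.2 (lidx j).
Proof. by move=> vh ch; rewrite /ljump (lim_right (mesh_lt ok j) vh ch). Qed.

Lemma penalty_ge0 e p (j : 'I_N) : 0 < e -> 0 <= penalty e p j.
Proof.
move=> e0; rewrite /penalty /hcell; apply: mulr_ge0.
  by apply: mulr_ge0; [exact: ltW|exact: exprn_ge0].
by rewrite invr_ge0 subr_ge0 ltW // mesh_lt.
Qed.

Variables (e gam : R) (b b1 r f : R -> R) (p : nat).
Variables (P S : 'I_N -> {poly R}) (w : 'I_N.+1 -> R) (eta etaS : 'I_N -> R) (Zf : R).
Hypotheses (e_gt0 : 0 < e) (gam_gt0 : 0 < gam) (p_gt0 : (0 < p)%N).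
Hypothesis sP : forall j, (size (P j) <= p.+1)%N.
Hypothesis sS : forall j, (size (S j) <= p)%N.
Hypothesis wl_P : forall j, w (lidx j) = (P j).[xl j].
Hypothesis wr_P : forall j, w (ridx j) = (P j).[xr j].
Hypothesis w0 : w ord0 = 0.
Hypothesis w1 : w ord_max = 0.
Hypothesis cb : forall j : 'I_N, {within `[xl j, xr j], continuous b}.
Hypothesis db : forall j : 'I_N, derOn (xl j) (xr j) b b1.
Hypotheses (nb : forall j : 'I_N, nice (xl j) (xr j) b) (nb1 : forall j : 'I_N, nice (xl j) (xr j) b1).
Hypotheses (nr : forall j : 'I_N, nice (xl j) (xr j) r) (nf : forall j : 'I_N, nice (xl j) (xr j) f).
Hypothesis hgam : forall (j : 'I_N) x, xl j < x -> x < xr j -> gam <= r x - 2^-1 * b1 x.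
Hypothesis b_ge0 : forall i : 'I_N.+1, 0 <= b (node i).
Hypothesis hres : forall (j : 'I_N) x, xl j < x -> x < xr j ->
  `|f x - (- e * ((P j)^`()^`()).[x] + b x * ((P j)^`()).[x] + r x * (P j).[x]) - ((S j)^`()).[x]| <= eta j.
Hypothesis hS : forall (j : 'I_N) x, xl j < x -> x < xr j -> `|(S j).[x]| <= etaS j.
Let flux j (y : R) := e * ((P j)^`()).[y] - (S j).[y].
(** The flux jumps of P at interior nodes are left abstract. There is none on one cell; on two cells
    the nodal value is an integral of De, whence the link imposed between [eb] and [De]. *)
Hypothesis hflux : forall (De : 'I_N -> {poly R}) (eb : 'I_N.+1 -> R),
  eb ord0 = 0 -> eb ord_max = 0 ->
  (forall j, Itg (xl j) (xr j) (fun x => (De j).[x]) = eb (ridx j) - eb (lidx j)) ->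
  - (\sum_(j < N) (eb (ridx j) * flux j (xr j) - eb (lidx j) * flux j (xl j))) <=
  4^-1 * \sum_(j < N) e * Itg (xl j) (xr j) (fun x => (De j).[x] * (De j).[x]) + Zf.
Let Zr := \sum_(j < N) (eta j ^+ 2 / gam + etaS j ^+ 2 / e) * (xr j - xl j).

Variable up : wpair om.
Hypothesis hup : wg_solution e b r f p up.

(** The discrete equation is tested with (E, e_b), the difference of u_p and P, and [cell_lower] is
    summed. As e_b vanishes at both ends the terms b e_b^2 telescope to 0, so the convection
    boundary terms are at least -Sc/2. *)
Lemma discrete_error : exists (Q De : 'I_N -> {poly R}) (eb : 'I_N.+1 -> R),
  let E j := Q j - P j in
  let St := \sum_(j < N) penalty e p j * (((E j).[xr j] - eb (ridx j)) ^+ 2 + ((E j).[xl j] - eb (lidx j)) ^+ 2) in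
  let Sc := \sum_(j < N) b (xr j) * ((E j).[xr j] - eb (ridx j)) ^+ 2 in
  [/\ forall j, (size (Q j) <= p.+1)%N /\ (size (De j) <= p)%N,
      (forall j x, xl j < x -> x < xr j -> up.1 x = (Q j).[x]) /\ (forall i, up.2 i = w i + eb i),
      forall j (q : {poly R}), (size q <= p)%N -> Itg (xl j) (xr j) (fun x => (De j).[x] * q.[x]) =
        weak_pairing (xl j) (xr j) (horner (E j)) (eb (lidx j)) (eb (ridx j)) (horner q) (horner q^`()) &
      2^-1 * (\sum_(j < N) e * Itg (xl j) (xr j) (fun x => (De j).[x] * (De j).[x])) +
      3 / 4 * (\sum_(j < N) gam * Itg (xl j) (xr j) (fun x => (E j).[x] * (E j).[x])) + St + 2^-1 * Sc <= Zr + Zf].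
Proof.
have [[[_ hq] up0 up1] hsol] := hup.
have {}hq (j : 'I_N) : exists q : {poly R}, (size q <= p.+1)%N /\ forall x, xl j < x -> x < xr j -> up.1 x = q.[x].
  have [q sq qE] := hq j; exists q; split=> // x lx rx; apply: qE.
  by rewrite /cell /= in_itv /= lx.
have [Q hQ] := choice hq.
pose E j := Q j - P j.
pose eb i := up.2 i - w i.
have sE j : (size (E j) <= p.+1)%N.
  by apply: leq_trans (size_polyD _ _) _; rewrite size_polyN geq_max (proj1 (hQ j)) sP.
pose v : wpair om := (pwfun [ffun j => E j], eb).
have v1 (j : 'I_N) x : xl j < x -> x < xr j -> v.1 x = (E j).[x].
  by move=> lx rx; rewrite /v /= (pwfun_cell ok _ lx rx) ffunE.
have u1E (j : 'I_N) x : xl j < x -> x < xr j -> up.1 x = (P j).[x] + (E j).[x].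
  by move=> lx rx; rewrite (proj2 (hQ j) _ lx rx) /E hornerD hornerN; ring.
have vV : inV0 p v.
  split; [by apply: (pw_inV ok) => j; rewrite ffunE|by rewrite /= /eb up0 w0 subr0|].
  by rewrite /= /eb up1 w1 subr0.
have nv (j : 'I_N) : nice (xl j) (xr j) v.1.
  by apply: nice_ext (poly_nice _ _ (E j)) => x lx rx; rewrite (v1 j x lx rx).
have nu (j : 'I_N) : nice (xl j) (xr j) up.1.
  by apply: nice_ext (poly_nice _ _ (Q j)) => x lx rx; rewrite (proj2 (hQ j) x lx rx).
have [De [wDe hDe]] := weakD_ex ok p.-1 nv.
have [Dup [wDup hDup]] := weakD_ex ok p.-1 nu.
have [Dc [wDc hDc]] := weakDc_ex ok p nu nb nb1 db.
have pp : p.-1.+1 = p by rewrite prednK.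
rewrite pp in hDe hDup.
have u2l (j : 'I_N) : up.2 (lidx j) = (P j).[xl j] + eb (lidx j) by rewrite -wl_P /eb addrC subrK.
have u2r (j : 'I_N) : up.2 (ridx j) = (P j).[xr j] + eb (ridx j) by rewrite -wr_P /eb addrC subrK.
have specE (j : 'I_N) (q : {poly R}) : (size q <= p)%N -> Itg (xl j) (xr j) (fun x => (De j).[x] * q.[x]) =
        weak_pairing (xl j) (xr j) (horner (E j)) (eb (lidx j)) (eb (ridx j)) (horner q) (horner q^`()).
  move=> sq; rewrite (proj2 (hDe j) q sq); apply: weak_pairing_ext => x lx rx; split=> //; exact: v1.
exists Q, De, eb => E' St Sc; rewrite -/E in E' St Sc *.
split.
- by move=> j; split; [exact: (proj1 (hQ j))|exact: (proj1 (hDe j))].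
- split=> [j x lx rx|i]; first exact: (proj2 (hQ j)).
  by rewrite /eb addrC subrK.
- exact: specE.
have cP (q : {poly R}) s t : {within `[s, t], continuous (horner q)} by exact: poly_within.
have jvr (j : 'I_N) : rjump v j = (E j).[xr j] - eb (ridx j) by exact: rjumpE (v1 j) (cP _ _ _).
have jvl (j : 'I_N) : ljump v j = (E j).[xl j] - eb (lidx j) by exact: ljumpE (v1 j) (cP _ _ _).
have jur (j : 'I_N) : rjump up j = (E j).[xr j] - eb (ridx j).
  by rewrite (rjumpE (proj2 (hQ j)) (cP _ _ _)) u2r /E hornerD hornerN; ring.
have jul (j : 'I_N) : ljump up j = (E j).[xl j] - eb (lidx j).
  by rewrite (ljumpE (proj2 (hQ j)) (cP _ _ _)) u2l /E hornerD hornerN; ring.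
have stE : stab e p up v = St.
  by apply: eq_bigr => j _; rewrite jvr jvl jur jul -!expr2.
have scE : stabc b up v = Sc.
  by apply: eq_bigr => j _; rewrite jvr jur -!expr2.
have := hsol v vV; rewrite /bilin stE scE.
rewrite (ipI_cells ok (h := fun j x => (Dup j).[x] * (De j).[x])); first last.
- by move=> j x lx rx; rewrite wDup wDe !(pwfun_cell ok _ lx rx).
- by move=> j; apply: niceM; exact: poly_nice.
rewrite (ipI_cells ok (h := fun j x => (Dc j).[x] * (E j).[x])); first last.
- by move=> j x lx rx; rewrite wDc (pwfun_cell ok _ lx rx) (v1 j x lx rx).
- by move=> j; apply: niceM; exact: poly_nice.
rewrite (ipI_cells ok (h := fun j x => r x * ((P j).[x] + (E j).[x]) * (E j).[x])); first last.
- by move=> j x lx rx; rewrite (v1 j x lx rx) (u1E j x lx rx).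
- move=> j; apply: niceM; last exact: poly_nice.
  by apply: niceM => //; apply: niceD; exact: poly_nice.
rewrite (ipI_cells ok (h := fun j x => f x * (E j).[x])); first last.
- by move=> j x lx rx; rewrite (v1 j x lx rx).
- by move=> j; apply: niceM => //; exact: poly_nice.
move=> hsum.
pose J j := - (2^-1 * (b (xr j) * ((E j).[xr j] - eb (ridx j)) ^+ 2)) + 2^-1 * (b (xl j) * ((E j).[xl j] - eb (lidx j)) ^+ 2)
  + 2^-1 * (b (xr j) * eb (ridx j) ^+ 2 - b (xl j) * eb (lidx j) ^+ 2).
have low : \sum_(j < N) (3 / 4 * (e * Itg (xl j) (xr j) (fun x => (De j).[x] * (De j).[x]))
   + 3 / 4 * (gam * Itg (xl j) (xr j) (fun x => (E j).[x] * (E j).[x])) + J j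
   - (eta j ^+ 2 / gam + etaS j ^+ 2 / e) * (xr j - xl j)
   + (eb (ridx j) * flux j (xr j) - eb (lidx j) * flux j (xl j))) <=
   \sum_(j < N) (e * Itg (xl j) (xr j) (fun x => (Dup j).[x] * (De j).[x])
    + Itg (xl j) (xr j) (fun x => (Dc j).[x] * (E j).[x])
    + Itg (xl j) (xr j) (fun x => r x * ((P j).[x] + (E j).[x]) * (E j).[x])
    - Itg (xl j) (xr j) (fun x => f x * (E j).[x])).
  apply: ler_sum => j _.
  apply: (@cell_lower R (xl j) (xr j) e gam (eta j) (etaS j) b b1 r f p (P j) (E j) (De j) (Dup j) (Dc j) (S j)).
  - exact: mesh_lt. - by []. - by []. - exact: sP. - exact: sE. - exact: (proj1 (hDe j)). - exact: sS.
  - exact: cb. - exact: db. - exact: nb. - exact: nb1. - exact: nr. - exact: nf. - exact: hgam.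
  - exact: specE.
  - move=> q sq; rewrite (proj2 (hDup j) q sq) u2l u2r.
    by apply: weak_pairing_ext => x lx rx; split=> //; exact: u1E.
  - move=> q sq; rewrite (proj2 (hDc j) q sq) u2l u2r.
    by apply: weak_pairing_ext => x lx rx; split=> //; exact: u1E.
  - exact: hres. - exact: hS.
have fl : - (\sum_(j < N) (eb (ridx j) * flux j (xr j) - eb (lidx j) * flux j (xl j))) <=
  4^-1 * \sum_(j < N) e * Itg (xl j) (xr j) (fun x => (De j).[x] * (De j).[x]) + Zf.
  apply: hflux.
  - by rewrite /eb up0 w0 subr0. - by rewrite /eb up1 w1 subr0.
  (* The weak derivative is tested with the constant 1. *)
  - move=> j; have one y : (1 : {poly R}).[y] = 1 by rewrite hornerE.
    have := specE j 1; rewrite size_poly1 => /(_ p_gt0); rewrite /weak_pairing !one !mulr1.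
    rewrite (Itg_ext (g := fun=> 0) (f := fun x => (E j).[x] * _)) ?Itg_cst ?mul0r.
    + rewrite oppr0 add0r => <-; apply: Itg_ext => x _ _; by rewrite one mulr1.
    + exact/ltW/(mesh_lt ok).
    + by move=> x _ _; rewrite derivC horner0 mulr0.
have Jlow : - (2^-1 * Sc) <= \sum_(j < N) J j.
  rewrite /J !big_split /= sumrN -!mulr_sumr -/Sc.
  have -> : \sum_(j < N) (b (xr j) * eb (ridx j) ^+ 2 - b (xl j) * eb (lidx j) ^+ 2) = 0.
    rewrite (mesh_tele (fun i => b (node i) * eb i ^+ 2)).
    by rewrite /eb up0 up1 w0 w1 subr0 expr0n /= !mulr0 subr0.
  rewrite mulr0 addr0 lerDl; apply: mulr_ge0; first by rewrite invr_ge0.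
  by apply: sumr_ge0 => j _; apply: mulr_ge0; [exact: b_ge0|exact: sqr_ge0].
move: fl low; set FL := \sum_(j < N) (eb (ridx j) * _ - _).
clearbody J.
rewrite sumrB big_split /= -/FL !big_split /= sumrN -/Zr -!mulr_sumr.
move: hsum Jlow; set j1 := \sum_(j < N) J j.
set d1 := \sum_(j < N) Itg _ _ _; set d2 := \sum_(j < N) Itg _ _ _; set d3 := \sum_(j < N) Itg _ _ _.
set d4 := \sum_(j < N) Itg _ _ _; set d5 := \sum_(j < N) Itg _ _ _; set d6 := \sum_(j < N) Itg _ _ _.
move=> H1 H2 H3 H4.
exact: (energy_balance H1 H2 H3 H4).
Qed.

Variables u u1 : R -> R.
Hypothesis cu : forall j : 'I_N, {within `[xl j, xr j], continuous u}.
Hypothesis du : forall j : 'I_N, derOn (xl j) (xr j) u u1.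
Hypotheses (nuu : forall j : 'I_N, nice (xl j) (xr j) u) (nu1 : forall j : 'I_N, nice (xl j) (xr j) u1).
Let z1 := \sum_(j < N) e * Itg (xl j) (xr j) (fun x => (u1 x - ((P j)^`()).[x]) ^+ 2).
Let z2 := \sum_(j < N) Itg (xl j) (xr j) (fun x => (u x - (P j).[x]) ^+ 2).

(** The triangle inequality for u - u_p = (u - P) - E, with E bounded by [discrete_error]. *)
Lemma wg_error : wgnorm e b p (subw (embed om u) up) <=
  Num.sqrt (2 * z1 + 2 * z2 + (4 + 4 / gam) * (Zr + Zf)).
Proof.
have [Q [De [eb H]]] := discrete_error.
pose E j := Q j - P j.
pose St := \sum_(j < N) penalty e p j * (((E j).[xr j] - eb (ridx j)) ^+ 2 + ((E j).[xl j] - eb (lidx j)) ^+ 2).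
pose Sc := \sum_(j < N) b (xr j) * ((E j).[xr j] - eb (ridx j)) ^+ 2.
have [sz [uQ u2] spec hX0] := H.
have {hX0 H} hX : 2^-1 * (\sum_(j < N) e * Itg (xl j) (xr j) (fun x => (De j).[x] * (De j).[x])) +
  3 / 4 * (\sum_(j < N) gam * Itg (xl j) (xr j) (fun x => (E j).[x] * (E j).[x])) + St + 2^-1 * Sc <= Zr + Zf := hX0.
set v := subw _ up.
have vE (j : 'I_N) x : xl j < x -> x < xr j -> v.1 x = (u x - (P j).[x]) - (E j).[x].
  by move=> lx rx; rewrite /v /= (uQ j x lx rx) /E hornerD hornerN; ring.
have nP (j : 'I_N) (q : {poly R}) : nice (xl j) (xr j) (horner q) by exact: poly_nice.
have nuP j : nice (xl j) (xr j) (fun x => u x - (P j).[x]) by exact: niceB (nuu j) (nP j _).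
have nu1P j : nice (xl j) (xr j) (fun x => u1 x - ((P j)^`()).[x]) by exact: niceB (nu1 j) (nP j _).
have nv (j : 'I_N) : nice (xl j) (xr j) v.1.
  apply: nice_ext (niceB (nuP j) (nP j (E j))) => x lx rx; by rewrite (vE j x lx rx).
have v2l (j : 'I_N) : v.2 (lidx j) = (u (xl j) - (P j).[xl j]) - eb (lidx j).
  by rewrite /v /= u2 wl_P; ring.
have v2r (j : 'I_N) : v.2 (ridx j) = (u (xr j) - (P j).[xr j]) - eb (ridx j).
  by rewrite /v /= u2 wr_P; ring.
have cP (q : {poly R}) s t : {within `[s, t], continuous (horner q)} by exact: poly_within.
have cw (j : 'I_N) : {within `[xl j, xr j], continuous (fun x => u x - (P j).[x] - (E j).[x])}.
  by apply: within_continuousB => //; apply: within_continuousB.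
(* u - P is continuous on each closed cell and agrees with its nodal values there, so only the jumps
   of E survive. *)
have jr (j : 'I_N) : rjump v j = - ((E j).[xr j] - eb (ridx j)).
  by rewrite (rjumpE (vE j) (cw j)) v2r; ring.
have jl (j : 'I_N) : ljump v j = - ((E j).[xl j] - eb (lidx j)).
  by rewrite (ljumpE (vE j) (cw j)) v2l; ring.
have stE : stab e p v v = St.
  by apply: eq_bigr => j _; rewrite jr jl !mulrNN -!expr2.
have scE : stabc b v v = Sc.
  by apply: eq_bigr => j _; rewrite jr !mulrNN -!expr2.
have jE : jumpsq b v <= Sc.
  apply: ler_sum => j _; rewrite jr sqrrN -mulrA; set y := _ ^+ 2.
  have by0 : 0 <= b (xr j) * y by apply: mulr_ge0; [exact: b_ge0|exact: sqr_ge0].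
  by case: ifP => _; move: by0; move: (b (xr j) * y) => k; lra.
have [D [wD hD]] := weakD_ex ok p.-1 nv.
rewrite prednK // in hD.
have DE (j : 'I_N) : Itg (xl j) (xr j) (fun x => (D j).[x] * (D j).[x]) <=
    2 * Itg (xl j) (xr j) (fun x => (u1 x - ((P j)^`()).[x]) ^+ 2) +
    2 * Itg (xl j) (xr j) (fun x => (De j).[x] * (De j).[x]).
  (* D is tested with itself: the integral of D^2 equals that of (u' - P') D - De D, and 2 (k1 - k2)
     k3 <= 2 k1^2 + 2 k2^2 + k3^2 concludes. *)
  have [sD sD2] := hD j; have := sD2 _ sD; rewrite v2l v2r.
  rewrite (@weak_pairing_ext _ _ _ _ (fun x => (u x - (P j).[x]) + (- E j).[x]) _ _ _ _ (horner (D j)^`())); last first.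
    by move=> x lx rx; rewrite (vE j x lx rx) hornerN.
  rewrite (weak_pairing_add (v := fun x => u x - (P j).[x]) (w := horner (- E j))) //.
  rewrite (@weak_pairing_parts _ _ _ (fun x => u x - (P j).[x]) (fun x => u1 x - ((P j)^`()).[x])) //; first last.
  - by move=> x lx rx; exact: dhorner.
  - by move=> x lx rx; exact: dB (du lx rx) (dhorner _ _).
  - by apply: within_continuousB.
  - exact: mesh_lt.
  have -> : weak_pairing (xl j) (xr j) (horner (- E j)) (- eb (lidx j)) (- eb (ridx j)) (horner (D j)) (horner (D j)^`()) =
     - Itg (xl j) (xr j) (fun x => (De j).[x] * (D j).[x]).
    rewrite spec // /weak_pairing (Itg_ext (g := fun x => (-1) * ((E j).[x] * ((D j)^`()).[x]))).
      by rewrite ItgZ; [ring|exact: niceM].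
    by move=> x _ _; rewrite hornerN; ring.
  move=> DD.
  have n1 : nice (xl j) (xr j) (fun x => (u1 x - ((P j)^`()).[x]) * (D j).[x]) by exact: niceM.
  have n2 : nice (xl j) (xr j) (fun x => (De j).[x] * (D j).[x]) by exact: niceM.
  have n3 : nice (xl j) (xr j) (fun x => (u1 x - ((P j)^`()).[x]) ^+ 2) by exact: niceM.
  have n4 : nice (xl j) (xr j) (fun x => (De j).[x] * (De j).[x]) by exact: niceM.
  have n5 : nice (xl j) (xr j) (fun x => (D j).[x] * (D j).[x]) by exact: niceM.
  have n6 := niceB n1 n2.
  have n7 : nice (xl j) (xr j) (fun x => 2 * (u1 x - ((P j)^`()).[x]) ^+ 2 + 2 * ((De j).[x] * (De j).[x])).
    by apply: niceD; [exact: niceM (niceC _ _ _) n3|exact: niceM (niceC _ _ _) n4].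
  have n8 : nice (xl j) (xr j) (fun x => 2 * ((u1 x - ((P j)^`()).[x]) * (D j).[x] - (De j).[x] * (D j).[x])).
    exact: niceM (niceC _ _ _) n6.
  have le : Itg (xl j) (xr j) (fun x => 2 * ((u1 x - ((P j)^`()).[x]) * (D j).[x] - (De j).[x] * (D j).[x])) <=
    Itg (xl j) (xr j) (fun x => (2 * (u1 x - ((P j)^`()).[x]) ^+ 2 + 2 * ((De j).[x] * (De j).[x])) + (D j).[x] * (D j).[x]).
    apply: Itg_le => //; first exact: niceD.
    move=> x _ _; move: (u1 x - _) (De j).[x] (D j).[x] => k1 k2 k3.
    have := sqr_ge0 (k1 - k2 - k3); have := sqr_ge0 (k1 + k2); nra.
  move: le; rewrite ItgZ // ItgB // ItgD // ItgD; [|exact: niceM (niceC _ _ _) n3|exact: niceM (niceC _ _ _) n4].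
  rewrite ItgZ // ItgZ // -DD; move: (Itg _ _ _) (Itg _ _ _) (Itg _ _ _) => k1 k2 k3; lra.
have VE (j : 'I_N) : Itg (xl j) (xr j) (fun x => v.1 x * v.1 x) <=
    2 * Itg (xl j) (xr j) (fun x => (u x - (P j).[x]) ^+ 2) +
    2 * Itg (xl j) (xr j) (fun x => (E j).[x] * (E j).[x]).
  have n1 : nice (xl j) (xr j) (fun x => (u x - (P j).[x]) ^+ 2) by exact: niceM.
  have n2 : nice (xl j) (xr j) (fun x => (E j).[x] * (E j).[x]) by exact: niceM.
  have n3 := niceM (niceC (xl j) (xr j) 2) n1; have n4 := niceM (niceC (xl j) (xr j) 2) n2.
  rewrite -ItgZ // -ItgZ // -ItgD //; apply: Itg_le; [exact: niceM|exact: niceD|].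
  move=> x lx rx; rewrite (vE j x lx rx); move: (u x - _) (E j).[x] => k1 k2.
  have := sqr_ge0 (k1 + k2); nra.
have E0 (j : 'I_N) : 0 <= Itg (xl j) (xr j) (fun x => (E j).[x] * (E j).[x]).
  by apply: Itg_ge0 => x _ _; rewrite -expr2 sqr_ge0.
rewrite /wgnorm -/v; apply: ler_wsqrtr; rewrite stE scE.
rewrite (ipI_cells ok (h := fun j x => (D j).[x] * (D j).[x])); first last.
- by move=> j x lx rx; rewrite wD !(pwfun_cell ok _ lx rx).
- by move=> j; exact: niceM.
rewrite (ipI_cells ok (h := fun j x => v.1 x * v.1 x)) //; last by move=> j; exact: niceM.
have s1 : e * \sum_(j < N) Itg (xl j) (xr j) (fun x => (D j).[x] * (D j).[x]) <=
   2 * z1 + 2 * \sum_(j < N) e * Itg (xl j) (xr j) (fun x => (De j).[x] * (De j).[x]).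
  rewrite !mulr_sumr -big_split /=; apply: ler_sum => j _.
  have := ler_wpM2l (ltW e_gt0) (DE j); move: (Itg _ _ _) (Itg _ _ _) (Itg _ _ _) => k1 k2 k3.
  by rewrite mulrDr !(mulrCA e 2).
have s2 : \sum_(j < N) Itg (xl j) (xr j) (fun x => v.1 x * v.1 x) <=
   2 * z2 + 2 * \sum_(j < N) Itg (xl j) (xr j) (fun x => (E j).[x] * (E j).[x]).
  by rewrite !mulr_sumr -big_split /=; apply: ler_sum => j _; exact: VE.
have d0 : 0 <= \sum_(j < N) e * Itg (xl j) (xr j) (fun x => (De j).[x] * (De j).[x]).
  apply: sumr_ge0 => j _; apply: mulr_ge0; first exact: ltW.
  by apply: Itg_ge0 => x _ _; rewrite -expr2 sqr_ge0.
have e0 : 0 <= \sum_(j < N) Itg (xl j) (xr j) (fun x => (E j).[x] * (E j).[x]).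
  by apply: sumr_ge0 => j _; exact: E0.
have St0 : 0 <= St.
  apply: sumr_ge0 => j _; apply: mulr_ge0; first exact: penalty_ge0.
  by apply: addr_ge0; exact: sqr_ge0.
have Sc0 : 0 <= Sc.
  by apply: sumr_ge0 => j _; apply: mulr_ge0; [exact: b_ge0|exact: sqr_ge0].
rewrite -[X in 3 / 4 * X]mulr_sumr in hX.
exact: norm_balance gam_gt0 s1 s2 d0 e0 St0 Sc0 jE hX.
Qed.

End WGError.

Lemma Itg_sqr_le (R : realType) (a c M : R) (k : R -> R) : a <= c -> nice a c k ->
  (forall x, a < x -> x < c -> `|k x| <= M) -> Itg a c (fun x => k x ^+ 2) <= M ^+ 2 * (c - a).
Proof.
move=> ac nk hM; rewrite -Itg_cst //; apply: Itg_le; [exact: (niceM nk nk)|exact: niceC|].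
move=> x ax xc; rewrite -(real_normK (num_real (k x))).
by rewrite lerXn2r ?nnegrE // ?hM // (le_trans _ (hM x ax xc)).
Qed.

(** * The one-cell and two-cell meshes *)

Section Meshes.
Context {R : realType}.
Implicit Types x : R.

(** [mesh1] and [mesh2] are the two branches of [SBLmesh], so estimates for them apply to it
    directly. *)
Definition mesh1 : mesh R := @Mesh R 1 (tnth [tuple 0; 1]).
Definition mesh2 (a : R) : mesh R := @Mesh R 2 (tnth [tuple 0; a; 1]).

Lemma mesh1E (j : 'I_1) : node (@lidx R mesh1 j) = 0 /\ node (@ridx R mesh1 j) = 1.
Proof. by rewrite (ord1 j) /=; split; rewrite (tnth_nth 0). Qed.

Lemma mesh1_ok : mesh_ok mesh1.
Proof.
split.
- split=> [||j]; [by rewrite /= (tnth_nth 0)|by rewrite /= (tnth_nth 0)|].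
  by have [-> ->] := mesh1E j.
- by move=> j; have [-> ->] := mesh1E j.
- by move=> i j x _ _; rewrite (ord1 i) (ord1 j).
- by move=> k _; rewrite big_ord1; have [-> ->] := mesh1E ord0.
Qed.

Definition cellL : 'I_2 := ord0.
Definition cellR : 'I_2 := ord_max.

Lemma mesh2_ind (T : 'I_2 -> Prop) : T cellL -> T cellR -> forall j, T j.
Proof.
move=> t0 t1 [[|[|//]] lt].
  by rewrite (_ : Ordinal lt = cellL) //; exact: val_inj.
by rewrite (_ : Ordinal lt = cellR) //; exact: val_inj.
Qed.

Lemma mesh2_sum (F : 'I_2 -> R) : \sum_(j < 2) F j = F cellL + F cellR.
Proof.
rewrite big_ord_recl big_ord1 /cellL /cellR; congr (_ + F _); exact: val_inj.
Qed.

Lemma mesh2_0l (a : R) : node (@lidx R (mesh2 a) cellL) = 0. Proof. by rewrite /= (tnth_nth 0). Qed.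
Lemma mesh2_0r (a : R) : node (@ridx R (mesh2 a) cellL) = a. Proof. by rewrite /= (tnth_nth 0). Qed.
Lemma mesh2_1l (a : R) : node (@lidx R (mesh2 a) cellR) = a. Proof. by rewrite /= (tnth_nth 0). Qed.
Lemma mesh2_1r (a : R) : node (@ridx R (mesh2 a) cellR) = 1. Proof. by rewrite /= (tnth_nth 0). Qed.

Lemma mesh2_ok (a : R) : 0 < a -> a < 1 -> mesh_ok (mesh2 a).
Proof.
move=> a0 a1; split.
- split=> [||]; [by rewrite /= (tnth_nth 0)|by rewrite /= (tnth_nth 0)|].
  by apply: mesh2_ind; rewrite ?mesh2_0l ?mesh2_0r ?mesh2_1l ?mesh2_1r.
- by apply: mesh2_ind; rewrite ?mesh2_0l ?mesh2_0r ?mesh2_1l ?mesh2_1r; split=> //; exact: ltW.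
- apply: mesh2_ind; apply: mesh2_ind => // x; rewrite /cell /= ?mesh2_0l ?mesh2_0r ?mesh2_1l ?mesh2_1r !in_itv /= => /andP[? ?] /andP[? ?]; exfalso; lra.
- move=> k; rewrite mesh2_sum => nk; have n0 := nk cellL; have n1 := nk cellR.
  rewrite ?mesh2_0l ?mesh2_0r ?mesh2_1l ?mesh2_1r in n0 n1 *.
  exact: Itg_split.
Qed.

End Meshes.

(** * Error bounds on the two meshes *)

Section Estimate.
Context {R : realType}.
Implicit Types x : R.
Variables (b r f : R -> R) (C0 g b0 gam : R).
Hypotheses (C0_gt0 : 0 < C0) (g_ge0 : 0 <= g) (b0_gt0 : 0 < b0) (gam_gt0 : 0 < gam).
Hypotheses (jB : jet01 (jetof b)) (jQ : jet01 (jetof r)) (jF : jet01 (jetof f)).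
Hypotheses (gB : geom_bound C0 g (jetof b)) (gQ : geom_bound C0 g (jetof r)) (gF : geom_bound C0 g (jetof f)).
Hypothesis cb : {within `[0, 1], continuous b}.
Hypothesis hb : forall x, 0 < x -> x < 1 -> b0 <= b x.
Hypothesis b_gt0 : forall x, 0 <= x -> x <= 1 -> 0 < b x.
Hypothesis r_ge0 : forall x, 0 < x -> x < 1 -> 0 <= r x.
Hypothesis hgam : forall x, 0 < x -> x < 1 -> gam <= r x - 2^-1 * jetof b 1 x.
Let Cb := C0 * (1 + g).

(** Only integrability is meant: the bounds on u' and u'' may depend on [e]; the one on u'' is read
    off the equation. *)
Lemma sol_nice (e : R) (u : R -> R) : 0 < e -> e <= 1 -> bvp_solution e b r f u ->
  [/\ nice 0 1 u, nice 0 1 (jetof u 1) & nice 0 1 (jetof u 2)].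
Proof.
move=> e0 e1 hu; have [A A1 hA] := sol_bound C0_gt0 g_ge0 b0_gt0 jB jQ jF gB gQ gF hb r_ge0.
have [jU eU] := sol_jet jB jQ jF e0 hu.
have nu : nice 0 1 u.
  split=> [x x0 x1|]; first exact: d_cont (jU 0%N x x0 x1).
  by exists A => x x0 x1; case: (hA e u e0 e1 hu x x0 x1).
have nu1 : nice 0 1 (jetof u 1).
  split=> [x x0 x1|]; first exact: d_cont (jU 1%N x x0 x1).
  exists (A / e) => x x0 x1; rewrite ler_pdivlMr // mulrC.
  by case: (hA e u e0 e1 hu x x0 x1).
split=> //.
have nb : nice 0 1 b := geom_nice 0 jB gB.
have nr : nice 0 1 r := geom_nice 0 jQ gQ.
have nf : nice 0 1 f := geom_nice 0 jF gF.
apply: nice_ext (niceM (niceC 0 1 e^-1) (niceB (niceD (niceM nb nu1) (niceM nr nu)) nf)) => x x0 x1.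
have := eU 0%N x x0 x1; rewrite !leib0 => E.
have -> : b x * jetof u 1 x + r x * u x - f x = e * jetof u 2 x by rewrite E.
by rewrite mulrA mulVf ?mul1r // gt_eqF.
Qed.

Let Kp (kap : R) := 4 * kap + 8 + 8 * Cb + (4 + 4 / gam) * (gam^-1 + 20 * kap).

Lemma Cb_ge0 : 0 <= Cb.
Proof. by have gp := g_ge0; have C0p := C0_gt0; apply: mulr_ge0; lra. Qed.

(** The coefficients of kap q come from dividing by [e] on a cell of width at most 2 kap q e; 3 + 4
    Cb is the cost of [energy_bound], and 18 kap q is 2 kap q times the square of the flux jump 3
    eta. Constants are absorbed by q >= 1. *)
Lemma error_budget (kap q eta z1 z2 zr zf : R) : 1 <= q -> 0 <= kap ->
  z1 <= (2 * kap * q + 3 + 4 * Cb) * eta ^+ 2 -> z2 <= eta ^+ 2 ->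
  zr <= (gam^-1 + 2 * kap * q) * eta ^+ 2 -> zf <= 18 * kap * q * eta ^+ 2 ->
  2 * z1 + 2 * z2 + (4 + 4 / gam) * (zr + zf) <= Kp kap * q * eta ^+ 2.
Proof.
move=> q1 k0 h1 h2 hr hf; have C0p := C0_gt0; have gp := g_ge0.
have y0 : 0 <= eta ^+ 2 by exact: sqr_ge0.
have Cb0 := Cb_ge0.
have gi : 0 <= gam^-1 by rewrite invr_ge0 ltW.
have G0 : 0 <= 4 + 4 / gam by lra.
have h3 : zr + zf <= q * (gam^-1 + 20 * kap) * eta ^+ 2.
  apply: le_trans (lerD hr hf) _; rewrite -mulrDl; apply: ler_wpM2r => //.
  have : gam^-1 <= q * gam^-1 by rewrite ler_peMl.
  lra.
have h4 : z1 + z2 <= q * (2 * kap + 4 + 4 * Cb) * eta ^+ 2.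
  apply: le_trans (lerD h1 h2) _; rewrite -[X in _ + X]mul1r -mulrDl; apply: ler_wpM2r => //.
  have : Cb <= q * Cb by rewrite ler_peMl.
  lra.
have -> : Kp kap * q * eta ^+ 2 = 2 * (q * (2 * kap + 4 + 4 * Cb) * eta ^+ 2)
   + (4 + 4 / gam) * (q * (gam^-1 + 20 * kap) * eta ^+ 2) by rewrite /Kp; ring.
rewrite -mulrDr; apply: lerD; first by apply: ler_wpM2l.
exact: ler_wpM2l.
Qed.

(** Without interior node the flux terms vanish, and 1/e <= 2 kap p pays for each division by
    [e]. *)
Lemma wg_error_mesh1 (e eta kap : R) (p : nat) (u : R -> R) (up : wpair (@mesh1 R)) (PR S : {poly R}) :
  0 < e -> e <= 1 -> (0 < p)%N -> 0 <= eta -> 0 <= kap -> 1 <= 2 * kap * p%:R * e ->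
  bvp_solution e b r f u -> wg_solution e b r f p up ->
  (size PR <= p.+1)%N -> (size S <= p)%N -> PR.[1] = 0 -> PR.[0] = 0 ->
  (forall x, 0 < x -> x < 1 ->
      [/\ `|u x - PR.[x]| <= eta, e * `|jetof u 1 x - (PR^`()).[x]| <= eta, `|S.[x]| <= eta &
      `|f x - (- e * (PR^`()^`()).[x] + b x * (PR^`()).[x] + r x * PR.[x]) - (S^`()).[x]| <= eta]) ->
  wgnorm e b p (subw (embed mesh1 u) up) <= Num.sqrt (Kp kap * p%:R * eta ^+ 2).
Proof.
move=> e0 e1 p0 eta0 k0 hk hu hup sP sS PR1 PR0 hR.
have gp := gam_gt0.
have [nu nu1 _] := sol_nice e0 e1 hu; have [jU _] := sol_jet jB jQ jF e0 hu; have [cu _ _ _] := hu.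
have nb : nice 0 1 b := geom_nice 0 jB gB.
have nb1 : nice 0 1 (jetof b 1) := geom_nice 1 jB gB.
have nr : nice 0 1 r := geom_nice 0 jQ gQ.
have nf : nice 0 1 f := geom_nice 0 jF gF.
have [N1 N2] := @mesh1E R ord0.
have W := @wg_error R mesh1 mesh1_ok e gam b (jetof b 1) r f p (fun=> PR) (fun=> S) (fun=> 0)
  (fun=> eta) (fun=> eta) 0 e0 gp p0.
apply: le_trans (W _ _ _ _ _ _ _ _ _ _ _ _ _ _ _ _ _ up hup u (jetof u 1) _ _ _ _) _ => //;
  try by move=> j; have [E1 E2] := mesh1E j; rewrite ?E1 ?E2.
- move=> j; have [-> ->] := mesh1E j; exact: (jB 0%N).
- move=> i; apply: ltW; apply: b_gt0; rewrite /= (tnth_nth 0); case: i => -[|[|//]] //= _; exact: ler01.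
- by move=> j x; have [-> ->] := mesh1E j => x0 x1; case: (hR x x0 x1).
- by move=> j x; have [-> ->] := mesh1E j => x0 x1; case: (hR x x0 x1).
- move=> De eb b0' b1' _; rewrite !big_ord1.
  have r1 : ridx (ord0 : 'I_(cells (@mesh1 R))) = ord_max by exact: val_inj.
  have l0 : lidx (ord0 : 'I_(cells (@mesh1 R))) = ord0 by exact: val_inj.
  rewrite r1 l0 b0' b1' !mul0r subrr oppr0 addr0; apply: mulr_ge0; first by rewrite invr_ge0.
  apply: mulr_ge0; first exact: ltW.
  by apply: Itg_ge0 => x _ _; rewrite -expr2 sqr_ge0.
- move=> j; have [-> ->] := mesh1E j; exact: (jU 0%N).
apply: ler_wsqrtr; rewrite !big_ord1.
rewrite N1 N2 subr0 mulr1.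
have he : e * (eta / e) ^+ 2 <= 2 * kap * p%:R * eta ^+ 2.
  rewrite (_ : _ * _ = e^-1 * eta ^+ 2); last by field; rewrite gt_eqF.
  by apply: ler_wpM2r; [exact: sqr_ge0|rewrite -ler_pdivrMr // in hk; rewrite -div1r].
have h2 : 2 * kap * p%:R * eta ^+ 2 <= (2 * kap * p%:R + 3 + 4 * Cb) * eta ^+ 2.
  apply: ler_wpM2r; first exact: sqr_ge0.
  rewrite -addrA lerDl; apply: addr_ge0 => //; apply: mulr_ge0 => //; exact: Cb_ge0.
apply: error_budget => //.
- by rewrite ler1n.
- have := Itg_sqr_le (M := eta / e) ler01 (niceB nu1 (poly_nice 0 1 PR^`())) _.
  rewrite subr0 mulr1 => h.
  apply: le_trans (ler_wpM2l (ltW e0) (h _)) _.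
    by move=> x x0 x1; rewrite ler_pdivlMr // mulrC; case: (hR x x0 x1).
  exact: le_trans he h2.
- have := Itg_sqr_le (M := eta) ler01 (niceB nu (poly_nice 0 1 PR)) _.
  by rewrite subr0 mulr1; apply => x x0 x1; case: (hR x x0 x1).
- rewrite mulrDl [eta ^+ 2 / gam]mulrC; apply: lerD => //.
  by move: he; rewrite expr_div_n; congr (_ <= _); field; rewrite gt_eqF.
- by rewrite !mulr_ge0 ?sqr_ge0.
Qed.

Lemma flux_gap (e eta x y z s : R) : `|e * (x - y)| <= eta -> `|e * (x - z)| <= eta -> `|s| <= eta ->
  `|e * z - (e * y - s)| <= 3 * eta.
Proof. by rewrite !ler_norml => /andP[? ?] /andP[? ?] /andP[? ?]; apply/andP; split; lra. Qed.

(** S is 0 on the coarse cell, so [e] is divided out only over the layer cell, whose width is at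
    most 2 kap p e; the flux jump at a is the one new term. *)
Lemma wg_error_mesh2 (e eta kap a : R) (p : nat) (u : R -> R) (up : wpair (mesh2 a)) (PR S PL : {poly R}) :
  0 < e -> e <= 1 -> (0 < p)%N -> 0 <= eta -> 0 <= kap -> 0 < a -> a < 1 -> 1 - a <= 2 * kap * p%:R * e ->
  bvp_solution e b r f u -> wg_solution e b r f p up ->
  (size PR <= p.+1)%N -> (size S <= p)%N -> (size PL <= p.+1)%N -> PR.[1] = 0 -> PL.[0] = 0 -> PL.[a] = PR.[a] ->
  (forall x, a < x -> x < 1 ->
      [/\ `|u x - PR.[x]| <= eta, e * `|jetof u 1 x - (PR^`()).[x]| <= eta, `|S.[x]| <= eta &
      `|f x - (- e * (PR^`()^`()).[x] + b x * (PR^`()).[x] + r x * PR.[x]) - (S^`()).[x]| <= eta]) ->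
  (forall x, 0 < x -> x < a ->
      [/\ `|u x - PL.[x]| <= eta, e * `|jetof u 1 x - (PL^`()).[x]| <= eta &
      `|f x - (- e * (PL^`()^`()).[x] + b x * (PL^`()).[x] + r x * PL.[x])| <= eta]) ->
  wgnorm e b p (subw (embed (mesh2 a) u) up) <= Num.sqrt (Kp kap * p%:R * eta ^+ 2).
Proof.
move=> e0 e1 p0 eta0 k0 a0 a1 hk hu hup sP sS sL PR1 PL0 PLR hR hL.
have gp := gam_gt0; have al := ltW a0; have ar := ltW a1.
have [nu nu1 nu2] := sol_nice e0 e1 hu; have [jU eU] := sol_jet jB jQ jF e0 hu; have [cu _ _ _] := hu.
have nb : nice 0 1 b := geom_nice 0 jB gB.
have nb1 : nice 0 1 (jetof b 1) := geom_nice 1 jB gB.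
have nr : nice 0 1 r := geom_nice 0 jQ gQ.
have nf : nice 0 1 f := geom_nice 0 jF gF.
pose P (j : 'I_2) := if j == 0%N :> nat then PL else PR.
pose T (j : 'I_2) := if j == 0%N :> nat then 0 else S.
pose w (i : 'I_3) : R := if i == 1%N :> nat then PR.[a] else 0.
have niceL k : nice 0 1 k -> nice 0 a k by exact: nice_sub.
have niceR k : nice 0 1 k -> nice a 1 k by exact: nice_sub.
have nice2 k : nice 0 1 k -> forall j, nice (node (@lidx R (mesh2 a) j)) (node (@ridx R (mesh2 a) j)) k.
  by move=> nk; apply: mesh2_ind; rewrite ?mesh2_0l ?mesh2_0r ?mesh2_1l ?mesh2_1r; [exact: niceL|exact: niceR].
have cont2 (k : R -> R) : {within `[0, 1], continuous k} -> forall j,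
    {within `[node (@lidx R (mesh2 a) j), node (@ridx R (mesh2 a) j)], continuous k}.
  move=> ck; apply: mesh2_ind; rewrite ?mesh2_0l ?mesh2_0r ?mesh2_1l ?mesh2_1r;
  apply: continuous_subspaceW ck => x /=; rewrite !in_itv /=; lra.
have der2 (k k1 : R -> R) : derOn 0 1 k k1 -> forall j,
    derOn (node (@lidx R (mesh2 a) j)) (node (@ridx R (mesh2 a) j)) k k1.
  move=> dk; apply: mesh2_ind; rewrite ?mesh2_0l ?mesh2_0r ?mesh2_1l ?mesh2_1r => x h1 h2; apply: dk => //.
    exact: lt_trans a1.
  exact: lt_trans h1.
have fluxc (q : {poly R}) : {for a, continuous (fun x => e * (jetof u 1 x - (q^`()).[x]))}.
  exact: d_cont (dZ e (dB (jU 1%N a a0 a1) (dhorner _ a))).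
(* u' is continuous at a, so the bounds inside both cells pass to the transition point; there they
   control the flux jump of P. *)
have fluxR : `|e * (jetof u 1 a - (PR^`()).[a])| <= eta.
  apply: (closed_norm_le a1 (fluxc PR)) => // y ay y1.
  by rewrite normrM gtr0_norm //; case: (hR y ay y1).
have fluxL : `|e * (jetof u 1 a - (PL^`()).[a])| <= eta.
  apply: (closed_norm_le a0 (fluxc PL)) => // y y0 ya.
  by rewrite normrM gtr0_norm //; case: (hL y y0 ya).
have fluxS : `|S.[a]| <= eta.
  by apply: (closed_norm_le a1 (@horner_cont _ S a)) => // y ay y1; case: (hR y ay y1).
have he : (1 - a) / e <= 2 * kap * p%:R by rewrite ler_pdivrMr.
have W := @wg_error R (mesh2 a) (mesh2_ok a0 a1) e gam b (jetof b 1) r f p P T w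
  (fun=> eta) (fun j : 'I_2 => if j == 0%N :> nat then 0 else eta) (18 * kap * p%:R * eta ^+ 2) e0 gp p0.
apply: le_trans (W _ _ _ _ _ _ _ _ _ _ _ _ _ _ _ _ _ up hup u (jetof u 1) _ _ _ _) _; clear W.
- by apply: mesh2_ind.
- by apply: mesh2_ind; rewrite /T //= size_poly0.
- apply: mesh2_ind; rewrite ?mesh2_0l ?mesh2_1l /w /P //=.
- apply: mesh2_ind; rewrite ?mesh2_0r ?mesh2_1r /w /P //=.
- by [].
- by [].
- exact: cont2.
- exact: der2 (jB 0%N).
- exact: nice2.
- exact: nice2.
- exact: nice2.
- exact: nice2.
- apply: mesh2_ind; rewrite ?mesh2_0l ?mesh2_0r ?mesh2_1l ?mesh2_1r => x h1 h2; apply: hgam => //.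
    exact: lt_trans a1.
  exact: lt_trans h1.
- move=> i; apply: ltW; apply: b_gt0; rewrite /= (tnth_nth 0); case: i => -[|[|[|//]]] //= _; exact: ler01.
- apply: mesh2_ind; rewrite ?mesh2_0l ?mesh2_0r ?mesh2_1l ?mesh2_1r /P /T /= => x h1 h2.
    by rewrite derivC horner0 subr0; case: (hL x h1 h2).
  by case: (hR x h1 h2).
- apply: mesh2_ind; rewrite ?mesh2_0l ?mesh2_0r ?mesh2_1l ?mesh2_1r /T /= => x h1 h2.
    by rewrite horner0 normr0.
  by case: (hR x h1 h2).
- move=> De eb E0 E1 hD; rewrite !mesh2_sum.
  have r1 : ridx (cellR : 'I_(cells (mesh2 a))) = ord_max by exact: val_inj.
  have l0 : lidx (cellL : 'I_(cells (mesh2 a))) = ord0 by exact: val_inj.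
  have r0 : ridx (cellL : 'I_(cells (mesh2 a))) = lidx (cellR : 'I_(cells (mesh2 a))) by exact: val_inj.
  (* Since e_b(1) = 0, the value e_b(a) is minus the integral of De over the layer cell; Young's
     inequality then costs only (3 eta)^2 (1 - a) / e. *)
  have D1 := hD cellR; rewrite mesh2_1l mesh2_1r r1 E1 sub0r in D1.
  rewrite mesh2_1l mesh2_1r r1 l0 r0 mesh2_1l E0 E1 !mul0r subr0 sub0r /P /T /= horner0 subr0.
  set y := eb _ in D1 *; set c := e * (PL^`()).[a] - (e * (PR^`()).[a] - S.[a]).
  have c3 : `|c| <= 3 * eta.
    exact: (flux_gap fluxR fluxL fluxS).
  have ny : - (y * (e * (PL^`()).[a]) - y * (e * (PR^`()).[a] - S.[a])) = Itg a 1 (fun x => c * (De cellR).[x]).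
    by rewrite ItgZ ?D1; [rewrite /c; ring|exact: poly_nice].
  rewrite ny; apply: le_trans (ler_norm _) _.
  apply: le_trans (Itg_young (M := 3 * eta) e0 (niceC a 1 c) (poly_nice a 1 (De cellR)) ar _) _ => //.
  apply: lerD.
    rewrite mulrDr [e / 4]mulrC -mulrA lerDr; apply: mulr_ge0; first by rewrite invr_ge0.
    apply: mulr_ge0; first exact: ltW.
    by apply: Itg_ge0 => x _ _; rewrite -expr2 sqr_ge0.
  have -> : (3 * eta) ^+ 2 / e * (1 - a) = 9 * eta ^+ 2 * ((1 - a) / e) by ring.
  have -> : 18 * kap * p%:R * eta ^+ 2 = 9 * eta ^+ 2 * (2 * kap * p%:R) by ring.
  by apply: ler_wpM2l => //; apply: mulr_ge0 => //; exact: sqr_ge0.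
- exact: (cont2 _ cu).
- exact: der2 (jU 0%N).
- exact: nice2.
- exact: nice2.
apply: ler_wsqrtr; rewrite !mesh2_sum mesh2_0l mesh2_0r mesh2_1l mesh2_1r /P /= subr0.
have C0' := Cb_ge0.
have e20 : 0 <= eta ^+ 2 by exact: sqr_ge0.
have he2 : (1 - a) / e * eta ^+ 2 <= 2 * kap * p%:R * eta ^+ 2 by apply: ler_wpM2r.
apply: error_budget => //.
- by rewrite ler1n.
- rewrite addrC -addrA mulrDl; apply: lerD.
    have := Itg_sqr_le (M := eta / e) ar (niceR _ (niceB nu1 (poly_nice 0 1 PR^`()))) _.
    move=> h; apply: le_trans (ler_wpM2l (ltW e0) (h _)) _.
      by move=> x x0 x1; rewrite ler_pdivlMr // mulrC; case: (hR x x0 x1).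
    by apply: le_trans he2; rewrite le_eqVlt; apply/orP; left; apply/eqP; field; rewrite gt_eqF.
  (* On the coarse cell the pointwise bound e |E'| <= eta would leave eta^2 / e; the energy identity
     avoids the factor 1/e. *)
  apply: (@energy_bound _ e eta Cb a b (jetof b 1) r (fun x => u x - PL.[x])
     (fun x => jetof u 1 x - (PL^`()).[x]) (fun x => jetof u 2 x - (PL^`()^`()).[x])) => //.
  + by move=> x x0 xa; apply: (jB 0%N) => //; exact: lt_trans a1.
  + by move=> x x0 xa; apply: dB (dhorner _ _); apply: (jU 0%N) => //; exact: lt_trans a1.
  + by move=> x x0 xa; apply: dB (dhorner _ _); apply: (jU 1%N) => //; exact: lt_trans a1.
  + exact: niceL.
  + exact: niceL (niceB nu (poly_nice _ _ _)).
  + exact: niceL (niceB nu1 (poly_nice _ _ _)).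
  + exact: niceL (niceB nu2 (poly_nice _ _ _)).
  + by move=> x x0 xa; apply: (data_bounds C0_gt0 g_ge0 gB gQ) => //; exact: lt_trans a1.
  + move=> x x0 xa; have [h1 h2 h3] := hL x x0 xa; split=> //.
    have := eU 0%N x x0 (lt_trans xa a1); rewrite !leib0 => E.
    have fE : f x = b x * jetof u 1 x + r x * u x - e * jetof u 2 x by rewrite E /jetof /=; ring.
    by move: h3; rewrite fE; congr (`| _ | <= _); ring.
- have H1 := Itg_sqr_le (M := eta) al (niceL _ (niceB nu (poly_nice 0 1 PL))) _.
  have H2 := Itg_sqr_le (M := eta) ar (niceR _ (niceB nu (poly_nice 0 1 PR))) _.
  apply: le_trans (lerD (H1 _) (H2 _)) _.
  + by move=> x x0 x1; case: (hL x x0 x1).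
  + by move=> x x0 x1; case: (hR x x0 x1).
  by rewrite -mulrDr subr0 addrC subrK mulr1.
- rewrite expr0n /= mul0r addr0.
  have -> : eta ^+ 2 / gam * a + (eta ^+ 2 / gam + eta ^+ 2 / e) * (1 - a) =
    gam^-1 * eta ^+ 2 + (1 - a) / e * eta ^+ 2 by ring.
  by rewrite (mulrDl gam^-1) lerD2l.
Qed.

End Estimate.

(** * Absorbing the degree and conclusion *)

Lemma sqrt_rate (R : realType) (K s C : R) (p : nat) : 0 <= K -> 0 < s -> 0 <= C ->
  Num.sqrt (K * p%:R * (C * expR (- s * p%:R)) ^+ 2) <= Num.sqrt (K / s) * C * expR (- (s / 2) * p%:R).
Proof.
move=> K0 s0 C0; set X := _ * _ * expR _.
have X0 : 0 <= X by rewrite /X !mulr_ge0 ?sqrtr_ge0 ?expR_ge0.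
rewrite -[leRHS](ger0_norm X0) -sqrtr_sqr; apply: ler_wsqrtr.
rewrite /X !exprMn sqr_sqrtr; last by apply: divr_ge0 => //; exact: ltW.
have -> : expR (- (s / 2) * p%:R) ^+ 2 = expR (- s * p%:R).
  by rewrite -expRM_natl; congr expR; field.
set E := expR (- s * p%:R).
have E0 : 0 <= E by exact: expR_ge0.
(* One of the two factors exp(-s p) absorbs p; the other gives the rate s/2 under the square
   root. *)
have pE : p%:R * E <= s^-1.
  have h : s * p%:R <= expR (s * p%:R) by apply: le_trans (expR_ge1Dx _); rewrite lerDr.
  rewrite /E mulNr expRN ler_pdivrMr ?expR_gt0 // mulrC ler_pdivlMr //.
  by rewrite mulrC.
have -> : K * p%:R * (C ^+ 2 * E ^+ 2) = K * C ^+ 2 * E * (p%:R * E) by ring.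
have -> : K / s * C ^+ 2 * E = K * C ^+ 2 * E * s^-1 by ring.
apply: ler_wpM2l => //; apply: mulr_ge0 => //; apply: mulr_ge0 => //; exact: sqr_ge0.
Qed.

Theorem proposition3 (R : realType) (b r f : R -> R)
    (C0 gb gr gf gamma : R)
    (hC0 : 0 < C0) (hgb : 0 < gb) (hgr : 0 < gr) (hgf : 0 < gf)
    (hb : analytic01 C0 gb b) (hr : analytic01 C0 gr r)
    (hf : analytic01 C0 gf f)
    (b_gt0 : forall x : R, x \in `[0, 1] -> 0 < b x)
    (r_ge0 : forall x : R, x \in `[0, 1] -> 0 <= r x)
    (hgamma : 0 < gamma)
    (hrb : forall x : R, x \in `]0, 1[ -> gamma <= r x - 2^-1 * derive1 b x) :
  exists c0 kappa sigma C : R,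
    [/\ 0 < c0 < 1, 0 < kappa, 0 < sigma, 0 < C &
      forall (p : nat) (e1 : R), (1 <= p)%N -> 0 < e1 <= c0 ->
      forall (u : R -> R) (up : wpair (SBLmesh kappa p e1)),
        bvp_solution e1 b r f u ->
        wg_solution e1 b r f p up ->
        wgnorm e1 b p (subw (embed (SBLmesh kappa p e1) u) up)
          <= C * expR (- sigma * p%:R)].
Proof.
(* One growth constant for the three data. *)
pose g := gb + gr + gf.
have g0 : 0 <= g by rewrite /g; lra.
have gB : geom_bound C0 g (jetof b) by apply: analytic01_bound hb; rewrite /g; lra.
have gQ : geom_bound C0 g (jetof r) by apply: analytic01_bound hr; rewrite /g; lra.
have gF : geom_bound C0 g (jetof f) by apply: analytic01_bound hf; rewrite /g; lra.
have jB := analytic01_jet hb; have jQ := analytic01_jet hr; have jF := analytic01_jet hf.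
have cb := hb.1.
(* The lower bound of b is its minimum on [0,1], hence independent of [e] and p. *)
have [m mI hm] := EVT_min (@ler01 R) cb.
have b0 := b_gt0 m mI.
have hbm x : 0 < x -> x < 1 -> b m <= b x.
  by move=> x0 x1; apply: hm; rewrite in_itv /= !ltW.
have bpos x : 0 <= x -> x <= 1 -> 0 < b x by move=> x0 x1; apply: b_gt0; rewrite in_itv /= x0.
have rpos x : 0 < x -> x < 1 -> 0 <= r x by move=> x0 x1; apply: r_ge0; rewrite in_itv /= !ltW.
have hgam x : 0 < x -> x < 1 -> gamma <= r x - 2^-1 * jetof b 1 x.
  by move=> x0 x1; apply: hrb; rewrite in_itv /= x0.
have [D [C [s [D0 C_gt0 s0 happ]]]] := approximant hC0 g0 b0 jB jQ jF gB gQ gF cb hbm rpos.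
pose kap : R := D%:R^-1; have k0 : 0 < kap by rewrite invr_gt0 ltr0n.
pose K := 4 * kap + 8 + 8 * (C0 * (1 + g)) + (4 + 4 / gamma) * (gamma^-1 + 20 * kap).
have K0 : 0 <= K.
  have h1 : 0 <= C0 * (1 + g) by apply: mulr_ge0; lra.
  have h2 : 0 <= gamma^-1 by rewrite invr_ge0 ltW.
  have h3 : 0 <= (4 + 4 / gamma) * (gamma^-1 + 20 * kap) by apply: mulr_ge0; lra.
  by rewrite /K; lra.
(* The summand 1 makes the constant positive, K being only known to be nonnegative at this point. *)
exists 2^-1, kap, (s / 2), (Num.sqrt (K / s) * C + 1).
have sK : 0 <= Num.sqrt (K / s) * C by rewrite mulr_ge0 ?sqrtr_ge0 ?(ltW C_gt0).
split; [by apply/andP; split; lra|by []|by rewrite divr_gt0|by rewrite ltr_wpDl|].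
move=> p e p1 /andP[e0 e12] u up hu hup; have e1 : e <= 1 by lra.
set eta := C * expR (- s * p%:R).
have eta0 : 0 <= eta by rewrite mulr_ge0 ?expR_ge0 ?(ltW C_gt0).
suff key : wgnorm e b p (subw (embed (SBLmesh kap p e) u) up) <= Num.sqrt (K * p%:R * eta ^+ 2).
  apply: le_trans key _; apply: le_trans (sqrt_rate p K0 s0 (ltW C_gt0)) _.
  by apply: ler_wpM2r; [exact: expR_ge0|rewrite lerDl].
have := happ p e u p1 e0 e1 hu; rewrite -/eta -/kap.
move: up hup; rewrite /SBLmesh; case: ifPn => hk up hup [PR [S [PL [[sR sS sL] [R1 L0 LR] hR hL]]]].
- have kpe : 0 < kap * p%:R * e by rewrite !mulr_gt0 ?ltr0n.
  apply: (@wg_error_mesh2 R b r f C0 g (b m) gamma hC0 g0 b0 hgamma jB jQ jF gB gQ gF cb hbm bpos rpos hgam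
    e eta kap (1 - kap * p%:R * e) p u up PR S PL) => //; try exact: ltW; lra.
- rewrite subrr in LR hR.
  apply: (@wg_error_mesh1 R b r f C0 g (b m) gamma hC0 g0 b0 hgamma jB jQ jF gB gQ gF cb hbm bpos rpos hgam
    e eta kap p u up PR S) => //; [exact: ltW| |by rewrite -LR].
  by rewrite -leNgt in hk; lra.
Qed.
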